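(* Let $\lambda$ be a generic normalized additively alternating $n\times n$ complex matrix, $q=\operatorname{EExp}(\lambda)$, $b$ its biresidue matrix, and $I\subseteq\{0,\dots,n-2\}$ such that $\{i,i+1\}$ is a smoothable edge of $b$ for every $i\in I$. For every choice of nonzero constants $\gamma_i\in\mathbb{C}$, $i\in I$, the algebra $\mathsf{A}_q$ admits a flat filtered deformation to a quadratic $\mathbb{C}[\varepsilon]$-algebra $\mathbb{C}\langle x_0,\dots,x_{n-1}\rangle[\varepsilon]/J_{q,I}$ whose two-sided ideal $J_{q,I}$ is generated by elements $$r_{ab}(\varepsilon)=-x_bx_a+q_{ba}x_ax_b+\sum_{m=1}^N\varepsilon^m\Big(\sum_{\substack{-e_a-e_b+e_k+e_\ell\in\Theta_m\\k\le\ell}}C^{k\ell}_{ba}x_kx_\ell\Big),\qquad a<b,$$ for some $N\ge1$ and constants $C^{k\ell}_{ba}\in\mathbb{C}$ with $C^{k\ell}_{ba}=\gamma_i$ whenever $-e_a-e_b+e_k+e_\ell=\boldsymbol\theta_i$. Specializing $\varepsilon$ to any value in $\mathbb{C}^\times$ gives a quadratic $\mathbb{C}$-algebra $\mathsf{A}_{q,I}$ that is, up to a filtered automorphism of $\mathsf V^*=\operatorname{span}(x_0,\dots,x_{n-1})$, independent of the nonzero constants $\gamma_i$ and of $\varepsilon$. Moreover, if no $\Theta_m$ with $m\ge1$ contains a weight of the form $e_a-e_b$, then the constants $C^{k\ell}_{ba}$ are uniquely determined by the $\gamma_i$, $i\in I$.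
   Context: Multiplicatively alternating $q$: nonzero entries, $q_{ii}=1$, $q_{ji}=q_{ij}^{-1}$; $\mathsf{A}_q=\mathbb{C}\langle x_0,\dots,x_{n-1}\rangle/(x_ix_j-q_{ij}x_jx_i)$. Additively alternating $\lambda$: $\lambda_{ji}=-\lambda_{ij}$; normalized: rows sum to zero; $\operatorname{EExp}(\lambda)=(e^{\lambda_{ij}})$. $e_a$ are the standard basis vectors of $\mathbb{Z}^n$; $x_a$ has torus weight $e_a$. A weight $\mathbf w\in\mathbb{Z}^n$ is relevant if $w_i\ge-1$ and $\sum w_i=0$; $q$-Hochschild-contributing if $w_i\ge-1$ for all $i$ and $\prod_jq_{ij}^{w_j}=1$ whenever $w_i\ge0$; $\lambda$-Poisson-contributing if $w_i\ge-1$ for all $i$ and $\sum_j\lambda_{ij}w_j=0$ whenever $w_i\ge0$. $\lambda$ is generic if rank $\lambda=n-1$ and every relevant $\operatorname{EExp}(\lambda)$-Hochschild-contributing weight is $\lambda$-Poisson-contributing. Biresidue matrix: the unique normalized alternating $b$ with $b|_\Delta=(\lambda|_\Delta)^{-1}$, $\Delta=\{z\in\mathbb{C}^n:\sum z_i=0\}$. An edge $\{i,j\}$ is smoothable if $b_{ij}\ne0$ and $(b_{jk}+b_{ki})/b_{ij}\in\mathbb{Z}_{\ge0}$ for $k\ne i,j$; its smoothable weight has entries $-1$ at $i,j$ and $(b_{jk}+b_{ki})/b_{ij}$ at $k\ne i,j$. $\boldsymbol\theta_i$ is the smoothable weight of $\{i,i+1\}$; $\Theta_m=\{\boldsymbol\theta_{i_1}+\dots+\boldsymbol\theta_{i_m}:i_1,\dots,i_m\in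 I\}$. The filtration $\mathcal F_a$ of $\mathbb{C}\langle x_0,\dots,x_{n-1}\rangle$ is spanned by words whose weight lies in $\Theta_m+\mathbb{Z}_{\ge0}^n$ for some $m\ge a$; ''flat filtered deformation'' means the quotient is a free $\mathbb{C}[\varepsilon]$-module reducing to $\mathsf{A}_q$ at $\varepsilon=0$, with deformed relations compatible with this filtration as displayed. *)

(* Defs.v *)
From HB Require Import structures.
From mathcomp Require Import all_boot all_order all_algebra.
From mathcomp Require Import complex Rstruct.
From Stdlib Require Rtrigo_def.
Set Implicit Arguments. Unset Strict Implicit. Unset Printing Implicit Defensive.
Import Order.TTheory GRing.Theory Num.Theory.
Local Open Scope ring_scope.

Definition CC : fieldType := complex.complex Rdefinitions.R.

Definition cexp (z : CC) : CC :=
  let x : Rdefinitions.R := complex.Re z in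
  let y : Rdefinitions.R := complex.Im z in
  ((Rtrigo_def.exp x)%:C * ((Rtrigo_def.cos y)%:C + 'i * (Rtrigo_def.sin y)%:C))%C.

Section Defs.
Variable n : nat.

Definition weight := {ffun 'I_n -> int}.
Definition ew (k : 'I_n) : weight := [ffun i => ((i == k) : nat)%:Z].

Definition mult_alternating (q : 'M[CC]_n) : Prop :=
  [/\ forall i j, q i j != 0, forall i, q i i = 1 & forall i j, q j i = (q i j)^-1].
Definition add_alternating (l : 'M[CC]_n) : Prop := forall i j, l j i = - l i j.
Definition normalized (l : 'M[CC]_n) : Prop := forall i, \sum_j l i j = 0.
Definition EExp (l : 'M[CC]_n) : 'M[CC]_n := \matrix_(i, j) cexp (l i j).

Definition relevant (w : weight) : Prop :=
  (forall i, -1 <= w i) /\ \sum_i w i = 0.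
Definition hochschild_contributing (q : 'M[CC]_n) (w : weight) : Prop :=
  (forall i, -1 <= w i) /\ (forall i, 0 <= w i -> \prod_j (q i j) ^ (w j) = 1).
Definition poisson_contributing (l : 'M[CC]_n) (w : weight) : Prop :=
  (forall i, -1 <= w i) /\ (forall i, 0 <= w i -> \sum_j l i j * (w j)%:~R = 0).
Definition generic (l : 'M[CC]_n) : Prop :=
  \rank l = n.-1 /\
  forall w, relevant w -> hochschild_contributing (EExp l) w -> poisson_contributing l w.

Definition inDelta (z : 'cV[CC]_n) : Prop := \sum_i z i 0 = 0.
(** b is the biresidue matrix of l: normalized alternating, and b|Delta is the
    inverse of l|Delta (l maps Delta to Delta). *)
Definition is_biresidue (l b : 'M[CC]_n) : Prop :=
  [/\ add_alternating b, normalized b &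
      forall z, inDelta z -> b *m (l *m z) = z /\ l *m (b *m z) = z].

Definition smoothable (b : 'M[CC]_n) (i j : 'I_n) : Prop :=
  b i j != 0 /\
  forall k, k != i -> k != j -> exists m : nat, (b j k + b k i) / b i j = m%:R.
Definition smoothable_weight (b : 'M[CC]_n) (i j : 'I_n) (w : weight) : Prop :=
  [/\ w i = -1, w j = -1 &
      forall k, k != i -> k != j -> (w k)%:~R = (b j k + b k i) / b i j].

Definition inTheta (I : {set 'I_n}) (theta : 'I_n -> weight) (m : nat) (w : weight) : bool :=
  [exists t : m.-tuple 'I_n, all (fun i => i \in I) t && (w == \sum_(i <- t) theta i)].

(** x_k lies in F_a (the filtration restricted to V^* = span x_k):
    its weight e_k lies in Theta_m + Z_{>=0}^n for some m >= a. *)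
Definition inF (I : {set 'I_n}) (theta : 'I_n -> weight) (a : nat) (k : 'I_n) : Prop :=
  exists m : nat, (a <= m)%N /\
    exists w : weight, inTheta I theta m w /\ forall i, 0 <= ew k i - w i.

(** ---- Free algebra K<x_0..x_{n-1}> : finite formal sums of words ---- *)
Definition word := seq 'I_n.
Definition fa (K : Type) := seq (K * word).
Definition coef (K : nmodType) (f : fa K) (w : word) : K := \sum_(t <- f | t.2 == w) t.1.
Definition fa_opp (K : zmodType) (f : fa K) : fa K := [seq (- t.1, t.2) | t <- f].
Definition sandwich (K : comNzRingType) (c : K) (u v : word) (f : fa K) : fa K :=
  [seq (c * t.1, u ++ t.2 ++ v) | t <- f].
Definition in_ideal (K : comNzRingType) (r : 'I_n -> 'I_n -> fa K) (f : fa K) : Prop :=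
  exists s : seq ((K * word) * (('I_n * 'I_n) * word)),
    all (fun t => (val t.2.1.1 < val t.2.1.2)%N) s /\
    forall w, coef f w =
      coef (flatten [seq sandwich t.1.1 t.1.2 t.2.2 (r t.2.1.1 t.2.1.2) | t <- s]) w.
Definition lincomb (K : comNzRingType) (T : Type) (B : T -> fa K) (s : seq (K * T)) : fa K :=
  flatten [seq [seq (t.1 * u.1, u.2) | u <- B t.2] | t <- s].
Definition free_quotient (K : comNzRingType) (r : 'I_n -> 'I_n -> fa K) : Prop :=
  exists (T : eqType) (B : T -> fa K),
    (forall f, exists s : seq (K * T), in_ideal r (f ++ fa_opp (lincomb B s))) /\
    (forall s : seq (K * T), in_ideal r (lincomb B s) ->
       forall x : T, \sum_(t <- s | t.2 == x) t.1 = 0).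

Definition wt (a b k l : 'I_n) : weight := ew k + ew l - ew a - ew b.
Definition rel_coef (I : {set 'I_n}) (theta : 'I_n -> weight) (N : nat)
    (Cc : 'I_n -> 'I_n -> 'I_n -> 'I_n -> CC) (a b k l : 'I_n) : {poly CC} :=
  \sum_(1 <= m < N.+1 | inTheta I theta m (wt a b k l)) (Cc k l b a)%:P * 'X^m.
Definition rel_ab (q : 'M[CC]_n) (I : {set 'I_n}) (theta : 'I_n -> weight) (N : nat)
    (Cc : 'I_n -> 'I_n -> 'I_n -> 'I_n -> CC) (a b : 'I_n) : fa {poly CC} :=
  [:: (-1, [:: b; a]); ((q b a)%:P, [:: a; b])] ++
  [seq (rel_coef I theta N Cc a b kl.1 kl.2, [:: kl.1; kl.2])
     | kl <- enum [pred kl : 'I_n * 'I_n | (val kl.1 <= val kl.2)%N]].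

Definition deformation_data (q : 'M[CC]_n) (I : {set 'I_n}) (theta : 'I_n -> weight)
    (gamma : 'I_n -> CC) (N : nat) (Cc : 'I_n -> 'I_n -> 'I_n -> 'I_n -> CC) : Prop :=
  [/\ (1 <= N)%N,
      forall a b k l i, (val a < val b)%N -> (val k <= val l)%N -> i \in I ->
        wt a b k l = theta i -> Cc k l b a = gamma i &
      free_quotient (rel_ab q I theta N Cc)].

Definition spec_eps (r : 'I_n -> 'I_n -> fa {poly CC}) (e : CC) : 'I_n -> 'I_n -> fa CC :=
  fun a b => [seq (t.1.[e], t.2) | t <- r a b].

(** algebra endomorphism of C<x> induced by x_k |-> sum_l P k l x_l *)
Definition subst_word (P : 'M[CC]_n) (w : word) : fa CC :=
  [seq (\prod_(p <- zip w u) P p.1 p.2, u)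
     | u <- [seq val t | t <- enum {: (size w).-tuple 'I_n}]].
Definition subst (P : 'M[CC]_n) (f : fa CC) : fa CC :=
  flatten [seq [seq (t.1 * s.1, s.2) | s <- subst_word P t.2] | t <- f].
Definition filtered (I : {set 'I_n}) (theta : 'I_n -> weight) (P : 'M[CC]_n) : Prop :=
  forall a k l, inF I theta a k -> P k l != 0 -> inF I theta a l.
Definition filtered_iso (I : {set 'I_n}) (theta : 'I_n -> weight)
    (r1 r2 : 'I_n -> 'I_n -> fa CC) : Prop :=
  exists P : 'M[CC]_n, [/\ P \in unitmx, filtered I theta P &
    forall f, in_ideal r1 f <-> in_ideal r2 (subst P f)].

End Defs.

(* Main.v *)
(** The algebra is modelled on the free C[eps]-module spanned by ordered monomials,
    with [x_i] acting by normal ordering; the quadratic relations hold for this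
    action up to defects, which vanish as soon as they vanish on the overlaps
    [x_c x_b x_a]. At the first order m where defects appear, those of torus weight
    w form a cocycle for the Koszul differential of multiplication by
    (chi_i(w) - 1)_i, where chi_i(w) = prod_j q_ij^(w_j), and changing the
    coefficients of weight w alters it by a coboundary. So the obstruction can be
    removed whenever some i has w_i >= 0 and chi_i(w) <> 1.

    Such an i exists for every w in Theta_m, m >= 2, with entries >= -1 and at most
    three entries -1: otherwise genericity makes lambda w vanish wherever w >= 0;
    but lambda theta_i is a multiple of e_i - e_(i+1), so this leaves too few places
    for the multiplicities of the theta_i to change, and w would have an entry -2.
    For uniqueness the same i shows that the difference of two solutions, a cocycle
    supported on a single pair {a, b}, is zero.

    The theta_i are linearly independent, so the torus acting by x_k |-> s_k x_k moves
    any gamma, and any eps, to any other. Weights only permit finitely many orders. *)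

Require Import Defs.
From HB Require Import structures.
From mathcomp Require Import all_boot all_order all_algebra.
From mathcomp Require Import complex Rstruct.
From mathcomp Require Import freeg.
From mathcomp Require Import ring zify.
From Stdlib Require Cos_plus Rtrigo1 Exp_prop ClassicalEpsilon.
Set Implicit Arguments. Unset Strict Implicit. Unset Printing Implicit Defensive.
Import Order.TTheory GRing.Theory Num.Theory.
Local Open Scope ring_scope.

(** Height one is special. For [w = theta i] every [chi k w] with [w k >= 0] equals 1, so no
    contracting index exists there; for the same reason the coboundary of a coefficient placed on
    the edge itself vanishes, and these coefficients can be prescribed. It is enough to prescribe 1:
    an arbitrary [gamma] is reached afterwards through the torus.

    One comparison principle, [intertwine], replaces it: a map that respects the operators on
    ordered products, into a target where the relations hold at the critical monomials, respects
    them everywhere, all modulo a graded family of errors. With different targets it gives leading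
    terms, approximate right multiplication, the effect of changing coefficients, and reduction
    modulo the ideal. A correction term of a relation has order at least 1, so an error of order s
    that passes through it has order s + 1; this gain allows one order to be solved at a time. *)

Section FreeModule.
Variables (R : comNzRingType) (T : choiceType).
Implicit Types (D : {freeg T / R}) (s : seq (R * T)).

Lemma fglift_scalable (N : lmodType R) (f : T -> N) : scalable (fglift f : {freeg T / R} -> N).
Proof.
move=> c D; rewrite -[D](freeg_repr) /=; set s := (X in [freeg X]).
have -> : c *: [freeg s] = [freeg [seq (c * x.1, x.2) | x <- s]] :> {freeg T / R}.
  apply/eqP/freeg_eqP => x; rewrite coeffZ !coeff_Freeg /precoeff big_map /=.
  by rewrite mulr_sumr.
rewrite !fglift_Freeg /prelift big_map scaler_sumr.
by apply: eq_bigr => x _; rewrite scalerA.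
Qed.

Lemma fglift_additive (N : lmodType R) (f : T -> N) :
  additive (fglift f : {freeg T / R} -> N).
Proof. exact: lift_is_additive. Qed.

HB.instance Definition _ (N : lmodType R) (f : T -> N) :=
  GRing.isAdditive.Build {freeg T / R} N (fglift f) (fglift_additive f).
HB.instance Definition _ (N : lmodType R) (f : T -> N) :=
  GRing.isScalable.Build R {freeg T / R} N *:%R (fglift f) (fglift_scalable f).

Lemma fgliftT (N : lmodType R) (f : T -> N) x : fglift f (<< x >> : {freeg T / R}) = f x.
Proof. by rewrite liftU scale1r. Qed.

Lemma coeffT x y : coeff y (<< x >> : {freeg T / R}) = (x == y)%:R.
Proof. by rewrite coeffU mul1r. Qed.

Lemma freeg_scaleE c x : c *: << x >> = << c *g x >> :> {freeg T / R}.
Proof. by apply/eqP/freeg_eqP => y; rewrite coeffZ !coeffU mul1r. Qed.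

Lemma coeff_sum (I : Type) (r : seq I) (P : pred I) (F : I -> {freeg T / R}) x :
  coeff x (\sum_(i <- r | P i) F i) = \sum_(i <- r | P i) coeff x (F i).
Proof. exact: raddf_sum. Qed.

Lemma freegE D : D = \sum_(x <- dom D) coeff x D *: << x >>.
Proof.
by rewrite -{1}[D]freeg_sumE; apply: eq_bigr => x _; rewrite freeg_scaleE.
Qed.

Lemma linear_freegE (N : lmodType R) (f : {linear {freeg T / R} -> N}) D :
  f D = \sum_(x <- dom D) coeff x D *: f << x >>.
Proof. by rewrite {1}[D]freegE linear_sum; apply: eq_bigr => x _; rewrite linearZ. Qed.

(** The coefficient stays inside [P] because most predicates in use are graded: closed under sums,
    but only under scalars of the right weight. *)
Lemma linear_freeg_ind (N : lmodType R) (P : N -> Prop) (f : {linear {freeg T / R} -> N}) D :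
  P 0 -> (forall a b, P a -> P b -> P (a + b)) ->
  (forall x, coeff x D != 0 -> P (coeff x D *: f << x >>)) -> P (f D).
Proof.
move=> P0 PD H; rewrite linear_freegE big_seq_cond.
elim/big_rec: _ => // x y /andP[xD _] Py; apply: PD => //; apply: H.
by rewrite -mem_dom.
Qed.

Lemma eq_linear_freeg (N : lmodType R) (f g : {linear {freeg T / R} -> N}) D :
  (forall x, coeff x D != 0 -> f << x >> = g << x >>) -> f D = g D.
Proof.
move=> H; rewrite !linear_freegE big_seq_cond [RHS]big_seq_cond.
by apply: eq_bigr => x /andP[xD _]; rewrite H // -mem_dom.
Qed.

End FreeModule.

(** * Torus weights and the filtration *)

(** The weights [theta i] generate [cmem]; [cht w = m] encodes that [w] lies in
    Theta_m. The length [clen] drops by [cstep] along each [theta i], which is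
    what makes rewriting to ordered monomials terminate. *)
Record cone (n : nat) := Cone {
  cmem : pred (weight n);
  cht : weight n -> nat;
  clen : 'I_n -> nat;
  cstep : nat;
  cmem0 : cmem 0;
  cmemD : forall v w, cmem v -> cmem w -> cmem (v + w);
  clen_gt0 : forall i, (0 < clen i)%N;
  cstep_gt0 : (0 < cstep)%N;
  cht_len : forall w, cmem w -> \sum_i (clen i)%:Z * w i = - (cstep * cht w)%:Z;
  cht0_eq0 : forall w, cmem w -> cht w = 0%N -> w = 0
}.

Section Cone.
Variables (n : nat) (G : cone n).
Implicit Types (u v w : weight n) (i j k l : 'I_n).
Notation W := (weight n).

Definition wlen w : int := \sum_i (clen G i)%:Z * w i.

Lemma wlenD : {morph wlen : v w / v + w}.
Proof.
by move=> v w; rewrite -big_split; apply: eq_bigr => i _; rewrite ffunE mulrDr.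
Qed.

Lemma wlenN : {morph wlen : w / - w}.
Proof. by move=> w; rewrite -sumrN; apply: eq_bigr => i _; rewrite ffunE mulrN. Qed.

Lemma wlenB : {morph wlen : v w / v - w}.
Proof. by move=> v w; rewrite wlenD wlenN. Qed.

Lemma wlen_ew i : wlen (ew i) = (clen G i)%:Z.
Proof.
rewrite /wlen (bigD1 i) //= ffunE eqxx mulr1 big1 ?addr0 // => j /negPf ji.
by rewrite ffunE ji mulr0.
Qed.

Definition wpos w : bool := [forall i, 0 <= w i].

Lemma wposP w : reflect (forall i, 0 <= w i) (wpos w).
Proof. exact: forallP. Qed.

Lemma wlen_ge0 w : wpos w -> 0 <= wlen w.
Proof. by move=> /wposP w0; apply: sumr_ge0 => i _; apply: mulr_ge0. Qed.

Lemma wpos0 : wpos 0.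
Proof. by apply/wposP => i; rewrite ffunE. Qed.

Lemma wposD v w : wpos v -> wpos w -> wpos (v + w).
Proof. by move=> /wposP v0 /wposP w0; apply/wposP => i; rewrite ffunE addr_ge0. Qed.

Lemma wpos_ew i : wpos (ew i).
Proof. by apply/wposP => j; rewrite ffunE. Qed.

Hint Resolve wpos0 wposD wpos_ew : core.

Lemma cht_wlen w : cmem G w -> wlen w = - (cstep G * cht G w)%:Z.
Proof. exact: cht_len. Qed.

Lemma cht0 : cht G 0 = 0%N.
Proof.
have := cht_wlen (cmem0 G); have := cstep_gt0 G.
rewrite {1}/wlen big1 ?addr0 => [|i _]; last by rewrite ffunE mulr0.
nia.
Qed.

Lemma chtD v w : cmem G v -> cmem G w -> cht G (v + w) = (cht G v + cht G w)%N.
Proof.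
move=> mv mw; have := cht_wlen (cmemD mv mw); have := cstep_gt0 G.
rewrite wlenD (cht_wlen mv) (cht_wlen mw); nia.
Qed.

Lemma wlen_lt0 w : cmem G w -> w != 0 -> wlen w < 0.
Proof.
move=> mw w0; rewrite cht_wlen //.
have : (0 < cht G w)%N by rewrite lt0n; apply: contra_neq w0; apply: cht0_eq0.
have := cstep_gt0 G; nia.
Qed.

Section Homogeneous.
Variable K : fieldType.
Implicit Types (r : {poly K}).

(** Deforming coefficients are monomials in the parameter 'X whose exponent is
    the height of the torus weight they carry. *)
Definition homog (s : nat) w r : Prop :=
  r = 0 \/ [/\ cmem G w, (s <= cht G w)%N & exists c, r = c *: 'X^(cht G w)].

Lemma homogD s w r r' : homog s w r -> homog s w r' -> homog s w (r + r').
Proof.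
move=> [->|[mw sw [c ->]]]; first by rewrite add0r.
move=> [->|[_ _ [c' ->]]]; first by rewrite addr0; right; split=> //; exists c.
by right; split=> //; exists (c + c'); rewrite scalerDl.
Qed.

Lemma homogM s s' w w' r r' :
  homog s w r -> homog s' w' r' -> homog (s + s') (w + w') (r * r').
Proof.
move=> [->|[mw sw [c ->]]]; first by rewrite mul0r; left.
move=> [->|[mw' sw' [c' ->]]]; first by rewrite mulr0; left.
right; split; first exact: cmemD.
  by rewrite chtD // leq_add.
by exists (c * c'); rewrite chtD // exprD -scalerAl -scalerAr scalerA.
Qed.

Lemma homogC c : homog 0 0 c%:P.
Proof.
right; split; rewrite ?cht0 //; first exact: cmem0.
by exists c; rewrite expr0 alg_polyC.
Qed.

Lemma homogZ s w c r : homog s w r -> homog s w (c%:P * r).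
Proof. by move=> h; have := homogM (homogC c) h; rewrite add0n add0r. Qed.

Lemma homogN s w r : homog s w r -> homog s w (- r).
Proof. by move=> h; have := homogZ (-1) h; rewrite polyCN mulNr mul1r. Qed.

Lemma homog_le s s' w r : (s' <= s)%N -> homog s w r -> homog s' w r.
Proof. by move=> h [->|[mw sw e]]; [left|right; split=> //; apply: leq_trans sw]. Qed.

Lemma homog_gt s w r : (cht G w < s)%N -> homog s w r -> r = 0.
Proof. by move=> h [//|[_ sw _]]; move: h; rewrite ltnNge sw. Qed.

Lemma homog_mem s w r : homog s w r -> r != 0 -> cmem G w /\ (s <= cht G w)%N.
Proof. by move=> [->|[]//]; rewrite eqxx. Qed.

Notation M := {freeg (weight n) / {poly K}}.
Implicit Types (p : M).

(** [p] is homogeneous of torus weight [v] and divisible by the s-th power of the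
    filtration; [<< u >>] stands for the ordered monomial of weight [u]. *)
Definition fil v s p : Prop :=
  forall u, homog s (u - v) (coeff u p) /\ (coeff u p != 0 -> wpos u).

Lemma fil0 v s : fil v s 0.
Proof. by move=> u; rewrite coeff0 eqxx; split=> //; left. Qed.

Lemma filD v s p p' : fil v s p -> fil v s p' -> fil v s (p + p').
Proof.
move=> H H' u; have [h1 h2] := H u; have [h1' h2'] := H' u.
rewrite coeffD; split; first exact: homogD.
have [->|] := eqVneq (coeff u p) 0; first by rewrite add0r.
by move=> /h2 ->.
Qed.

Lemma filMZ v s s' w r p : homog s' w r -> fil (v + w) s p -> fil v (s' + s) (r *: p).
Proof.
move=> hr H u; have [h1 h2] := H u; rewrite coeffZ; split; last first.
  by move=> h; apply: h2; apply: contra_neq h => ->; rewrite mulr0.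
have -> : u - v = w + (u - (v + w)) by apply/ffunP=> i; rewrite !ffunE; ring.
exact: homogM.
Qed.

Lemma filZ v s c p : fil v s p -> fil v s (c%:P *: p).
Proof. by move=> H; apply: (@filMZ v s 0 0) (homogC c) _; rewrite addr0. Qed.

Lemma filN v s p : fil v s p -> fil v s (- p).
Proof. by move=> /(filZ (-1)); rewrite polyCN scaleN1r. Qed.

Lemma filB v s p p' : fil v s p -> fil v s p' -> fil v s (p - p').
Proof. by move=> h /filN h'; apply: filD. Qed.

Lemma fil_le v s s' p : (s' <= s)%N -> fil v s p -> fil v s' p.
Proof. by move=> h H u; have [h1 h2] := H u; split=> //; apply: homog_le h1. Qed.

Lemma fil_sum v s (J : Type) (t : seq J) (P : pred J) (F : J -> M) :
  (forall x, P x -> fil v s (F x)) -> fil v s (\sum_(x <- t | P x) F x).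
Proof. by move=> H; elim/big_rec: _ => [|y x Py]; [apply: fil0|apply/filD/H]. Qed.

Lemma fil_T v : wpos v -> fil v 0 << v >>.
Proof.
move=> v0 u; rewrite coeffT; case: eqVneq => [<-|_] /=; split=> //.
- by rewrite subrr -[1%:R]/(1%:P); exact: homogC.
- by left.
- by rewrite eqxx.
Qed.

(** Monomials with nonnegative exponents suffice as test elements, since a filtered element is
    supported on them; its coefficients account for the shift in weight and order. *)
Lemma fil_lin (f : {linear M -> M}) v s v' s' p :
  (forall u, wpos u -> fil (u + v') s' (f << u >>)) -> fil v s p ->
  fil (v + v') (s + s') (f p).
Proof.
move=> hf hp; apply: linear_freeg_ind; [exact: fil0|exact: filD|] => u nz.
have [h1 h2] := hp u; apply: (filMZ h1).
have -> : v + v' + (u - v) = u + v' by apply/ffunP=> i; rewrite !ffunE; ring.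
exact/hf/h2.
Qed.

End Homogeneous.
End Cone.
#[export] Hint Resolve wpos0 wposD wpos_ew : core.

(** * Ordered monomials and the defect of the relations *)

Ltac weq := apply/ffunP => ?; rewrite !ffunE; ring.

Section Relations.
Variables (n : nat) (K : fieldType) (q : 'I_n -> 'I_n -> K).
Variable cst : 'I_n -> 'I_n -> weight n -> {poly K}.
Variables (N : lmodType {poly K}) (Y : 'I_n -> {linear N -> N}).

(** Coefficients are indexed by torus weight so that homogeneity concerns a single argument; for
    ordered pairs the weight determines [(k, l)]. The module [N] is arbitrary because the formula is
    evaluated both on ordered monomials and on the free algebra. *)
Definition Qop b a (p : N) : N :=
  \sum_(kl : 'I_n * 'I_n | (kl.1 <= kl.2)%N) cst b a (wt a b kl.1 kl.2) *: Y kl.1 (Y kl.2 p).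

Definition Eop b a (p : N) : N := Y b (Y a p) - (q b a)%:P *: Y a (Y b p) - Qop b a p.

Lemma Qop_is_linear b a : linear (Qop b a).
Proof.
move=> c x y; rewrite scaler_sumr -big_split; apply: eq_bigr => kl _ /=.
by rewrite !linearP /= !scalerA [c * _]mulrC.
Qed.

HB.instance Definition _ b a := GRing.isLinear.Build {poly K} N N *:%R (Qop b a) (Qop_is_linear b a).

Lemma Eop_is_linear b a : linear (Eop b a).
Proof.
exact: (linearP (((Y b \o Y a) \- ((q b a)%:P \*: (Y a \o Y b))) \- Qop b a)).
Qed.

HB.instance Definition _ b a := GRing.isLinear.Build {poly K} N N *:%R (Eop b a) (Eop_is_linear b a).

Local Notation E := Eop.
Local Notation Q := Qop.

(** The two ways of reordering the overlap [Y c (Y b (Y a p))]. *)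
Lemma jacobi c b a (p : N) :
  E c b (Y a p) + Q c b (Y a p) + (q c b)%:P *: (Y b (E c a p) + Y b (Q c a p)) +
    (q c b * q c a)%:P *: (E b a (Y c p) + Q b a (Y c p)) =
  Y c (E b a p) + Y c (Q b a p) + (q b a)%:P *: (E c a (Y b p) + Q c a (Y b p)) +
    (q b a * q c a)%:P *: (Y a (E c b p) + Y a (Q c b p)).
Proof.
have EQ i j x : E i j x + Q i j x = Y i (Y j x) - (q i j)%:P *: Y j (Y i x).
  by rewrite /Eop subrK.
have YE k i j x : Y k (E i j x) + Y k (Q i j x) = Y k (Y i (Y j x)) - (q i j)%:P *: Y k (Y j (Y i x)).
  by rewrite -linearD EQ linearB linearZ.
rewrite !YE !EQ !scalerBr !scalerA -!polyCM !addrA !subrK.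
by congr (_ - _%:P *: _); ring.
Qed.

End Relations.

(** * Left multiplication on ordered monomials *)

Section Straight.
Variables (n : nat) (G : cone n) (K : fieldType) (q : 'I_n -> 'I_n -> K).
Implicit Types (u v w : weight n) (i j k l a b c : 'I_n).
Notation W := (weight n).
Notation M := {freeg (weight n) / {poly K}}.
Notation fil := (fil G).

(** The condition under which putting [x_i] in front of [<< v >>] leaves the monomial ordered. *)
Definition low i v : bool := [forall j : 'I_n, (j < i)%N ==> (v j == 0)].

Lemma lowP i v : reflect (forall j, (j < i)%N -> v j = 0) (low i v).
Proof.
apply: (iffP forallP) => H j; first by move=> ji; apply/eqP; move: (H j); rewrite ji.
by apply/implyP => /H ->.
Qed.

Lemma low_ew i j v : (i <= j)%N -> low i v -> low i (v + ew j).
Proof.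
move=> ij /lowP lv; apply/lowP => k ki; rewrite !ffunE lv //.
by case: eqVneq => // kj; move: ki; rewrite kj ltnNge ij.
Qed.

Lemma low0 i : low i 0.
Proof. by apply/lowP => j _; rewrite ffunE. Qed.

(** [X i] is left multiplication by [x_i] on ordered monomials. The relations are
    imposed only where they define [X i << v >>] recursively, so such an [X] exists
    for arbitrary coefficients [cst]; whether [Eop] vanishes everywhere is the
    question of flatness. *)
Definition straight cst (X : 'I_n -> {linear M -> M}) : Prop :=
  [/\ forall i v, wpos v -> low i v -> X i << v >> = << v + ew i >>,
      forall i j v, wpos v -> (j < i)%N -> low j v -> Eop q cst X i j << v >> = 0 &
      forall i v, wpos v -> fil (v + ew i) 0 (X i << v >>)].

Definition deforming s (cst : 'I_n -> 'I_n -> weight n -> {poly K}) :=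
  forall b a w, homog G s w (cst b a w).

Lemma low_split i v : wpos v -> ~~ low i v ->
  exists j, [/\ (j < i)%N, low j v, wpos (v - ew j) & low j (v - ew j)].
Proof.
move=> v0; rewrite negb_forall => /existsP[j0]; rewrite negb_imply => /andP[ji0 vj0].
have [j /andP[ji vj] min] := @arg_minnP _ j0 (fun j : 'I_n => (j < i)%N && (v j != 0))
  (fun j => val j) (introT andP (conj ji0 vj0)).
have lj : low j v.
  apply/lowP => k kj; apply/eqP/negPn/negP => vk.
  by have := min k; rewrite vk (ltn_trans kj ji) => /(_ isT); rewrite leqNgt kj.
exists j; split=> //.
  apply/wposP => k; rewrite !ffunE; case: eqVneq => [->|_] /=; last by rewrite subr0 (wposP _ v0).
  by have := wposP _ v0 j; lia.
apply/lowP => k kj; rewrite !ffunE (lowP _ _ lj) //.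
by case: eqVneq kj => [->|_]; rewrite ?ltnn.
Qed.

Lemma wpos_ind (P : weight n -> Prop) : P 0 ->
  (forall i v, wpos v -> low i v -> P v -> P (v + ew i)) -> forall v, wpos v -> P v.
Proof.
move=> P0 PS v v0.
have [m] : exists m : nat, wlen G v <= m%:Z by exists `|wlen G v|%N; lia.
elim: m v v0 => [|m IH] v v0 vm.
  have vlen := wlen_ge0 G v0.
  suff -> : v = 0 by [].
  apply/ffunP => i; rewrite ffunE; apply/eqP/negPn/negP => vi.
  suff : 0 < wlen G v by lia.
  rewrite /wlen (bigD1 i) //= ltr_wpDr //.
    by apply: sumr_ge0 => j _; rewrite mulr_ge0 // (wposP _ v0).
  by rewrite mulr_gt0 // ?ltz_nat ?clen_gt0 // lt0r vi (wposP _ v0).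
have [->//|vn0] := eqVneq v 0.
have /existsP[i vi] : [exists i, v i != 0].
  by apply: contraNT vn0; rewrite negb_exists => /forallP H; apply/eqP/ffunP=> i;
    rewrite ffunE; apply/eqP; move: (H i); rewrite negbK.
suff [j [v'0 lj]] : exists j, wpos (v - ew j) /\ low j (v - ew j).
  have -> : v = v - ew j + ew j by rewrite subrK.
  apply: PS => //; apply: IH => //; rewrite wlenB wlen_ew.
  by have := clen_gt0 G j; lia.
have [li|/(low_split v0)[j []]] := boolP (low i v); last by exists j.
exists i; split.
  apply/wposP => k; rewrite !ffunE; case: eqVneq => [->|_] /=; last by rewrite subr0 (wposP _ v0).
  by have := wposP _ v0 i; lia.
apply/lowP => k kj; rewrite !ffunE (lowP _ _ li) //.
by case: eqVneq kj => [->|_]; rewrite ?ltnn.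
Qed.

Section Intertwine.
Variable cst : 'I_n -> 'I_n -> weight n -> {poly K}.
Hypothesis cst1 : deforming 1 cst.
Variables (X : 'I_n -> {linear M -> M}) (N : lmodType {poly K}).
Variables (Y : 'I_n -> {linear N -> N}) (phi : {linear M -> N}) (Z : weight n -> N -> Prop).
Hypothesis sX : straight cst X.
Hypotheses (Z0 : forall v, Z v 0) (ZD : forall v x y, Z v x -> Z v y -> Z v (x + y)).
Hypothesis ZZ : forall v w r x, homog G 0 w r -> Z (v + w) x -> Z v (r *: x).
Hypothesis ZY : forall v i x, Z v x -> Z (v + ew i) (Y i x).
Hypothesis phi_low : forall i v, wpos v -> low i v ->
  Z (v + ew i) (Y i (phi << v >>) - phi << v + ew i >>).
Hypothesis phi_rel : forall i j v, wpos v -> (j < i)%N -> low j v ->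
  Z (v + ew i + ew j) (Eop q cst Y i j (phi << v >>)).

Let ZN v x : Z v x -> Z v (- x).
Proof.
move=> h; rewrite -scaleN1r -[-1]/(- 1%:P) -polyCN.
by apply: (ZZ (homogC G _)); rewrite addr0.
Qed.

Lemma intertwine_fil (i : 'I_n) v p :
  (forall u, coeff u p != 0 -> wpos u -> cmem G (u - v) ->
     Z (u + ew i) (Y i (phi << u >>) - phi (X i << u >>))) ->
  fil v 0 p -> Z (v + ew i) (Y i (phi p) - phi (X i p)).
Proof.
move=> H hp.
pose g : {linear M -> N} := (Y i \o phi) \- (phi \o X i).
have -> : Y i (phi p) - phi (X i p) = g p by [].
apply: linear_freeg_ind; [exact: Z0|exact: ZD|] => u nz.
have [h1 h2] := hp u; apply: (ZZ h1).
have -> : v + ew i + (u - v) = u + ew i by weq.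
by apply: H => //; [exact: h2|case: (homog_mem h1 nz)].
Qed.

Let intertwine2 k l v : wpos v ->
  Z (v + ew l) (Y l (phi << v >>) - phi (X l << v >>)) ->
  (forall u, wpos u -> cmem G (u - (v + ew l)) ->
     Z (u + ew k) (Y k (phi << u >>) - phi (X k << u >>))) ->
  Z (v + ew l + ew k) (Y k (Y l (phi << v >>)) - phi (X k (X l << v >>))).
Proof.
move=> v0 /(ZY k) h1 h2; have [_ _ X3] := sX.
have h3 := intertwine_fil (fun u _ => h2 u) (X3 l v v0).
by have := ZD h1 h3; rewrite linearB addrA subrK.
Qed.

(** [Z] collects the admissible errors by weight. To pass [x_i] across the smallest letter [x_j] of
    [v], the relation is applied on both sides. This leaves [x_j x_i] on a shorter monomial and
    correction terms of smaller total length, so induction on [wlen v + clen i] applies. *)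
Lemma intertwine i v : wpos v -> Z (v + ew i) (Y i (phi << v >>) - phi (X i << v >>)).
Proof.
move=> v0; have [X1 X2 X3] := sX.
have [m] : exists m : nat, wlen G v + (clen G i)%:Z <= m%:Z.
  by exists (absz (wlen G v + (clen G i)%:Z)); lia.
elim: m i v v0 => [|m IH] i v v0 vm.
  by have := wlen_ge0 G v0; have := clen_gt0 G i; lia.
have [li|/(low_split v0)[j [ji lj v'0 lj']]] := boolP (low i v).
  by rewrite X1 //; apply: phi_low.
set v' := v - ew j in v'0 lj'; have vE : v = v' + ew j by rewrite /v' subrK.
have wE : wlen G v = wlen G v' + (clen G j)%:Z by rewrite vE wlenD wlen_ew.
have j1 := clen_gt0 G j.
have XE : X i << v >> = (q i j)%:P *: X j (X i << v' >>) + Qop cst X i j << v' >>.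
  have := X2 i j v' v'0 ji lj'; rewrite /Eop (X1 j) // -vE => /eqP.
  by rewrite subr_eq0 subr_eq addrC => /eqP ->.
have h1 := ZN (ZY i (phi_low v'0 lj')).
have h2 := phi_rel v'0 ji lj'.
have h3 : Z (v' + ew i + ew j) (Y j (Y i (phi << v' >>)) - phi (X j (X i << v' >>))).
  apply: intertwine2 => //; first by apply: IH => //; lia.
  (* For the leading monomial [v' + ew i] the measure does not drop; but it is [low j], so [phi_low]
     applies directly. *)
  move=> u u0 mu; have [ue|une] := eqVneq (u - (v' + ew i)) 0.
    have -> : u = v' + ew i by apply/eqP; rewrite -subr_eq0 ue.
    have lju : low j (v' + ew i) by apply: low_ew => //; apply: ltnW.
    have u'0 : wpos (v' + ew i) by apply: wposD.
    by rewrite (X1 j) //; apply: phi_low.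
  apply: IH => //; have := wlen_lt0 mu une; rewrite wlenB wlenD wlen_ew; lia.
have h4 : Z (v' + ew i + ew j) (Qop cst Y i j (phi << v' >>) - phi (Qop cst X i j << v' >>)).
  rewrite linear_sum /Qop -sumrB; elim/big_rec: _ => [|[k l] x _ Zx]; first exact: Z0.
  apply: ZD => //=; rewrite linearZ /= -scalerBr.
  have [->|nz] := eqVneq (cst i j (wt j i k l)) 0; first by rewrite scale0r; apply: Z0.
  have hc := cst1 i j (wt j i k l); have [mw hw] := homog_mem hc nz.
  apply: (ZZ (homog_le (leq0n _) hc)).
  have -> : v' + ew i + ew j + wt j i k l = v' + ew l + ew k by rewrite /wt; weq.
  have wn0 : wt j i k l != 0.
    by apply: contraTneq hw => ->; rewrite cht0.
  (* A nonzero weight of the cone has negative length, so [x_k x_l] is shorter than [x_i x_j]. *)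
  have := wlen_lt0 mw wn0; rewrite /wt !(wlenB, wlenD) !wlen_ew => wl.
  have k1 := clen_gt0 G k; apply: intertwine2 => //; first by apply: IH => //; lia.
  move=> u u0 mu; apply: IH => //.
  have : wlen G u <= wlen G (v' + ew l).
    have [ue|une] := eqVneq (u - (v' + ew l)) 0.
      by have -> : u = v' + ew l by apply/eqP; rewrite -subr_eq0 ue.
    by have := wlen_lt0 mu une; rewrite wlenB; lia.
  by rewrite wlenD wlen_ew; lia.
have e1 : v + ew i = v' + ew i + ew j by rewrite vE; weq.
have e2 : v' + ew j + ew i = v' + ew i + ew j by weq.
rewrite e2 -vE in h1; rewrite e1.
have h5 : Z (v' + ew i + ew j) ((q i j)%:P *: (Y j (Y i (phi << v' >>)) - phi (X j (X i << v' >>)))).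
  by apply: (ZZ (homogC G _)); rewrite addr0.
have h6 := ZD h5 h4.
have Zt x y z (u := v' + ew i + ew j) : Z u (x - y) -> Z u (y - z) -> Z u (x - z).
  by move=> hx /(ZD hx); rewrite addrA subrK.
apply: (Zt _ (Y i (Y j (phi << v' >>)))); first by rewrite -linearB -opprB linearN.
apply: (Zt _ ((q i j)%:P *: Y j (Y i (phi << v' >>)) + Qop cst Y i j (phi << v' >>))).
  by rewrite opprD addrA.
by rewrite XE linearD linearZ /= opprD addrACA -scalerBr.
Qed.

Lemma intertwineP i v p : fil v 0 p -> Z (v + ew i) (Y i (phi p) - phi (X i p)).
Proof. by apply: intertwine_fil => u _ u0 _; apply: intertwine. Qed.

End Intertwine.
End Straight.

(** * Construction of the operators *)

Section Existence.
Variables (n : nat) (G : cone n) (K : fieldType) (q : 'I_n -> 'I_n -> K).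
Implicit Types (u v w : weight n) (i j k l a b c : 'I_n).
Notation M := {freeg (weight n) / {poly K}}.
Notation fil := (fil G).
Variable cst : 'I_n -> 'I_n -> weight n -> {poly K}.
Hypothesis cst1 : deforming G 1 cst.

(** Termination depends on the weights at which [cst] is nonzero, not on the structure of [v]; hence
    the fuel. The result is independent of it once it exceeds the length. *)
Fixpoint Xfuel (f : nat) i v : M :=
  if f is f'.+1 then
    if low i v then << v + ew i >> else
    if [pick j : 'I_n | (j < i)%N && (low j v && (v j != 0))] is Some j then
      (q i j)%:P *: fglift (Xfuel f' j) (Xfuel f' i (v - ew j)) +
      \sum_(kl : 'I_n * 'I_n | (kl.1 <= kl.2)%N)
         cst i j (wt j i kl.1 kl.2) *: fglift (Xfuel f' kl.1) (Xfuel f' kl.2 (v - ew j))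
    else 0
  else 0.

Lemma pick_low i j v : (j < i)%N -> low j v -> wpos v ->
  [pick k : 'I_n | (k < i)%N && (low k (v + ew j) && ((v + ew j) k != 0))] = Some j.
Proof.
move=> ji lj v0; have jpos : 0 < (v + ew j) j.
  by rewrite !ffunE eqxx ltr_wpDl // (wposP _ v0).
have lj' : low j (v + ew j) by apply: low_ew.
case: pickP => [k /and3P[ki lk vk]|/(_ j)]; last by rewrite ji lj' gt_eqF.
congr Some; apply/eqP; rewrite -val_eqE eqn_leq /=; apply/andP; split; rewrite leqNgt; apply/negP => h.
  by move: jpos; rewrite (lowP _ _ lk) ?ltxx.
by move: vk; rewrite (lowP _ _ lj') ?eqxx.
Qed.

Lemma Xfuel_split f i j v : (j < i)%N -> low j v -> wpos v ->
  Xfuel f.+1 i (v + ew j) =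
      (q i j)%:P *: fglift (Xfuel f j) (Xfuel f i v) +
      \sum_(kl : 'I_n * 'I_n | (kl.1 <= kl.2)%N)
         cst i j (wt j i kl.1 kl.2) *: fglift (Xfuel f kl.1) (Xfuel f kl.2 v).
Proof.
move=> ji lj v0; rewrite /= pick_low // addrK.
case: ifP => // /lowP /(_ j ji) h.
have : 0 < (v + ew j) j by rewrite !ffunE eqxx ltr_wpDl // (wposP _ v0).
by rewrite h ltxx.
Qed.

Lemma fglift_fil (f g : weight n -> M) v s p k :
  (forall u, coeff u p != 0 -> wpos u -> cmem G (u - v) ->
     f u = g u /\ fil (u + ew k) 0 (f u)) -> fil v s p ->
  fglift f p = fglift g p /\ fil (v + ew k) s (fglift f p).
Proof.
move=> H hp; split.
  apply: eq_linear_freeg => u nz; have [h1 h2] := hp u; rewrite /= !fgliftT.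
  by case: (H u nz (h2 nz)) => //; case: (homog_mem h1 nz).
apply: linear_freeg_ind; [exact: fil0|exact: filD|] => u nz.
have [h1 h2] := hp u; rewrite -[s]addn0; apply: (filMZ h1).
have -> : v + ew k + (u - v) = u + ew k by weq.
by rewrite /= fgliftT; case: (H u nz (h2 nz)) => //; case: (homog_mem h1 nz).
Qed.

Lemma Xfuel_stable m i v : wpos v -> wlen G v + (clen G i)%:Z <= m%:Z ->
  forall f f', (m < f)%N -> (m < f')%N ->
  Xfuel f i v = Xfuel f' i v /\ fil (v + ew i) 0 (Xfuel f i v).
Proof.
elim: m i v => [|m IH] i v v0 vm.
  by have := wlen_ge0 G v0; have := clen_gt0 G i; lia.
case=> // f [] // f' mf mf'.
have [li|nli] := boolP (low i v).
  by rewrite /= li; split=> //; apply: fil_T; apply: wposD.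
have [j [ji _ v'0 lj]] := low_split v0 nli.
move: v'0 lj; set v' := v - ew j => v'0 lj; have vE : v = v' + ew j by rewrite /v' subrK.
have wE : wlen G v = wlen G v' + (clen G j)%:Z by rewrite vE wlenD wlen_ew.
have j1 := clen_gt0 G j; rewrite vE !Xfuel_split //.
have [|e1 F1] := IH i v' v'0 _ f f' mf mf'; first by lia.
have e12 : v' + ew j + ew i = v' + ew i + ew j by weq.
have [e2 F2] : fglift (Xfuel f j) (Xfuel f i v') = fglift (Xfuel f' j) (Xfuel f i v') /\
     fil (v' + ew i + ew j) 0 (fglift (Xfuel f j) (Xfuel f i v')).
  apply: fglift_fil F1 => u nz u0 mu.
  have [ue|une] := eqVneq (u - (v' + ew i)) 0.
    have uE : u = v' + ew i by apply/eqP; rewrite -subr_eq0 ue.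
    case: f f' mf mf' {e1 nz} => // f [] // f' _ _ /=.
    have -> : low j u by rewrite uE; apply: low_ew => //; apply: ltnW.
    by split=> //; apply: fil_T; apply: wposD.
  apply: IH => //; have := wlen_lt0 mu une; rewrite wlenB wlenD wlen_ew; lia.
have H (kl : 'I_n * 'I_n) :
    cst i j (wt j i kl.1 kl.2) *: fglift (Xfuel f kl.1) (Xfuel f kl.2 v') =
    cst i j (wt j i kl.1 kl.2) *: fglift (Xfuel f' kl.1) (Xfuel f' kl.2 v') /\
    fil (v' + ew i + ew j) 0 (cst i j (wt j i kl.1 kl.2) *: fglift (Xfuel f kl.1) (Xfuel f kl.2 v')).
  case: kl => k l /=.
  have [->|nz] := eqVneq (cst i j (wt j i k l)) 0; first by rewrite !scale0r; split=> //; apply: fil0.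
  have hc := cst1 i j (wt j i k l); have [mw hw] := homog_mem hc nz.
  have wn0 : wt j i k l != 0 by apply: contraTneq hw => ->; rewrite cht0.
  have := wlen_lt0 mw wn0; rewrite /wt !(wlenB, wlenD) !wlen_ew => wl.
  have k1 := clen_gt0 G k.
  have [|e3 F3] := IH l v' v'0 _ f f' mf mf'; first by lia.
  have [e4 F4] : fglift (Xfuel f k) (Xfuel f l v') = fglift (Xfuel f' k) (Xfuel f l v') /\
     fil (v' + ew l + ew k) 0 (fglift (Xfuel f k) (Xfuel f l v')).
    apply: fglift_fil F3 => u _ u0 mu; apply: IH => //.
    have : wlen G u <= wlen G (v' + ew l).
      have [ue|une] := eqVneq (u - (v' + ew l)) 0.
        by have -> : u = v' + ew l by apply/eqP; rewrite -subr_eq0 ue.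
      by have := wlen_lt0 mu une; rewrite wlenB; lia.
    by rewrite wlenD wlen_ew; lia.
  rewrite e4 e3; split=> //; rewrite -e3 -e4.
  apply: (filMZ (homog_le (leq0n _) hc)).
  by have -> : v' + ew i + ew j + wt j i k l = v' + ew l + ew k by rewrite /wt; weq.
rewrite e2 e1; split.
  by congr (_ + _); apply: eq_bigr => kl _; case: (H kl).
rewrite -e1 -e2 e12; apply: filD; first exact: filZ.
by apply: fil_sum => kl _; case: (H kl).
Qed.

Lemma straight_exists : exists X : 'I_n -> {linear M -> M}, straight G q cst X.
Proof.
pose F i v := Xfuel (absz (wlen G v + (clen G i)%:Z)).+1 i v.
have FE i v f : wpos v -> wlen G v + (clen G i)%:Z < f%:Z -> F i v = Xfuel f i v.
  move=> v0 h; have := wlen_ge0 G v0 => v1.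
  have [||//] := @Xfuel_stable (absz (wlen G v + (clen G i)%:Z)) i v v0 _ _.+1 f (ltnSn _); lia.
have Ffil i v : wpos v -> fil (v + ew i) 0 (F i v).
  move=> v0; have := wlen_ge0 G v0 => v1.
  have [|//] := @Xfuel_stable (absz (wlen G v + (clen G i)%:Z)) i v v0 _ _ _ (ltnSn _) (ltnSn _); lia.
exists (fun i => fglift (F i) : {linear M -> M}); split.
- by move=> i v v0 li; rewrite /= fgliftT /F /= li.
- move=> i j v v0 ji lj.
  have Flow : F j v = << v + ew j >> by rewrite /F /= lj.
  (* [F l v] has finitely many monomials, so one amount of fuel serves them all; it is then made
     uniform in [l]. *)
  have lim (l : 'I_n) : exists f0 : nat, forall f, (f0 <= f)%N ->
      Xfuel f l v = F l v /\ forall k, fglift (Xfuel f k) (F l v) = fglift (F k) (F l v).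
    pose mu i u := (absz (wlen G u + (clen G i)%:Z)).+1.
    exists (maxn (mu l v) (\max_(u <- dom (F l v)) \max_k mu k u)) => f.
    rewrite geq_max => /andP[f1 f2]; split.
      by rewrite -FE //; have := wlen_ge0 G v0; move: f1; rewrite /mu; lia.
    move=> k; apply: eq_linear_freeg => u nz; have [h1 h2] := Ffil l v v0 u.
    rewrite /= !fgliftT (FE _ _ f) ?h2 //; have := wlen_ge0 G (h2 nz).
    have : (mu k u <= f)%N.
      apply: leq_trans f2; apply: (@leq_trans (\max_k mu k u)); first exact: (leq_bigmax k).
      by apply: (@leq_bigmax_seq _ _ _ (fun u => \max_k mu k u)); rewrite // mem_dom.
    by rewrite /mu; lia.
  have [g gE] := fin_all_exists lim.
  pose f := maxn (absz (wlen G (v + ew j) + (clen G i)%:Z)) (\max_l g l).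
  have fE l : (g l <= f)%N by rewrite /f leq_max (leq_bigmax l) orbT.
  have v'0 : wpos (v + ew j) by apply: wposD.
  rewrite /Eop /= !fgliftT Flow fgliftT (FE _ _ f.+1) //; last first.
    have := wlen_ge0 G v'0; move: (leq_maxl (absz (wlen G (v + ew j) + (clen G i)%:Z)) (\max_l g l)).
    by rewrite -/f; lia.
  rewrite Xfuel_split // -addrA -opprD; apply/eqP; rewrite subr_eq0; apply/eqP; congr (_ + _).
    by have [-> ->] := gE i f (fE i).
  by apply: eq_bigr => kl _ /=; rewrite fgliftT; have [-> ->] := gE kl.2 f (fE _).
- by move=> i v v0; rewrite /= fgliftT; apply: Ffil.
Qed.

End Existence.

(** * Leading terms in the quantum torus *)

Section Bicharacter.
Variables (n : nat) (K : fieldType) (q : 'I_n -> 'I_n -> K).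
Hypothesis qV : forall i j, q i j * q j i = 1.
Hypothesis q1 : forall i, q i i = 1.
Implicit Types (u v w : weight n) (i j k l a b c : 'I_n).

(** In the quantum torus, T^u T^v = [bch u v] T^(u + v) for ordered monomials. *)
Definition bch u v : K := \prod_(i : 'I_n) \prod_(j : 'I_n | (j < i)%N) q i j ^ (u i * v j).

Lemma q_neq0 i j : q i j != 0.
Proof. by apply/eqP => q0; have := qV i j; rewrite q0 mul0r => /eqP; rewrite eq_sym oner_eq0. Qed.

Lemma bch_neq0 u v : bch u v != 0.
Proof. by apply/prodf_neq0 => i _; apply/prodf_neq0 => j _; rewrite expfz_neq0 ?q_neq0. Qed.

Lemma bchDl u u' v : bch (u + u') v = bch u v * bch u' v.
Proof.
rewrite -big_split; apply: eq_bigr => i _; rewrite -big_split; apply: eq_bigr => j _ /=.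
by rewrite ffunE mulrDl expfzDr ?q_neq0.
Qed.

Lemma bchDr u v v' : bch u (v + v') = bch u v * bch u v'.
Proof.
rewrite -big_split; apply: eq_bigr => i _; rewrite -big_split; apply: eq_bigr => j _ /=.
by rewrite ffunE mulrDr expfzDr ?q_neq0.
Qed.

Lemma bch_ewl i v : bch (ew i) v = \prod_(j : 'I_n | (j < i)%N) q i j ^ v j.
Proof.
rewrite /bch (bigD1 i) //= [X in _ * X]big1 ?mulr1 => [|k /negPf ki].
  by apply: eq_bigr => j _; rewrite ffunE eqxx mul1r.
by apply: big1 => j _; rewrite ffunE ki mul0r expr0z.
Qed.

Lemma bch_ewr u j : bch u (ew j) = \prod_(i : 'I_n | (j < i)%N) q i j ^ u i.
Proof.
rewrite /bch (eq_bigr (fun i : 'I_n => if (j < i)%N then q i j ^ u i else 1)); last first.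
  move=> i _; case: ifP => ji.
    rewrite (bigD1 j) //= [X in _ * X]big1 ?mulr1 => [|k /andP[_ /negPf kj]].
      by rewrite ffunE eqxx mulr1.
    by rewrite ffunE kj mulr0 expr0z.
  apply: big1 => k ki; rewrite ffunE; case: eqVneq => [kj|]; last by rewrite mulr0 expr0z.
  by rewrite kj ji in ki.
by rewrite -big_mkcond.
Qed.

Lemma bch0l v : bch 0 v = 1.
Proof. by apply: big1 => i _; apply: big1 => j _; rewrite ffunE mul0r expr0z. Qed.

Lemma bch0r v : bch v 0 = 1.
Proof. by apply: big1 => i _; apply: big1 => j _; rewrite ffunE mulr0 expr0z. Qed.

Lemma bch_low i v : low i v -> bch (ew i) v = 1.
Proof. by move=> /lowP lv; rewrite bch_ewl; apply: big1 => j /lv ->; rewrite expr0z. Qed.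

Lemma bch_ew i j : bch (ew i) (ew j) = if (j < i)%N then q i j else 1.
Proof.
rewrite bch_ewl; case: ifP => ji.
  rewrite (bigD1 j) //= [X in _ * X]big1 ?mulr1 => [|k /andP[_ /negPf kj]].
    by rewrite ffunE eqxx expr1z.
  by rewrite ffunE kj expr0z.
apply: big1 => k ki; rewrite ffunE; case: eqVneq => [kj|]; last by rewrite expr0z.
by rewrite kj ji in ki.
Qed.

Lemma bch_swap i j : bch (ew i) (ew j) = q i j * bch (ew j) (ew i).
Proof.
rewrite !bch_ew; case: ltngtP => h; rewrite ?mulr1 ?qV //.
by have -> : i = j by apply: val_inj.
Qed.

(** The scalar in [T_i T^w = chi_i(w) T^w T_i] in the quantum torus. *)
Definition chi i w : K := \prod_j q i j ^ w j.

Lemma chiE i w : bch (ew i) w = chi i w * bch w (ew i).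
Proof.
rewrite bch_ewl bch_ewr /chi [X in _ = X * _](bigID (fun j : 'I_n => (j < i)%N)) /= -mulrA.
rewrite [X in _ * X](_ : _ = 1) ?mulr1 //.
rewrite (bigD1 i) ?ltnn //= q1 exp1rz mul1r.
rewrite (eq_bigl (fun j : 'I_n => (i < j)%N)); last first.
  by move=> j; rewrite -leqNgt ltn_neqAle andbC eq_sym.
rewrite -big_split big1 //= => j _; rewrite -expfzMl qV exp1rz //.
Qed.

End Bicharacter.

Section Leading.
Variables (n : nat) (G : cone n) (K : fieldType).
Implicit Types (u v w : weight n) (i j k l a b c : 'I_n).
Notation M := {freeg (weight n) / {poly K}}.
Notation fil := (fil G).

Lemma fil_coeff0 v s p w : fil v s p -> (cht G w < s)%N -> coeff (v + w) p = 0 :> {poly K}.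
Proof.
move=> H h; have [h1 _] := H (v + w); apply: (homog_gt h).
by move: h1; rewrite addrAC subrr add0r.
Qed.

(** An operator of order [s] sends the part of [p] of positive height to order above [s], so in
    height [s] only the leading coefficient of [p] counts. *)
Lemma lead1 (f : {linear M -> M}) v v' s p w :
  (forall u, wpos u -> fil (u + v') s (f << u >>)) -> fil v 0 p -> cht G w = s ->
  coeff (v + v' + w) (f p) = coeff v p * coeff (v + v' + w) (f << v >>).
Proof.
move=> hf hp hw; have hr : fil v 1 (p - coeff v p *: << v >>).
  move=> u; have [h1 h2] := hp u; rewrite coeffB coeffZ coeffT.
  case: eqVneq => [<-|vu]; first by rewrite mulr1 (subrr (coeff v p)); split; [left|rewrite eqxx].
  rewrite mulr0 subr0; split=> //; case: h1 => [->|[m _ e]]; first by left.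
  right; split=> //; rewrite lt0n; apply: contra_neq vu => /(cht0_eq0 m) /eqP.
  by rewrite subr_eq0 => /eqP ->.
have := fil_coeff0 (fil_lin hf hr) (w := w).
rewrite linearB linearZ coeffB coeffZ /= hw ltnS leqnn => /(_ isT) /eqP.
by rewrite subr_eq0 => /eqP.
Qed.

(** Dual to [lead1]: the order sits in [p], so in height [s] only the leading part [c] of [f]
    counts. *)
Lemma lead2 (f : {linear M -> M}) (c : weight n -> K) v v' s p w :
  (forall u, wpos u -> fil (u + v') 1 (f << u >> - (c u)%:P *: << u + v' >>)) ->
  fil v s p -> cht G w = s ->
  coeff (v + v' + w) (f p) = (c (v + w))%:P * coeff (v + w) p.
Proof.
move=> hf hp hw.
pose g : {linear M -> M} := fglift (fun u => (c u)%:P *: << u + v' >> : M).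
have gE u : coeff (u + v') (g p) = (c u)%:P * coeff u p.
  rewrite linear_freegE raddf_sum /=; case: (boolP (u \in dom p)) => up.
    rewrite (bigD1_seq u) ?uniq_dom //= fgliftT !coeffZ coeffT eqxx mulr1 mulrC.
    rewrite big1 ?addr0 // => x /negPf xu.
    by rewrite fgliftT !coeffZ coeffT (inj_eq (addIr _)) xu !mulr0.
  rewrite (coeff_outdom up) mulr0 big_seq big1 // => x xp.
  rewrite fgliftT !coeffZ coeffT (inj_eq (addIr _)).
  by case: eqVneq => [xu|]; rewrite ?mulr0 //; move: up; rewrite -xu xp.
have hg u : wpos u -> fil (u + v') 1 ((f \- g : {linear M -> M}) << u >>).
  by move=> u0; rewrite /= fgliftT; apply: hf.
have := fil_coeff0 (fil_lin hg hp) (w := w); rewrite hw addn1 leqnn => /(_ isT) /=.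
by rewrite coeffB => /eqP; rewrite subr_eq0 => /eqP ->; rewrite -gE addrAC.
Qed.

End Leading.

Section Filtered.
Variables (n : nat) (G : cone n) (K : fieldType) (q : 'I_n -> 'I_n -> K).
Hypothesis qV : forall i j, q i j * q j i = 1.
Hypothesis q1 : forall i, q i i = 1.
Implicit Types (u v w : weight n) (i j k l a b c : 'I_n).
Notation M := {freeg (weight n) / {poly K}}.
Notation fil := (fil G).
Notation bch := (bch q).

Definition raising (Y : 'I_n -> {linear M -> M}) : Prop :=
  forall i v, wpos v -> fil (v + ew i) 0 (Y i << v >>).

Lemma raising_fil Y v s i p : raising Y -> fil v s p -> fil (v + ew i) s (Y i p).
Proof. by move=> HY hp; rewrite -[s]addn0; apply: fil_lin hp => u; apply: HY. Qed.

Lemma Qop_fil s' cst Y v s b a p : deforming G s' cst -> raising Y -> fil v s p ->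
  fil (v + ew b + ew a) (s' + s) (Qop cst Y b a p).
Proof.
move=> hc HY hp; apply: fil_sum => -[k l] _ /=; apply: (filMZ (hc _ _ _)).
have -> : v + ew b + ew a + wt a b k l = v + ew l + ew k by rewrite /wt; weq.
exact: (raising_fil _ HY (raising_fil _ HY hp)).
Qed.

Lemma fil_comp_ZZ s v w (r : {poly K}) (x : M) : homog G 0 w r -> fil (v + w) s x -> fil v s (r *: x).
Proof. by move=> hr hx; apply: (filMZ hr). Qed.

Lemma straight_raising cst X : straight G q cst X -> raising X.
Proof. by case. Qed.

(** [intertwine] with the quantum torus operators as target: they satisfy the undeformed relations
    exactly, and the corrections have order 1. *)
Lemma straight_lead cst X a u : deforming G 1 cst -> straight G q cst X -> wpos u ->
  fil (u + ew a) 1 (X a << u >> - (bch (ew a) u)%:P *: << u + ew a >>).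
Proof.
move=> cst1 sX u0.
pose Y i : {linear M -> M} := fglift (fun u => (bch (ew i) u)%:P *: << u + ew i >> : M).
have YT i v : Y i << v >> = (bch (ew i) v)%:P *: << v + ew i >> by rewrite /Y /= fgliftT.
have HY : raising Y by move=> i v v0; rewrite YT; apply/filZ/fil_T/wposD.
suff : fil (u + ew a) 1 (Y a << u >> - X a << u >>).
  by move=> /filN; rewrite opprB YT.
apply: (@intertwine n G K q cst cst1 X M Y idfun (fun v => fil v 1)) => //.
- by move=> v; apply: fil0.
- by move=> v x y; apply: filD.
- by move=> v w r x; apply: fil_comp_ZZ.
- by move=> v i x; apply: raising_fil.
- by move=> i v v0 li; rewrite /= YT bch_low // scale1r subrr; apply: fil0.
move=> i j v v0 ji lj; rewrite /Eop.
have -> : Y i (Y j (idfun << v >>)) - (q i j)%:P *: Y j (Y i (idfun << v >>)) = 0.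
  have YZ k (r : {poly K}) x : Y k (r *: x) = r *: Y k x by rewrite linearZ.
  rewrite /= !YT !YZ !YT /= !scalerA -!polyCM !(bchDr qV) (bch_swap qV q1 i j).
  have -> : v + ew j + ew i = v + ew i + ew j by weq.
  by apply/eqP; rewrite subr_eq0; apply/eqP; congr (_%:P *: _); ring.
rewrite sub0r; apply: filN; rewrite -[1%N]addn0; apply: Qop_fil => //.
exact: fil_T.
Qed.

Lemma raising_word Y v s p (wd : seq 'I_n) : raising Y -> fil v s p ->
  fil (v + \sum_(i <- wd) ew i) s (foldr (fun i => Y i) p wd).
Proof.
move=> HY hp; elim: wd => [|i wd IH] /=; first by rewrite big_nil addr0.
rewrite big_cons; have -> : v + (ew i + \sum_(j <- wd) ew j) = v + \sum_(j <- wd) ew j + ew i.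
  by rewrite -addrA [ew i + _]addrC.
exact: raising_fil.
Qed.

Definition mword v : seq 'I_n := flatten [seq nseq (absz (v i)) i | i <- enum 'I_n].

Lemma mword0 : mword 0 = [::].
Proof. by rewrite /mword; elim: (enum _) => //= i t ->; rewrite ffunE. Qed.

Lemma mword_low i v : wpos v -> low i v -> mword (v + ew i) = i :: mword v.
Proof.
move=> v0 /lowP li; rewrite /mword.
have : pairwise (fun i j : 'I_n => (i < j)%N) (enum 'I_n).
  rewrite -sorted_pairwise; last by move=> ? ? ?; apply: ltn_trans.
  by have := iota_ltn_sorted 0 n; rewrite -val_enum_ord sorted_map.
have : i \in enum 'I_n by rewrite mem_enum.
case/splitPr => t1 t2; rewrite pairwise_cat /= allrel_consr => /and4P[/andP[h1 _] _ h2 _].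
rewrite !map_cat !flatten_cat /=.
have -> : flatten [seq nseq `|v j| j | j <- t1] = [::].
  elim: t1 h1 => //= j t1 IH /andP[ji h1]; rewrite li // IH //.
have -> : flatten [seq nseq `|(v + ew i) j| j | j <- t1] = [::].
  elim: t1 h1 => //= j t1 IH /andP[ji h1]; rewrite !ffunE li // IH //.
  by case: eqVneq ji => [->|]; rewrite ?ltnn.
rewrite /=; have -> : absz ((v + ew i) i) = (absz (v i)).+1.
  by rewrite !ffunE eqxx /=; have := wposP _ v0 i; move: (v i) => z; lia.
rewrite /=; congr (_ :: _ ++ flatten _); apply/eq_in_map => j /(allP h2) ij.
by rewrite !ffunE; case: eqVneq ij => [->|_]; rewrite ?ltnn //= addr0.
Qed.

End Filtered.

(** * The overlap defect *)

Section Obstruction.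
Variables (n : nat) (G : cone n) (K : fieldType) (q : 'I_n -> 'I_n -> K).
Hypothesis qV : forall i j, q i j * q j i = 1.
Hypothesis q1 : forall i, q i i = 1.
Implicit Types (u v w : weight n) (i j k l a b c : 'I_n).
Notation M := {freeg (weight n) / {poly K}}.
Notation fil := (fil G).
Notation bch := (bch q).
Variables (cst : 'I_n -> 'I_n -> weight n -> {poly K}) (X : 'I_n -> {linear M -> M}).
Hypotheses (cst1 : deforming G 1 cst) (sX : straight G q cst X).
Notation Q := (Qop cst X).
Notation E := (Eop q cst X).

Lemma raisingX : raising G X. Proof. exact: straight_raising sX. Qed.

(** Right multiplication by the ordered monomial of weight [u]. *)
Definition shiftop u : {linear M -> M} :=
  fglift (fun v => foldr (fun i => X i) << u >> (mword v)).

Lemma shiftop0 u : shiftop u << 0 >> = << u >>.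
Proof. by rewrite /shiftop /= fgliftT mword0. Qed.

Lemma shiftop_low u i v : wpos v -> low i v -> X i (shiftop u << v >>) = shiftop u << v + ew i >>.
Proof. by move=> v0 li; rewrite /shiftop /= !fgliftT mword_low. Qed.

Lemma shiftop_filT u v : wpos u -> wpos v -> fil (v + u) 0 (shiftop u << v >>).
Proof.
move=> u0; move: v; apply: (wpos_ind G) => [|i v v0 li IH]; first by rewrite shiftop0 add0r; apply: fil_T.
rewrite -shiftop_low //; have -> : v + ew i + u = v + u + ew i by rewrite addrAC.
exact: raising_fil raisingX IH.
Qed.

Lemma shiftop_lead u v : wpos u -> wpos v ->
  fil (v + u) 1 (shiftop u << v >> - (bch v u)%:P *: << v + u >>).
Proof.
move=> u0; move: v; apply: (wpos_ind G) => [|i v v0 li IH].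
  by rewrite shiftop0 bch0l add0r scale1r subrr; apply: fil0.
have -> : v + ew i + u = v + u + ew i by rewrite addrAC.
have := raising_fil i raisingX IH.
have := filZ (bch v u) (straight_lead qV q1 i cst1 sX (wposD v0 u0)).
move=> h /filD /(_ h); congr (fil _ _ _).
rewrite linearB [X i (_ *: _)]linearZ /= shiftop_low // scalerBr addrA subrK scalerA -polyCM.
by rewrite (bchDr qV) (bchDl qV) bch_low // mul1r.
Qed.

Variable s : nat.
Hypothesis Efil : forall b a u, (a < b)%N -> wpos u -> fil (u + (ew b + ew a)) s (E b a << u >>).

Lemma Eop_fil b a v s' p : (a < b)%N -> fil v s' p -> fil (v + (ew b + ew a)) (s' + s) (E b a p).
Proof. by move=> ab; apply: fil_lin => u; apply: Efil. Qed.

(** [shiftop u] respects [X i] on ordered products by construction, and the defects in the target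
    have order [s], so [intertwine] applies. *)
Lemma shiftop_assoc u i v s' p : wpos u -> fil v s' p ->
  fil (v + (ew i + u)) (s' + s) (X i (shiftop u p) - shiftop u (X i p)).
Proof.
move=> u0; pose f : {linear M -> M} := (X i \o shiftop u) \- (shiftop u \o X i).
move=> hp; have := @fil_lin _ G K f v s' (ew i + u) s p _ hp; apply => {hp p v} v v0.
rewrite addrA.
apply: (@intertwine n G K q cst cst1 X M X (shiftop u) (fun v => fil (v + u) s)) => //.
- by move=> x; apply: fil0.
- by move=> x y z; apply: filD.
- move=> x y r z hr hz; apply: (filMZ hr); have -> // : x + u + y = x + y + u by rewrite addrAC.
- move=> x j z hz; have -> : x + ew j + u = x + u + ew j by rewrite addrAC.
  exact: raising_fil raisingX hz.
- by move=> j x x0 lj; rewrite shiftop_low // subrr; apply: fil0.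
- move=> j k x x0 kj lk.
  have := Eop_fil kj (shiftop_filT u0 x0); rewrite add0n.
  have -> // : x + u + (ew j + ew k) = x + ew j + ew k + u.
  by rewrite addrAC !addrA.
Qed.

(** [Q] raises the order by one and so improves the error of [shiftop_assoc] to [s.+1]. This makes
    overlap defects comparable in height [s] for different [u]. *)
Lemma shiftop_Q u b a v y y0 : wpos u -> fil v 0 y0 -> fil (v + u) s (y - shiftop u y0) ->
  fil (v + (ew b + ew a) + u) s.+1 (Q b a y - shiftop u (Q b a y0)).
Proof.
move=> u0 hy0 hy; have h1 := Qop_fil b a cst1 raisingX hy.
have -> : Q b a y - shiftop u (Q b a y0) =
   Q b a (y - shiftop u y0) + (Q b a (shiftop u y0) - shiftop u (Q b a y0)).
  by rewrite linearB addrA subrK.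
have e : v + (ew b + ew a) + u = v + u + ew b + ew a by rewrite addrAC !addrA.
rewrite e; apply: filD => //.
rewrite linear_sum /Qop -sumrB; apply: fil_sum => -[k l] _ /=.
rewrite linearZ /= -scalerBr; apply: (filMZ (cst1 _ _ _)).
have -> : v + u + ew b + ew a + wt a b k l = v + u + ew k + ew l by rewrite /wt; weq.
have h2 := shiftop_assoc l u0 hy0; have h3 := shiftop_assoc k u0 (raising_fil l raisingX hy0).
have := raising_fil k raisingX h2; rewrite !add0n in h2 h3 *.
have -> : v + (ew l + u) + ew k = v + u + ew k + ew l by weq.
move: h3; have -> : v + ew l + (ew k + u) = v + u + ew k + ew l by weq.
by move=> h3 /filD /(_ h3); rewrite linearB addrA subrK.
Qed.

(** The [Q]-terms of the two sides of [jacobi]; [Qupp - Qlow] is therefore a weighted sum of the six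
    defect terms. *)
Definition Qlow c b a p : M :=
  Q c b (X a p) + (q c b)%:P *: X b (Q c a p) + (q c b * q c a)%:P *: Q b a (X c p).
Definition Qupp c b a p : M :=
  X c (Q b a p) + (q b a)%:P *: Q c a (X b p) + (q b a * q c a)%:P *: X a (Q c b p).

Lemma shiftop_QX u c b a : wpos u ->
  fil (ew a + ew b + ew c + u) s.+1
    (Q c b (X a << u >>) - shiftop u (Q c b (X a << 0 >>))).
Proof.
move=> u0; have -> : ew a + ew b + ew c + u = ew a + (ew c + ew b) + u by weq.
have h0 : fil 0 0 << 0 >> := fil_T G K (@wpos0 n).
apply: shiftop_Q => //; first by have := raising_fil a raisingX h0; rewrite add0r.
by have := shiftop_assoc a u0 h0; rewrite shiftop0 add0r.
Qed.

Lemma shiftop_XQ u c b a : wpos u ->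
  fil (ew a + ew b + ew c + u) s.+1
    (X c (Q b a << u >>) - shiftop u (X c (Q b a << 0 >>))).
Proof.
move=> u0; have -> : ew a + ew b + ew c + u = 0 + (ew b + ew a) + (ew c + u) by weq.
have h0 : fil 0 0 << 0 >> := fil_T G K (@wpos0 n).
have h1 := Qop_fil b a cst1 raisingX h0.
have h2 : fil (0 + (ew b + ew a) + u) s.+1 (Q b a << u >> - shiftop u (Q b a << 0 >>)).
  by apply: shiftop_Q => //; rewrite shiftop0 subrr; apply: fil0.
have h3 := shiftop_assoc c u0 h1; rewrite addnC addn1 in h3.
have := raising_fil c raisingX h2.
have -> : 0 + (ew b + ew a) + u + ew c = 0 + ew b + ew a + (ew c + u) by weq.
move=> /filD /(_ h3); rewrite [X c (_ - _)]linearB [Z in fil _ _ Z]addrA subrK.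
by have -> : 0 + ew b + ew a + (ew c + u) = 0 + (ew b + ew a) + (ew c + u) by weq.
Qed.

Lemma shiftop_Qdiff u c b a : wpos u ->
  fil (ew a + ew b + ew c + u) s.+1
    (Qupp c b a << u >> - Qlow c b a << u >> -
     shiftop u (Qupp c b a << 0 >> - Qlow c b a << 0 >>)).
Proof.
move=> u0; have sZ (r : {poly K}) x : shiftop u (r *: x) = r *: shiftop u x by rewrite linearZ.
have sD x y : shiftop u (x + y) = shiftop u x + shiftop u y by rewrite linearD.
have e1 : ew b + ew a + ew c + u = ew a + ew b + ew c + u by weq.
have e2 : ew c + ew a + ew b + u = ew a + ew b + ew c + u by weq.
have e3 : ew c + ew b + ew a + u = ew a + ew b + ew c + u by weq.
have h1 := shiftop_QX c b a u0; have h2 := filZ (q c b) (shiftop_XQ b c a u0).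
have h3 := filZ (q c b * q c a) (shiftop_QX b a c u0).
have h4 := shiftop_XQ c b a u0; have h5 := filZ (q b a) (shiftop_QX c a b u0).
have h6 := filZ (q b a * q c a) (shiftop_XQ a c b u0).
have e4 : ew c + ew a + ew b + u = ew a + ew b + ew c + u by weq.
have e5 : ew a + ew c + ew b + u = ew a + ew b + ew c + u by weq.
have e6 : ew b + ew c + ew a + u = ew a + ew b + ew c + u by weq.
rewrite ?(e1, e2, e3, e4, e5, e6) in h1 h2 h3 h4 h5 h6.
have hL := filD (filD h1 h2) h3; have hU := filD (filD h4 h5) h6.
have -> : Qupp c b a << u >> - Qlow c b a << u >> - shiftop u (Qupp c b a << 0 >> - Qlow c b a << 0 >>)
   = (Qupp c b a << u >> - shiftop u (Qupp c b a << 0 >>)) - (Qlow c b a << u >> - shiftop u (Qlow c b a << 0 >>)).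
  have D0 (x y z t : M) : x - y - (z - t) = x - z - (y - t).
    by rewrite !opprB addrACA [RHS]addrACA; congr (_ + _); apply: addrC.
  by rewrite linearB; apply: D0.
have D (x1 x2 x3 y1 y2 y3 : M) : x1 - y1 + (x2 - y2) + (x3 - y3) = x1 + x2 + x3 - (y1 + y2 + y3).
  by rewrite [x1 - y1 + (x2 - y2)]addrACA [LHS]addrACA -!opprD.
move: hU hL; rewrite !scalerBr !D -!sZ -!sD => hU hL.
exact: filB hU hL.
Qed.

End Obstruction.

Local Opaque Eop Qop.

(** * Overlap coefficients as a Koszul cocycle *)

Section Cocycle.
Variables (n : nat) (G : cone n) (K : fieldType) (q : 'I_n -> 'I_n -> K).
Hypothesis qV : forall i j, q i j * q j i = 1.
Hypothesis q1 : forall i, q i i = 1.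
Implicit Types (u v w : weight n) (i j k l a b c : 'I_n).
Notation M := {freeg (weight n) / {poly K}}.
Notation fil := (fil G).
Notation bch := (bch q).
Notation chi := (chi q).
Variables (cst : 'I_n -> 'I_n -> weight n -> {poly K}) (X : 'I_n -> {linear M -> M}).
Hypotheses (cst1 : deforming G 1 cst) (sX : straight G q cst X).
Notation Q := (Qop cst X).
Notation E := (Eop q cst X).
Variable s : nat.
Hypothesis Efil : forall b a u, (a < b)%N -> wpos u -> fil (u + (ew b + ew a)) s (E b a << u >>).
Variable w : weight n.
Hypothesis ws : cht G w = s.

Definition enorm b a u : K := bch w (ew b + ew a + u) * bch (ew b) (ew a + u) * bch (ew a) u.

(** E b a T^u = [ecoef b a u] T^w T_b T_a T^u + terms of other weights. *)
Definition ecoef b a u : {poly K} :=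
  (enorm b a u)^-1%:P * coeff (u + (ew b + ew a) + w) (E b a << u >>).

Lemma enorm_neq0 b a u : enorm b a u != 0.
Proof. by rewrite !mulf_neq0 ?bch_neq0. Qed.

Lemma ecoefE b a u :
  coeff (u + (ew b + ew a) + w) (E b a << u >>) = (enorm b a u)%:P * ecoef b a u.
Proof. by rewrite mulrA -polyCM mulfV ?mul1r ?enorm_neq0. Qed.

Lemma ecoef_low b a u : wpos u -> (a < b)%N -> low a u -> ecoef b a u = 0.
Proof. by move=> u0 ab la; have [_ E0 _] := sX; rewrite /ecoef E0 // coeff0 mulr0. Qed.

(** Scalar of the quantum torus product [T^w T_c T_b T_a T^u], as [enorm] is that of
    [T^w T_b T_a T^u]. *)
Definition tnorm c b a u : K :=
  bch w (ew c + ew b + ew a + u) * bch (ew c) (ew b + ew a + u) * bch (ew b) (ew a + u) * bch (ew a) u.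

Lemma coeff_EX c b a u : (b < c)%N -> wpos u ->
  coeff (ew a + ew b + ew c + u + w) (E c b (X a << u >>)) =
  (bch (ew a) u * enorm c b (u + ew a))%:P * ecoef c b (u + ew a).
Proof.
move=> bc u0; have -> : ew a + ew b + ew c + u + w = u + ew a + (ew c + ew b) + w by weq.
have [_ _ X3] := sX.
rewrite (lead1 (fun u => Efil bc) (X3 a u u0) ws) ecoefE (polyCM (bch (ew a) u) (enorm c b _)) -mulrA; congr (_ * _).
have := fil_coeff0 (straight_lead qV q1 a cst1 sX u0) (w := 0); rewrite cht0 => /(_ isT).
by rewrite addr0 coeffB coeffZ coeffT eqxx mulr1 => /eqP; rewrite subr_eq0 => /eqP.
Qed.

Lemma coeff_XE c b a u : (a < b)%N -> wpos u ->
  coeff (ew a + ew b + ew c + u + w) (X c (E b a << u >>)) =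
  (bch (ew c) (u + (ew b + ew a) + w) * enorm b a u)%:P * ecoef b a u.
Proof.
move=> ab u0; have -> : ew a + ew b + ew c + u + w = u + (ew b + ew a) + ew c + w by weq.
rewrite (lead2 (fun v => straight_lead qV q1 c cst1 sX (u := v)) (Efil ab u0) ws).
by rewrite ecoefE [in RHS]polyCM mulrA.
Qed.

Lemma tnorm_neq0 c b a u : tnorm c b a u != 0.
Proof. by rewrite !mulf_neq0 ?bch_neq0. Qed.

Let bch_rules c b a := (bch_swap qV q1 c b, bch_swap qV q1 c a, bch_swap qV q1 b a,
   chiE qV q1 a w, chiE qV q1 b w, chiE qV q1 c w).

Lemma jacobi_coeff (e1 r1 e2 r2 e3 r3 e4 r4 e5 r5 e6 r6 : M) (x y z t : {poly K}) v :
  e1 + r1 + x *: (e2 + r2) + y *: (e3 + r3) = e4 + r4 + z *: (e5 + r5) + t *: (e6 + r6) ->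
  coeff v e1 + x * coeff v e2 + y * coeff v e3 - coeff v e4 - z * coeff v e5 - t * coeff v e6 =
  coeff v (r4 + z *: r5 + t *: r6 - (r1 + x *: r2 + y *: r3)).
Proof.
move=> /(congr1 (coeff v)); rewrite coeffB !(coeffD, coeffZ) => h.
by apply/eqP; rewrite -subr_eq0; apply/eqP; rewrite -[RHS](subrr (coeff v e1 + coeff v r1
  + x * (coeff v e2 + coeff v r2) + y * (coeff v e3 + coeff v r3))) {2}h; ring.
Qed.

(** The source of the Koszul factors: a letter to the left of a defect has to be moved past [T^w],
    which costs [chi]; a letter to the right costs nothing. *)
Lemma tnormE c b a u :
  [/\ bch (ew a) u * enorm c b (u + ew a) = tnorm c b a u,
      q c b * (bch (ew b) (u + (ew c + ew a) + w) * enorm c a u) = chi b w * tnorm c b a u &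
      q c b * q c a * (bch (ew c) u * enorm b a (u + ew c)) = tnorm c b a u] /\
  [/\ bch (ew c) (u + (ew b + ew a) + w) * enorm b a u = chi c w * tnorm c b a u,
      q b a * (bch (ew b) u * enorm c a (u + ew b)) = tnorm c b a u &
      q b a * q c a * (bch (ew a) (u + (ew c + ew b) + w) * enorm c b u) = chi a w * tnorm c b a u].
Proof.
rewrite /enorm /tnorm !(bchDr qV); split; split; first by ring.
by rewrite !(bch_rules c b a); ring.
by rewrite !(bch_rules c b a); ring.
by rewrite !(bch_rules c b a); ring.
by rewrite !(bch_rules c b a); ring.
by rewrite !(bch_rules c b a); ring.
Qed.

Lemma ecoef_Qdiff c b a u : (a < b)%N -> (b < c)%N -> wpos u ->
  (tnorm c b a u)%:P * (ecoef c b (u + ew a) + (chi b w)%:P * ecoef c a u + ecoef b a (u + ew c)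
     - (chi c w)%:P * ecoef b a u - ecoef c a (u + ew b) - (chi a w)%:P * ecoef c b u) =
  coeff (ew a + ew b + ew c + u + w) (Qupp q cst X c b a << u >> - Qlow q cst X c b a << u >>).
Proof.
move=> ab bc u0; have ac := ltn_trans ab bc.
have J := jacobi_coeff (ew a + ew b + ew c + u + w) (jacobi q cst X c b a << u >>).
have p1 : ew b + ew a + ew c + u + w = ew a + ew b + ew c + u + w by weq.
have p2 : ew c + ew b + ew a + u + w = ew a + ew b + ew c + u + w by weq.
have p3 : ew a + ew c + ew b + u + w = ew a + ew b + ew c + u + w by weq.
have p4 : ew b + ew c + ew a + u + w = ew a + ew b + ew c + u + w by weq.
have p5 : ew c + ew a + ew b + u + w = ew a + ew b + ew c + u + w by weq.
have t1 := coeff_EX a bc u0; have t2 := coeff_XE b ac u0; have t3 := coeff_EX c ab u0.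
have t4 := coeff_XE c ab u0; have t5 := coeff_EX b ac u0; have t6 := coeff_XE a bc u0.
rewrite ?(p1, p2, p3, p4, p5) in t1 t2 t3 t4 t5 t6.
apply: etrans _ J; move: (E b a << u >>) (E c a << u >>) (E c b << u >>) t2 t4 t6 => f1 f2 f3 t2 t4 t6.
rewrite t1 t3 t5.
rewrite t2.
rewrite t4 t6 => {t1 t2 t3 t4 t5 t6}.
have [[n1 n2 n3] [n4 n5 n6]] := tnormE c b a u.
have mulPA (x y : K) (r : {poly K}) : x%:P * (y%:P * r) = (x * y)%:P * r by rewrite mulrA -polyCM.
rewrite n1 n4 (mulPA (q c b)) n2 (mulPA (q c b * q c a)) n3 (mulPA (q b a)) n5.
rewrite (mulPA (q b a * q c a)) n6 (polyCM (chi a w)) (polyCM (chi b w)) (polyCM (chi c w)).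
move: (ecoef c b (u + ew a)) (ecoef c a u) (ecoef b a (u + ew c)) (ecoef b a u)
  (ecoef c a (u + ew b)) (ecoef c b u) (tnorm c b a u)%:P => x1 x2 x3 x4 x5 x6 t.
by ring.
Qed.

(** On [<< 0 >>] every other defect term falls on a monomial where [straight] imposes the relation;
    only the genuine overlap [x_c x_b x_a] remains. *)
Lemma ecoef_Qdiff0 c b a : (a < b)%N -> (b < c)%N ->
  (tnorm c b a 0)%:P * ecoef c b (ew a) =
    coeff (ew a + ew b + ew c + w) (Qupp q cst X c b a << 0 >> - Qlow q cst X c b a << 0 >>) /\
  fil (ew a + ew b + ew c) s (Qupp q cst X c b a << 0 >> - Qlow q cst X c b a << 0 >>).
Proof.
move=> ab bc; have ac := ltn_trans ab bc; split.
  have := ecoef_Qdiff ab bc (@wpos0 n); rewrite !add0r addr0 => <-.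
  rewrite (@ecoef_low b a (ew c)) // ?(@ecoef_low c a (ew b)) //; last 2 first.
  - by rewrite -[ew b]add0r; apply: low_ew (low0 _); apply: ltnW.
  - by rewrite -[ew c]add0r; apply: low_ew (low0 _); apply: ltnW.
  rewrite !(@ecoef_low _ _ 0) ?low0 //.
  by congr (_ * _); ring.
have [X1 E0 _] := sX.
have J := jacobi q cst X c b a << 0 >>.
have E00 i j : (j < i)%N -> E i j << 0 >> = 0 by move=> ji; rewrite E0 // low0.
have E01 i j k : (j < i)%N -> (j <= k)%N -> E i j (X k << 0 >>) = 0.
  by move=> ji jk; rewrite X1 ?low0 // E0 ?wposD // low_ew ?low0.
have XZ i : X i 0 = 0 by rewrite linear0.
rewrite (E00 b a) // (E00 c a) // (E00 c b) // !XZ in J.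
rewrite (E01 b a c) ?(ltnW ac) // (E01 c a b) ?(ltnW ab) // in J.
have -> : Qupp q cst X c b a << 0 >> - Qlow q cst X c b a << 0 >> = E c b (X a << 0 >>).
  have H (e r1 r2 r3 r4 r5 r6 : M) (x y z t : {poly K}) :
      e + r1 + x *: (0 + r2) + y *: (0 + r3) = 0 + r4 + z *: (0 + r5) + t *: (0 + r6) ->
      r4 + z *: r5 + t *: r6 - (r1 + x *: r2 + y *: r3) = e.
    by rewrite !add0r => <-; apply/eqP; rewrite subr_eq !addrA.
  exact: H J.
have -> : ew a + ew b + ew c = 0 + ew a + (ew c + ew b) by weq.
have := Eop_fil Efil bc (raising_fil a (straight_raising sX) (fil_T G K (@wpos0 n))).
by rewrite add0n.
Qed.

(** By [shiftop_Qdiff] the overlap defect commutes with right multiplication, so it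
    is the same for every [u]. *)
Lemma ecoef_cocycle c b a u : (a < b)%N -> (b < c)%N -> wpos u ->
  ecoef c b (u + ew a) + (chi b w)%:P * ecoef c a u + ecoef b a (u + ew c)
     - (chi c w)%:P * ecoef b a u - ecoef c a (u + ew b) - (chi a w)%:P * ecoef c b u =
  ecoef c b (ew a).
Proof.
move=> ab bc u0; have tn0 := tnorm_neq0 c b a u.
have [h0 f0] := ecoef_Qdiff0 ab bc.
have tI x y : (tnorm c b a u)%:P * x = (tnorm c b a u)%:P * y -> x = y.
  by apply: mulfI; rewrite polyC_eq0.
apply: tI; rewrite ecoef_Qdiff //.
have h1 := fil_coeff0 (shiftop_Qdiff cst1 sX Efil c b a u0) (w := w).
move: h1; rewrite ws => /(_ (ltnSn _)) /eqP; rewrite coeffB subr_eq0 => /eqP ->.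
have h2 := lead2 (fun v => @shiftop_lead _ _ _ _ qV q1 _ _ cst1 sX u v u0) f0 ws.
rewrite h2 -h0 mulrA -polyCM; congr (_%:P * _).
by rewrite /tnorm !(bchDr qV) !(bchDl qV) !(bch0r q); ring.
Qed.

(** The cocycle identity for each three of the letters [a < b < c < d], evaluated on the fourth.
    Defects on low monomials vanish, and eliminating the values on quadratic monomials leaves a
    relation among overlaps. *)
Lemma ecoef_closed (d c b a : 'I_n) : (a < b)%N -> (b < c)%N -> (c < d)%N ->
  (chi d w - 1)%:P * ecoef c b (ew a) - (chi c w - 1)%:P * ecoef d b (ew a)
  + (chi b w - 1)%:P * ecoef d c (ew a) - (chi a w - 1)%:P * ecoef d c (ew b) = 0.
Proof.
move=> ab bc cd; have ac := ltn_trans ab bc; have bd := ltn_trans bc cd; have ad := ltn_trans ab bd.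
have l1 i j : (i <= j)%N -> low i (ew j) by move=> ij; rewrite -[ew j]add0r low_ew ?low0.
have l2 i j k : (i <= j)%N -> (i <= k)%N -> low i (ew j + ew k) by move=> ij ik; rewrite low_ew ?l1.
have z1 i j k : (j < i)%N -> (j <= k)%N -> ecoef i j (ew k) = 0.
  by move=> ji jk; rewrite ecoef_low ?l1.
have z2 i j k l : (j < i)%N -> (j <= k)%N -> (j <= l)%N -> ecoef i j (ew k + ew l) = 0.
  by move=> ji jk jl; rewrite ecoef_low ?l2 ?wposD.
have [[ab' bc'] cd'] := (ltnW ab, ltnW bc, ltnW cd).
have [[ac' bd'] ad'] := (ltnW ac, ltnW bd, ltnW ad).
have e1 := ecoef_cocycle ab bd (wpos_ew c).
rewrite (z1 d a c) // (z2 b a c d) // (z1 b a c) // (z2 d a c b) // (z1 d b c) // in e1.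
have e2 := ecoef_cocycle ab bc (wpos_ew d).
rewrite (z1 c a d) // (z2 b a d c) // (z1 b a d) // (z2 c a d b) // (z1 c b d) // in e2.
have e3 := ecoef_cocycle ac cd (wpos_ew b).
rewrite (z1 d a b) // (z2 c a b d) // (z1 c a b) // (z2 d a b c) // in e3.
have e4 := ecoef_cocycle bc cd (wpos_ew a).
rewrite !(mulr0, subr0, addr0) in e1 e2 e3.
rewrite [ew a + ew c]addrC e1 [ew a + ew d]addrC e2 [ew a + ew b]addrC in e4.
move: e3 e4; move: (ecoef d c (ew b + ew a)) (ecoef d c (ew b)) (ecoef d c (ew a))
 (ecoef d b (ew a)) (ecoef c b (ew a)) => x y z s' t e3 e4.
have ex : x = z + (chi a w)%:P * y by rewrite -e3; ring.
move/eqP: e4; rewrite -subr_eq0 => /eqP e4.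
by rewrite -[RHS]oppr0 -[in RHS]e4 ex !polyCB; ring.
Qed.

(** Diamond lemma at one weight: with the smallest letter [a] peeled off [u], the cocycle identity
    reduces [u] to [u - ew a], with the overlap as inhomogeneous term. *)
Lemma ecoef_diamond :
  (forall c b a, (a < b)%N -> (b < c)%N -> ecoef c b (ew a) = 0) ->
  forall c b u, (b < c)%N -> wpos u -> ecoef c b u = 0.
Proof.
move=> o0 c b u bc u0; have [m] : exists m : nat, wlen G u <= m%:Z.
  by exists (absz (wlen G u)); lia.
elim: m c b u bc u0 => [|m IH] c b u bc u0 um.
  have [lb|/(low_split u0)[a [_ _ u'0 _]]] := boolP (low b u); first exact: ecoef_low.
  have := wlen_ge0 G u'0; rewrite wlenB wlen_ew; have := clen_gt0 G a; lia.
have [lb|/(low_split u0)[a [ab la u'0 la']]] := boolP (low b u); first exact: ecoef_low.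
have := ecoef_cocycle ab bc u'0; rewrite subrK o0 //.
have [ab' bc'] := (ltnW ab, ltnW bc); have ac := ltn_trans ab bc.
rewrite (ecoef_low u'0 ac la') (ecoef_low u'0 ab la').
have z1 : ecoef b a (u - ew a + ew c) = 0.
  by apply: ecoef_low; [exact: wposD| |rewrite low_ew // ltnW].
have z2 : ecoef c a (u - ew a + ew b) = 0.
  by apply: ecoef_low; [exact: wposD| |rewrite low_ew].
rewrite z1 z2.
rewrite (IH c b (u - ew a)) //; last by rewrite wlenB wlen_ew; have := clen_gt0 G a; lia.
by rewrite !(mulr0, subr0, addr0).
Qed.

End Cocycle.

Local Transparent Eop Qop.

(** * Effect of a change of coefficients on the overlaps *)

Section Compare.
Variables (n : nat) (G : cone n) (K : fieldType) (q : 'I_n -> 'I_n -> K).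
Hypothesis qV : forall i j, q i j * q j i = 1.
Hypothesis q1 : forall i, q i i = 1.
Implicit Types (u v w : weight n) (i j k l a b c : 'I_n).
Notation M := {freeg (weight n) / {poly K}}.
Notation fil := (fil G).
Notation bch := (bch q).
Notation chi := (chi q).

Lemma ew_pair_inj k l k' l' : (k <= l)%N -> (k' <= l')%N ->
  ew k + ew l = ew k' + ew l' -> (k, l) = (k', l').
Proof.
move=> kl kl' e; have [kk|kk] := eqVneq k k'.
  by move: e; rewrite kk => /addrI /ffunP /(_ l); rewrite !ffunE eqxx; case: eqVneq => // ->.
have := congr1 (fun f : weight n => f k) e; have := congr1 (fun f : weight n => f k') e.
have kk' : (k' == k) = false by rewrite eq_sym (negPf kk).
rewrite !ffunE !eqxx (negPf kk) kk'.
have [k'l|_] := eqVneq k' l; last by case: (k' == l').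
have [kl''|_] := eqVneq k l'; last by case: (k == l).
move=> _ _; case/eqP: kk; apply: val_inj; apply/eqP; rewrite eqn_leq.
by rewrite {1}k'l kl {1}kl'' kl'.
Qed.

Lemma Qop_eq (N : lmodType {poly K}) (Y : 'I_n -> {linear N -> N})
    (cst cst' : 'I_n -> 'I_n -> weight n -> {poly K}) b a p :
  Qop cst' Y b a p - Qop cst Y b a p = Qop (fun b a w => cst' b a w - cst b a w) Y b a p.
Proof. by rewrite -sumrB; apply: eq_bigr => kl _; rewrite scalerBl. Qed.

Lemma Eop_fil_step cst X s : deforming G 1 cst -> straight G q cst X ->
  (forall b a u, (a < b)%N -> wpos u -> fil (u + (ew b + ew a)) s (Eop q cst X b a << u >>)) ->
  (forall w c b a, cmem G w -> cht G w = s -> (a < b)%N -> (b < c)%N -> ecoef q cst X w c b (ew a) = 0) ->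
  forall b a u, (a < b)%N -> wpos u -> fil (u + (ew b + ew a)) s.+1 (Eop q cst X b a << u >>).
Proof.
move=> cst1 sX Efil o0 b a u ab u0 v; have [h1 h2] := Efil b a u ab u0 v; split=> //.
have [->|nz] := eqVneq (coeff v (Eop q cst X b a << u >>)) 0; first by left.
have [mw sw] := homog_mem h1 nz.
case: h1 => [->|[_ _ e]]; first by left.
right; split=> //; rewrite ltn_neqAle sw andbT; apply: contra_neq nz => ws.
have wE : v = u + (ew b + ew a) + (v - (u + (ew b + ew a))) by rewrite addrC subrK.
rewrite {1}wE (ecoefE qV); have := ecoef_diamond qV q1 cst1 sX Efil (esym ws).
by move=> -> //; rewrite ?mulr0 // => c0 b0 a0; apply: o0.
Qed.

Lemma homog_ecoef cst X s w c b u :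
  (forall b a u, (a < b)%N -> wpos u -> fil (u + (ew b + ew a)) s (Eop q cst X b a << u >>)) ->
  (b < c)%N -> wpos u -> homog G s w (ecoef q cst X w c b u) /\
  (ecoef q cst X w c b u != 0 -> wpos (u + (ew c + ew b) + w)).
Proof.
move=> Efil bc u0; have [h1 h2] := Efil c b u bc u0 (u + (ew c + ew b) + w).
split; first by apply: homogZ; move: h1; rewrite [_ + w]addrC addrK.
by move=> nz; apply: h2; apply: contra_neq nz => z; rewrite /ecoef z mulr0.
Qed.

Section Two.
Variables (cst cst' : 'I_n -> 'I_n -> weight n -> {poly K}) (X X' : 'I_n -> {linear M -> M}).
Hypotheses (cst1 : deforming G 1 cst) (sX : straight G q cst X).
Hypotheses (cst1' : deforming G 1 cst') (sX' : straight G q cst' X').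
Variable s : nat.
Hypothesis dcst : deforming G s (fun b a w => cst' b a w - cst b a w).
Notation Q := (Qop cst X).
Notation Q' := (Qop cst' X').
Notation E := (Eop q cst X).
Notation E' := (Eop q cst' X').
Let HX := straight_raising sX.
Let HX' := straight_raising sX'.

Lemma straight_compare i v : wpos v -> fil (v + ew i) s (X' i << v >> - X i << v >>).
Proof.
move=> v0; have [X1' X2' X3'] := sX'.
apply: (@intertwine n G K q cst cst1 X M X' idfun (fun v => fil v s)) => //.
- by move=> x; apply: fil0.
- by move=> x y z; apply: filD.
- by move=> x y r z; apply: fil_comp_ZZ.
- by move=> x j z; apply: raising_fil.
- by move=> j x x0 lj; rewrite /= X1' // subrr; apply: fil0.
move=> j k x x0 kj lk /=.
have -> : Eop q cst X' j k << x >> = Qop cst' X' j k << x >> - Qop cst X' j k << x >>.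
  by rewrite -[LHS]subr0 -(X2' j k x x0 kj lk) /Eop opprB addrC addrA subrK.
rewrite Qop_eq -[s]addn0; apply: Qop_fil => //; exact: fil_T.
Qed.

Lemma compare_fil i v s0 p : fil v s0 p -> fil (v + ew i) (s0 + s) (X' i p - X i p).
Proof.
pose f : {linear M -> M} := X' i \- X i.
by move=> hp; apply: (@fil_lin _ G K f) hp => u u0; apply: straight_compare.
Qed.

Lemma compare2_fil k l v p : fil v 0 p ->
  fil (v + ew l + ew k) s (X' k (X' l p) - X k (X l p)).
Proof.
move=> hp; have h1 := raising_fil k HX' (compare_fil l hp).
have h2 := compare_fil k (raising_fil l HX hp).
by have := filD h1 h2; rewrite linearB addrA subrK.
Qed.

(** Replacing [X] by [X'] costs an error of order [s], and the factor [cst] in front adds one more;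
    in height [s] only the change of coefficients is visible. *)
Lemma Qop_cst b a p v : fil v 0 p ->
  fil (v + ew b + ew a) s.+1 (Q' b a p - Q b a p - Qop (fun b a w => cst' b a w - cst b a w) X' b a p).
Proof.
move=> hp; have D1 (x y z : M) : x - y - (x - z) = z - y by rewrite opprB addrC addrA subrK.
rewrite -Qop_eq D1 -sumrB.
apply: fil_sum => -[k l] _ /=; rewrite -scalerBr -[s.+1]add1n; apply: (filMZ (cst1 _ _ _)).
have -> : v + ew b + ew a + wt a b k l = v + ew l + ew k by rewrite /wt; weq.
exact: compare2_fil.
Qed.

Lemma Qop_compare b a p v : fil v 0 p ->
  fil (v + ew b + ew a) s (Q' b a p - Q b a p).
Proof.
move=> hp; have h1 := fil_le (leqnSn s) (Qop_cst b a hp).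
have h2 := Qop_fil b a dcst HX' hp; rewrite addn0 in h2.
by have := filD h1 h2; rewrite subrK.
Qed.

Lemma Eop_compare b a u : wpos u ->
  fil (u + (ew b + ew a)) s (E' b a << u >> - E b a << u >>).
Proof.
move=> u0; have hu := fil_T G K u0.
have h1 := compare2_fil b a hu; have h2 := filZ (q b a) (compare2_fil a b hu).
have h3 := Qop_compare b a hu.
have e1 : u + ew a + ew b = u + (ew b + ew a) by weq.
rewrite e1 in h1; rewrite -!addrA in h2 h3.
have := filB (filB h1 h2) h3; congr (fil _ _ _); rewrite /Eop scalerBr.
move: (X' b _) (X b _) (_ *: X' a _) (_ *: X a _) (Q' _ _ _) (Q _ _ _) => x y z t r1 r2.
have D0 (a1 a2 a3 a4 : M) : a1 - a2 - (a3 - a4) = a1 - a3 - (a2 - a4).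
  by rewrite !opprB addrACA [RHS]addrACA; congr (_ + _); apply: addrC.
by rewrite [x - y - (z - t)]D0 [LHS]D0. 
Qed.

Lemma coeff_XX k l u : wpos u -> coeff (u + ew l + ew k) (X' k (X' l << u >>)) =
  (bch (ew k) (ew l + u) * bch (ew l) u)%:P.
Proof.
move=> u0; have h := straight_lead qV q1 _ cst1' sX'.
have := lead2 (fun v => h k v) (raising_fil l HX' (fil_T G K u0)) (w := 0).
rewrite cht0 !addr0 => /(_ erefl) ->.
have := lead2 (fun v => h l v) (fil_T G K u0) (w := 0).
by rewrite cht0 !addr0 => /(_ erefl) ->; rewrite coeffT eqxx mulr1 -polyCM [u + ew l]addrC.
Qed.

Variable w : weight n.
Hypothesis ws : cht G w = s.
Notation enorm := (enorm q w).

(** Divided by the scalar of [T^w T_b T_a], so that only the factors [chi] remain in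
    [ecoef_compare]. *)
Definition dcoef b a : {poly K} :=
  (bch w (ew b + ew a) * bch (ew b) (ew a))^-1%:P * (cst' b a w - cst b a w).

Hypothesis dsupp : forall b a, cst' b a w - cst b a w != 0 ->
  exists k l, (k <= l)%N /\ wt a b k l = w.

Lemma Qop_lead b a u : wpos u ->
  coeff (u + (ew b + ew a) + w) (Q' b a << u >> - Q b a << u >>) = (enorm b a u)%:P * dcoef b a.
Proof.
move=> u0; have hu := fil_T G K u0.
have h1 := fil_coeff0 (Qop_cst b a hu) (w := w).
rewrite ws ltnSn coeffB in h1.
have -> : u + (ew b + ew a) + w = u + ew b + ew a + w by weq.
move/(_ isT)/eqP: h1; rewrite subr_eq0 => /eqP ->.
rewrite /Qop raddf_sum /=.
(* A contributing weight has height at least [s] and differs from [w] by an element of the cone;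
   additivity of heights forces the difference to have height 0, hence to vanish. *)
have F0 k l : wt a b k l != w -> coeff (u + ew b + ew a + w)
    ((cst' b a (wt a b k l) - cst b a (wt a b k l)) *: X' k (X' l << u >>)) = 0.
  move=> wk; rewrite coeffZ.
  have hd := dcst b a (wt a b k l).
  have [->|nz] := eqVneq (cst' b a (wt a b k l) - cst b a (wt a b k l)) 0; first by rewrite mul0r.
  have [mk sk] := homog_mem hd nz.
  have [hx _] := raising_fil k HX' (raising_fil l HX' hu) (u + ew b + ew a + w).
  have e : u + ew b + ew a + w - (u + ew l + ew k) = w - wt a b k l by rewrite /wt; weq.
  rewrite e in hx.
  have [->|nz'] := eqVneq (coeff (u + ew b + ew a + w) (X' k (X' l << u >>))) 0; first by rewrite mulr0.
  have [mk' _] := homog_mem hx nz'.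
  have : cht G (wt a b k l + (w - wt a b k l)) = s by rewrite addrC subrK.
  rewrite chtD // => hs.
  have h0 : cht G (w - wt a b k l) = 0%N by lia.
  by move: wk; rewrite eq_sym -subr_eq0 (cht0_eq0 mk' h0) eqxx.
have [d0|/dsupp [k [l [kl wk]]]] := eqVneq (cst' b a w - cst b a w) 0.
  rewrite /dcoef d0 !mulr0; apply: big1 => -[k l] _ /=.
  by have [wk|/F0 //] := eqVneq (wt a b k l) w; rewrite wk d0 scale0r coeff0.
rewrite (bigD1 (k, l)) //= big1 ?addr0 => [|[k' l'] /andP[/= kl' ne]]; last first.
  apply: F0; apply: contra ne => /eqP wk'; apply/eqP/ew_pair_inj => //.
  have := wk'; rewrite -wk /wt => /eqP; rewrite !(inj_eq (addIr _)) => /eqP ->.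
  by [].
rewrite wk coeffZ /dcoef.
have -> : u + ew b + ew a + w = u + ew l + ew k by rewrite -wk /wt; weq.
rewrite coeff_XX // mulrC mulrA -polyCM; congr (_%:P * _).
have wE : ew l + ew k = w + ew b + ew a by rewrite -wk /wt; weq.
have e1 : bch (ew k) (ew l + u) * bch (ew l) u = bch (ew l + ew k) u.
  rewrite (bchDr qV) (bchDl qV) (bch_ew q k l) ltnNge kl /=; ring.
rewrite e1 wE /enorm !(bchDr qV) !(bchDl qV).
by field; rewrite !(bch_neq0 qV).
Qed.

Lemma coeff_XQ c b a :
  coeff (ew a + ew b + ew c + w) (X' c (Q' b a << 0 >>) - X c (Q b a << 0 >>)) =
  (bch (ew c) (0 + (ew b + ew a) + w) * enorm b a 0)%:P * dcoef b a.
Proof.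
have h0 : fil 0 0 << 0 >> := fil_T G K (@wpos0 n).
have -> : X' c (Q' b a << 0 >>) - X c (Q b a << 0 >>) =
   X' c (Q' b a << 0 >> - Q b a << 0 >>) + (X' c (Q b a << 0 >>) - X c (Q b a << 0 >>)).
  by rewrite linearB addrA subrK.
have h1 := Qop_compare b a h0; have h2 := compare_fil c (Qop_fil b a cst1 HX h0).
have -> : ew a + ew b + ew c + w = 0 + ew b + ew a + ew c + w by weq.
rewrite coeffD (fil_coeff0 h2) ?ws ?addr0 //.
have h := straight_lead qV q1 c cst1' sX'.
rewrite (lead2 (fun v => h v) h1 ws) -[0 + ew b + ew a]addrA.
by rewrite Qop_lead // mulrA -polyCM.
Qed.

Lemma coeff_QX c b a :
  coeff (ew a + ew b + ew c + w) (Q' c b (X' a << 0 >>) - Q c b (X a << 0 >>)) =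
  (enorm c b (0 + ew a))%:P * dcoef c b.
Proof.
have [X1 _ _] := sX; have [X1' _ _] := sX'.
rewrite X1 ?X1' ?low0 // -Qop_lead ?wposD //; congr (coeff _ _); weq.
Qed.

Hypothesis Efil : forall b a u, (a < b)%N -> wpos u -> fil (u + (ew b + ew a)) s (E b a << u >>).

Lemma Efil_compare b a u : (a < b)%N -> wpos u -> fil (u + (ew b + ew a)) s (E' b a << u >>).
Proof.
move=> ab u0; have := filD (Eop_compare b a u0) (Efil ab u0).
by rewrite subrK.
Qed.

(** At [u = 0] both overlap coefficients are read off from [Qupp - Qlow]. There [x_c] to the left of
    [Q b a] contributes [chi c w] and [x_c] to its right contributes 1, and likewise for the other
    letters; the sum is the Koszul coboundary of [dcoef]. *)
Lemma ecoef_compare c b a : (a < b)%N -> (b < c)%N ->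
  ecoef q cst' X' w c b (ew a) - ecoef q cst X w c b (ew a) =
  (chi c w - 1)%:P * dcoef b a - (chi b w - 1)%:P * dcoef c a + (chi a w - 1)%:P * dcoef c b.
Proof.
move=> ab bc.
have [h _] := ecoef_Qdiff0 qV q1 cst1 sX Efil ws ab bc.
have [h' _] := ecoef_Qdiff0 qV q1 cst1' sX' Efil_compare ws ab bc.
have [[n1 n2 n3] [n4 n5 n6]] := tnormE qV q1 w c b a 0.
rewrite !bch0r mul1r in n1; rewrite !bch0r mul1r in n3; rewrite !bch0r mul1r in n5.
apply: (mulfI (_ : (tnorm q w c b a 0)%:P != 0)); first by rewrite polyC_eq0 tnorm_neq0.
rewrite mulrBr h h'.
have e1 : ew b + ew a + ew c + w = ew a + ew b + ew c + w by weq.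
have e2 : ew c + ew a + ew b + w = ew a + ew b + ew c + w by weq.
have e3 : ew c + ew b + ew a + w = ew a + ew b + ew c + w by weq.
have e4 : ew a + ew c + ew b + w = ew a + ew b + ew c + w by weq.
have e5 : ew b + ew c + ew a + w = ew a + ew b + ew c + w by weq.
have t1 := coeff_XQ c b a; have t2 := coeff_QX c a b; have t3 := coeff_XQ a c b.
have t4 := coeff_QX c b a; have t5 := coeff_XQ b c a; have t6 := coeff_QX b a c.
rewrite ?(e1, e2, e3, e4, e5) in t1 t2 t3 t4 t5 t6.
rewrite n1 in t4; rewrite n4 in t1.
move: t1 t2 t3 t4 t5 t6; rewrite /Qupp /Qlow.
move: (X' c (Q' b a _)) (X c (Q b a _)) (Q' c a (X' b _)) (Q c a (X b _)) (X' a (Q' c b _)) (X a (Q c b _)).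
move: (Q' c b (X' a _)) (Q c b (X a _)) (X' b (Q' c a _)) (X b (Q c a _)) (Q' b a (X' c _)) (Q b a (X c _)).
move=> y1' y1 y2' y2 y3' y3 x1' x1 x2' x2 x3' x3.
rewrite !coeffB => t1 t2 t3 t4 t5 t6.
move: n2 n3 n5 n6; move: (bch _ _ * enorm c a 0) (enorm b a (0 + ew c)) (enorm c a (0 + ew b)) (bch _ _ * enorm c b 0)
  t2 t3 t5 t6 => k5 k6 k2 k3 t2 t3 t5 t6 n2 n3 n5 n6.
rewrite !(coeffD, coeffZ); move: (coeff _ x1') (coeff _ x2') (coeff _ x3') (coeff _ y1') (coeff _ y2') (coeff _ y3')
  (coeff _ x1) (coeff _ x2) (coeff _ x3) (coeff _ y1) (coeff _ y2) (coeff _ y3) t1 t2 t3 t4 t5 t6.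
move=> {}x1' {}x2' {}x3' {}y1' {}y2' {}y3' {}x1 {}x2 {}x3 {}y1 {}y2 {}y3 t1 t2 t3 t4 t5 t6.
transitivity ((x1' - x1) + (q b a)%:P * (x2' - x2) + (q b a * q c a)%:P * (x3' - x3)
  - ((y1' - y1) + (q c b)%:P * (y2' - y2) + (q c b * q c a)%:P * (y3' - y3))); first by ring.
have mulPA (x y : K) (r : {poly K}) : x%:P * (y%:P * r) = (x * y)%:P * r by rewrite mulrA -polyCM.
rewrite t1 t2 t3 t4 t5 t6; move: (dcoef b a) (dcoef c a) (dcoef c b) => d1 d2 d3.
rewrite !mulPA n2 n3 n5 n6 !polyCB !(polyCM (chi _ w)); ring.
Qed.

End Two.
End Compare.

(** * Solving for the deformation *)

Lemma wpos_sum2 n (v : weight n) : wpos v -> \sum_i v i = 2 ->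
  exists k l : 'I_n, (k <= l)%N /\ v = ew k + ew l.
Proof.
have step (u : weight n) (m : nat) : wpos u -> \sum_i u i = m.+1%:Z ->
    exists k : 'I_n, wpos (u - ew k) /\ \sum_i (u - ew k) i = m%:Z.
  move=> u0 us; have /existsP[k uk] : [exists k, u k != 0].
    apply: contra_eqT us; rewrite negb_exists => /forallP H.
    by rewrite big1 // => i _; apply/eqP; rewrite -[_ == _]negbK.
  exists k; split.
    apply/wposP => i; rewrite !ffunE; case: eqVneq => [->|_] /=; last by rewrite subr0 (wposP _ u0).
    by have := wposP _ u0 k; lia.
  under eq_bigr do rewrite !ffunE.
  rewrite big_split /= us sumrN (bigD1 k) //= eqxx big1 ?addr0 => [|i /negPf -> //]; lia.
move=> v0 /(step v 1%N v0)[k [k0 ks]]; have [l [l0 ls]] := step _ 0%N k0 ks.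
have vE : v = ew k + ew l.
  apply/eqP; rewrite -subr_eq0 opprD addrA; apply/eqP/ffunP => i; rewrite [RHS]ffunE.
  have /eqP := ls; rewrite psumr_eq0 => [/allP /(_ i)|j _]; last exact: (wposP _ l0).
  by rewrite mem_index_enum => /(_ isT) /eqP.
have [kl|/ltnW lk] := leqP k l; first by exists k, l.
by exists l, k; rewrite addrC.
Qed.

Section Solve.
Variables (n : nat) (K : fieldType) (y : 'I_n -> K) (tau : 'I_n -> 'I_n -> 'I_n -> {poly K}) (i : 'I_n).
Hypothesis yi : y i != 0.
Hypothesis closed : forall d c b a : 'I_n, (a < b)%N -> (b < c)%N -> (c < d)%N ->
  (y d)%:P * tau c b a - (y c)%:P * tau d b a + (y b)%:P * tau d c a - (y a)%:P * tau d c b = 0.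

(** The Koszul differential of multiplication by [y] becomes exact once [y i] is
    invertible; this is the homotopy it yields in degree 3. *)
Definition contraction (b a : 'I_n) : {poly K} :=
  (y i)^-1%:P * (if (b < i)%N then tau i b a
                 else if (a < i)%N && (i < b)%N then - tau b i a
                 else if (i < a)%N then tau b a i else 0).

(** If [i] is one of the three letters the identity is formal; otherwise it is [closed] for [a],
    [b], [c] and [i] in increasing order. *)
Lemma contractionP (c b a : 'I_n) : (a < b)%N -> (b < c)%N ->
  (y c)%:P * contraction b a - (y b)%:P * contraction c a + (y a)%:P * contraction c b = tau c b a.
Proof.
move=> ab bc; have ac := ltn_trans ab bc.
have yI x z : (y i)%:P * x = (y i)%:P * z -> x = z.
  by apply: mulfI; rewrite polyC_eq0.
have P (x z : {poly K}) : (y i)%:P * (z * ((y i)^-1%:P * x)) = z * x.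
  by rewrite mulrCA [(y i)%:P * _]mulrA -polyCM mulfV // mul1r.
have Z (u v z : {poly K}) : z = 0 -> u - v = z \/ v - u = z -> u = v.
  by move=> -> [] /eqP; rewrite subr_eq0 => /eqP.
have F (k l : 'I_n) : (k < l)%N -> (l < k)%N = false by move=> kl; rewrite ltnNge (ltnW kl).
apply: yI; rewrite /contraction mulrDr mulrBr !P.
pose S := (bc, ab, ac, F _ _ bc, F _ _ ab, F _ _ ac, ltnn, andbF).
have [ic|ci|/val_inj ->] := ltngtP i c; last first.
- by rewrite ?S /=; ring.
- rewrite (ltn_trans bc ci); apply: (Z _ _ _ (closed ab bc ci)); right; ring.
have [ib|bi|/val_inj ->] := ltngtP i b; last first.
- by rewrite ?S /=; ring.
- rewrite (ltn_trans ab bi) (F _ _ (ltn_trans ab bi)) /=.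
  by apply: (Z _ _ _ (closed ab bi ic)); left; ring.
have [ia|ai|/val_inj ->] := ltngtP i a; last first.
- by rewrite ?S /=; ring.
- by rewrite /=; apply: (Z _ _ _ (closed ai ib bc)); right; ring.
by rewrite /=; apply: (Z _ _ _ (closed ia ab bc)); left; ring.
Qed.

End Solve.

Section Deform.
Variables (n : nat) (G : cone n) (K : fieldType) (q : 'I_n -> 'I_n -> K).
Hypothesis qV : forall i j, q i j * q j i = 1.
Hypothesis q1 : forall i, q i i = 1.
Implicit Types (u v w : weight n) (i j k l a b c : 'I_n).
Notation M := {freeg (weight n) / {poly K}}.
Notation fil := (fil G).
Notation bch := (bch q).
Notation chi := (chi q).

Hypothesis cmem_sum : forall w, cmem G w -> \sum_i w i = 0.
Hypothesis cmem_rigid : forall w, cmem G w -> (2 <= cht G w)%N -> (forall i, -1 <= w i) ->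
  (#|[pred i | w i == -1%R]| <= 3)%N -> exists i, 0 <= w i /\ chi i w != 1.
Hypothesis cmem_first : forall w, cmem G w -> cht G w = 1%N ->
  exists i j : 'I_n, [/\ (i < j)%N, w i = -1, w j = -1 &
    forall k, k != i -> k != j -> 0 <= w k /\ chi k w = 1].

Lemma wt_repr a b w : cmem G w -> wpos (w + (ew a + ew b)) ->
  exists k l, (k <= l)%N /\ wt a b k l = w.
Proof.
move=> mw h; case: (wpos_sum2 h) => [|k [l [kl e]]].
  under eq_bigr do rewrite !ffunE.
  rewrite !big_split /= cmem_sum // add0r.
  have s1 c : \sum_(i < n) ((i == c) : nat)%:Z = 1.
    by rewrite (bigD1 c) //= eqxx big1 ?addr0 // => i /negPf ->.
  by rewrite !s1.
by exists k, l; split=> //; rewrite /wt -e; weq.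
Qed.

Lemma Eop_fil1 cst X b a u : deforming G 1 cst -> straight G q cst X -> wpos u ->
  fil (u + (ew b + ew a)) 1 (Eop q cst X b a << u >>).
Proof.
move=> cst1 sX u0; have HX := straight_raising sX; rewrite /Eop.
have L i j : fil (u + (ew b + ew a)) 1 (X i (X j << u >>) - (bch (ew i) (u + ew j) * bch (ew j) u)%:P *: << u + (ew j + ew i) >>)
    \/ ~ (((i == b) && (j == a)) || ((i == a) && (j == b))).
  have [e|] := boolP (((i == b) && (j == a)) || ((i == a) && (j == b))); last by right.
  left; have eij : ew j + ew i = ew b + ew a.
    by case/orP: e => /andP[/eqP -> /eqP ->] //; rewrite addrC.
  rewrite eij; have h1 := raising_fil i HX (straight_lead qV q1 j cst1 sX u0).
  have h2 := filZ (bch (ew j) u) (straight_lead qV q1 i cst1 sX (wposD u0 (wpos_ew j))).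
  have e1 : u + ew j + ew i = u + (ew b + ew a) by rewrite -addrA eij.
  have := filD h1 h2; rewrite e1; congr (fil _ _ _).
  rewrite linearB [X i (_ *: _)]linearZ /= scalerBr addrA subrK scalerA -polyCM.
  by rewrite [in LHS]mulrC.
have [hba|] := L b a; last by rewrite !eqxx.
have [hab|] := L a b; last by rewrite !eqxx orbT.
have hQ := Qop_fil b a cst1 HX (fil_T G K u0); rewrite addn0 -addrA in hQ.
have := filB (filB hba (filZ (q b a) hab)) hQ; congr (fil _ _ _); congr (_ - _).
rewrite scalerBr scalerA -polyCM [ew b + ew a]addrC.
have -> : q b a * (bch (ew a) (u + ew b) * bch (ew b) u) = bch (ew b) (u + ew a) * bch (ew a) u.
  by rewrite !(bchDr qV) (bch_swap qV q1 b a); ring.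
by rewrite opprB addrA subrK.
Qed.

(** All weights of height [s] are corrected at once, since in this height they do not interact.
    Corrections must sit on quadratic monomials, which is why the contracting index is taken with
    [w i >= 0]. *)
Lemma Eop_step cst X s : (2 <= s)%N -> deforming G 1 cst -> straight G q cst X ->
  (forall b a u, (a < b)%N -> wpos u -> fil (u + (ew b + ew a)) s (Eop q cst X b a << u >>)) ->
  exists cst' X', [/\ deforming G 1 cst', straight G q cst' X',
    forall b a u, (a < b)%N -> wpos u -> fil (u + (ew b + ew a)) s.+1 (Eop q cst' X' b a << u >>) &
    forall b a w, (cht G w < s)%N -> cst' b a w = cst b a w].
Proof.
move=> s2 cst1 sX Efil.
pose tau w c b a := - ecoef q cst X w c b (ew a).
pose con w i b a := contraction (fun j => chi j w - 1) (tau w) i b a.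
pose add b a w : {poly K} :=
  if [&& cmem G w, cht G w == s & (a < b)%N] then
    if [pick i | (0 <= w i) && (chi i w != 1)] is Some i then
      (bch w (ew b + ew a) * bch (ew b) (ew a))%:P * con w i b a
    else 0 else 0.
pose cst' b a w := cst b a w + add b a w.
have tauP w c b a : (b < c)%N -> homog G s w (tau w c b a) /\
    (tau w c b a != 0 -> wpos (ew a + (ew c + ew b) + w)).
  move=> bc; have [h1 h2] := homog_ecoef w Efil bc (wpos_ew a).
  by split; [exact: homogN|rewrite oppr_eq0].
have conP w i b a : (a < b)%N -> homog G s w (con w i b a) /\
    (con w i b a != 0 -> i != a /\ i != b /\ wpos (ew a + ew b + ew i + w)).
  move=> ab; rewrite /con /contraction.
  have C (x : {poly K}) : (chi i w - 1)^-1%:P * x != 0 -> x != 0.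
    by apply: contra_neq => ->; rewrite mulr0.
  case: ifP => [bi|_].
    have [h1 h2] := tauP w i b a bi; split; first exact: homogZ.
    move/C/h2 => p; rewrite -!val_eqE !gtn_eqF ?(ltn_trans ab bi) //; split=> //; split=> //.
    by move: p; congr (wpos _); weq.
  case: ifP => [/andP[ai ib]|_].
    have [h1 h2] := tauP w b i a ib; split; first by apply/homogZ/homogN.
    move/C; rewrite oppr_eq0 => /h2 p.
    rewrite -!val_eqE gtn_eqF // ltn_eqF //; split=> //; split=> //.
    by move: p; congr (wpos _); weq.
  case: ifP => [ia|_]; last by split; [rewrite mulr0; left|rewrite mulr0 eqxx].
  have [h1 h2] := tauP w b a i ab; split; first exact: homogZ.
  move/C/h2 => p; rewrite -!val_eqE !ltn_eqF ?(ltn_trans ia ab) //; split=> //; split=> //.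
  by move: p; congr (wpos _); weq.
have addP b a w : homog G s w (add b a w).
  rewrite /add; case: ifP => [/and3P[_ _ ab]|_]; last by left.
  case: pickP => [i _|_]; last by left.
  by apply: homogZ; case: (conP w i b a ab).
have addS b a w : add b a w != 0 -> exists k l, (k <= l)%N /\ wt a b k l = w.
  rewrite /add; case: ifP => [/and3P[mw _ ab]|_]; last by rewrite eqxx.
  case: pickP => [i /andP[wi _]|_]; last by rewrite eqxx.
  have [_ h] := conP w i b a ab; rewrite mulf_eq0 negb_or => /andP[_ /h[ia [ib p]]].
  apply: wt_repr => //; apply/wposP => j; have := wposP _ p j; rewrite !ffunE.
  by case: (eqVneq j i) => [->|] /=; rewrite ?(negPf ia) ?(negPf ib) /=; lia.
have cst1' : deforming G 1 cst'.
  by move=> b a w; apply: homogD => //; apply: homog_le (addP b a w); lia.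
have [X' sX'] := straight_exists q cst1'.
have dc b a w : cst' b a w - cst b a w = add b a w by rewrite /cst' addrC addKr.
have dcst : deforming G s (fun b a w => cst' b a w - cst b a w) by move=> b a w; rewrite dc.
exists cst', X'; split=> //; last first.
  move=> b a w ws; rewrite /cst' /add; case: ifP => [/and3P[_ /eqP e _]|_]; last by rewrite addr0.
  by rewrite e ltnn in ws.
have Efil' := Efil_compare cst1 sX sX' dcst Efil.
apply: Eop_fil_step => // w c b a mw ws ab bc.
have dS b' a' : cst' b' a' w - cst b' a' w != 0 -> exists k l, (k <= l)%N /\ wt a' b' k l = w.
  by rewrite dc; apply: addS.
have /eqP := ecoef_compare qV q1 cst1 sX cst1' sX' dcst ws dS Efil ab bc.
rewrite subr_eq => /eqP ->.
have ac := ltn_trans ab bc.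
have nI b' a' x : (bch w (ew b' + ew a') * bch (ew b') (ew a'))^-1%:P *
    ((bch w (ew b' + ew a') * bch (ew b') (ew a'))%:P * x) = x.
  by rewrite mulrA -polyCM mulVf ?mul1r // mulf_neq0 ?bch_neq0.
have dE b' a' : (a' < b')%N -> dcoef q cst cst' w b' a' =
    if [pick i | (0 <= w i) && (chi i w != 1)] is Some i then con w i b' a' else 0.
  move=> ab'; rewrite /dcoef (dc b' a' w) /add mw ws eqxx ab' /=.
  by case: pickP => [i _|_]; rewrite ?nI ?mulr0.
rewrite (dE b a ab) (dE c a ac) (dE c b bc) => {dE nI}.
case: pickP => [i /andP[wi ci]|none]; last first.
  (* Without a contracting index, a nonzero overlap coefficient would give [w] entries at least
     [-1], equal to [-1] at most at [a], [b], [c], against [cmem_rigid]. *)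
  rewrite !mulr0 subr0 !addr0 add0r; apply: contraTeq isT => o0.
  have [_ /(_ o0) p] := homog_ecoef w Efil bc (wpos_ew a).
  have p' j : - 1 <= w j /\ (j \notin [:: a; b; c] -> 0 <= w j).
    have := wposP _ p j; rewrite !ffunE !inE.
    have [nab nac nbc] : [/\ a != b, a != c & b != c] by rewrite -!val_eqE !ltn_eqF.
    case: (eqVneq j a) => [->|_]; first by rewrite (negPf nab) (negPf nac) /=; lia.
    case: (eqVneq j b) => [->|_]; first by rewrite (negPf nbc) /=; lia.
    by case: (eqVneq j c) => _ /=; lia.
  have [|||i [wi ci]] := cmem_rigid mw; rewrite ?ws //.
  - by move=> j; case: (p' j).
  - apply: leq_trans (card_size [:: a; b; c]); apply: subset_leq_card; apply/subsetP => j.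
    rewrite inE => /eqP wj; case: (p' j) => _; rewrite wj; case: (_ \in _) => //= /(_ isT); lia.
  - by have := none i; rewrite /= wi ci.
have -> := @contractionP n K (fun j => chi j w - 1) (tau w) i _ _ c b a ab bc.
- by rewrite /tau addNr.
- by rewrite subr_eq0.
move=> d' c' b' a' ab' bc' cd'; have := ecoef_closed qV q1 cst1 sX Efil ws ab' bc' cd'.
rewrite /tau; move: (ecoef q cst X w c' b' (ew a')) (ecoef q cst X w d' b' (ew a'))
  (ecoef q cst X w d' c' (ew a')) (ecoef q cst X w d' c' (ew b')) => x1 x2 x3 x4 /eqP.
by rewrite -oppr_eq0 => /eqP <-; ring.
Qed.

(** Vanishing on overlaps raises the order of every defect without bound, whereas each coefficient
    has a fixed height. *)
Lemma Eop_eq0 cst X : deforming G 1 cst -> straight G q cst X ->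
  (forall c b a, (a < b)%N -> (b < c)%N -> Eop q cst X c b << ew a >> = 0) ->
  forall b a u, (a < b)%N -> wpos u -> Eop q cst X b a << u >> = 0.
Proof.
move=> cst1 sX o0.
have H s b a u : (a < b)%N -> wpos u -> fil (u + (ew b + ew a)) s.+1 (Eop q cst X b a << u >>).
  elim: s b a u => [|s IH] b a u ab u0; first exact: Eop_fil1.
  apply: Eop_fil_step => // w c' b' a' _ _ ab' bc'.
  by rewrite /ecoef o0 // coeff0 mulr0.
move=> b a u ab u0; apply/eqP/freeg_eqP => v; rewrite coeff0.
have [h _] := H (cht G (v - (u + (ew b + ew a)))) b a u ab u0 v.
exact: homog_gt (ltnSn _) h.
Qed.

(** Height one lies outside [cmem_rigid]. Compared with the undeformed system, the new coefficient
    sits on the single edge [{i, j}]; its coboundary carries the factor [chi k w - 1] for a third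
    letter [k], which [cmem_first] makes zero. *)
Lemma Eop_first : exists cst X, [/\ deforming G 1 cst, straight G q cst X,
    forall b a u, (a < b)%N -> wpos u -> fil (u + (ew b + ew a)) 2 (Eop q cst X b a << u >>) &
    forall b a w, cmem G w -> cht G w = 1%N -> (a < b)%N -> w a = -1 -> w b = -1 -> cst b a w = 'X].
Proof.
pose cst0 b a w : {poly K} := 0.
have cst01 s : deforming G s cst0 by move=> b a w; left.
have [X0 sX0] := straight_exists q (cst01 1%N).
pose P b a w := [&& cmem G w, cht G w == 1%N, (a < b)%N, w a == -1%R & w b == -1%R].
pose cst b a w : {poly K} := if P b a w then 'X else 0.
have cst1 : deforming G 1 cst.
  move=> b a w; rewrite /cst; case: ifP => [/and5P[mw /eqP e _ _ _]|_]; last by left.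
  by right; rewrite mw e; split=> //; exists 1; rewrite scale1r expr1.
have [X sX] := straight_exists q cst1.
have dcst : deforming G 1 (fun b a w => cst b a w - cst0 b a w).
  by move=> b a w; rewrite /cst0 subr0.
have E0 b a u : (a < b)%N -> wpos u -> fil (u + (ew b + ew a)) 1 (Eop q cst0 X0 b a << u >>).
  by move=> _ u0; apply: Eop_fil1 => //; apply: cst01.
have E1 := Efil_compare (cst01 1%N) sX0 sX dcst E0.
exists cst, X; split=> //; last first.
  by move=> b a w mw e ab wa wb; rewrite /cst /P mw e ab wa wb !eqxx.
apply: Eop_fil_step => // w c b a mw w1 ab bc.
have [i [j [ij wi wj wk]]] := cmem_first mw w1.
have Pij b' a' : P b' a' w -> a' = i /\ b' = j.
  case/and5P => _ _ ab' /eqP wa /eqP wb.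
  have H k : w k = -1 -> k = i \/ k = j.
    move=> wk1; have [|ki] := eqVneq k i; first by left.
    have [|kj] := eqVneq k j; first by right.
    by have [] := wk k ki kj; rewrite wk1.
  move: (H a' wa) (H b' wb) ab' => [->|->] [->|->] //; rewrite ?ltnn //.
  by rewrite ltnNge (ltnW ij).
have dS b' a' : cst b' a' w - cst0 b' a' w != 0 -> exists k l, (k <= l)%N /\ wt a' b' k l = w.
  rewrite /cst0 subr0 /cst; case: ifP => [Pw _|_]; last by rewrite eqxx.
  have [ai bj] := Pij _ _ Pw; apply: wt_repr => //; apply/wposP => k; rewrite !ffunE ai bj.
  have nij : i != j by rewrite -val_eqE ltn_eqF.
  have [->|ki] := eqVneq k i; first by rewrite wi (negPf nij).
  have [->|kj] := eqVneq k j; first by rewrite wj.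
  by have [] := wk k ki kj; rewrite !addr0.
have := ecoef_compare qV q1 (cst01 1%N) sX0 cst1 sX dcst w1 dS E0 ab bc.
have -> : ecoef q cst0 X0 w c b (ew a) = 0.
  have [h _] := ecoef_Qdiff0 qV q1 (cst01 1%N) sX0 E0 w1 ab bc.
  have Q0 b' a' p : Qop cst0 X0 b' a' p = 0 by apply: big1 => kl _; rewrite scale0r.
  have X00 k : X0 k 0 = 0 by rewrite linear0.
  rewrite /Qupp /Qlow !Q0 !X00 !scaler0 !addr0 subr0 coeff0 in h.
  by apply/eqP; have /eqP := h; rewrite mulf_eq0 polyC_eq0 (negPf (tnorm_neq0 qV _ _ _ _ _)).
rewrite subr0 => ->; have ac := ltn_trans ab bc.
have Z b' a' c' : (a' < b')%N -> c' != a' -> c' != b' -> (chi c' w - 1)%:P * dcoef q cst0 cst w b' a' = 0.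
  move=> ab' ca cb; rewrite /dcoef /cst0 subr0 /cst; case: ifP => [Pw|_]; last by rewrite !mulr0.
  have [ai bj] := Pij _ _ Pw; rewrite ai in ca; rewrite bj in cb.
  by have [_ ->] := wk c' ca cb; rewrite subrr polyC0 mul0r.
have [nab nac nbc] : [/\ a != b, a != c & b != c] by rewrite -!val_eqE !ltn_eqF.
by rewrite !Z // ?subr0 ?addr0 // eq_sym.
Qed.

Lemma Eop_exists : exists cst X, [/\ deforming G 1 cst, straight G q cst X,
    forall b a u, (a < b)%N -> wpos u -> Eop q cst X b a << u >> = 0 &
    forall b a w, cmem G w -> cht G w = 1%N -> (a < b)%N -> w a = -1 -> w b = -1 -> cst b a w = 'X].
Proof.
have H m : (2 <= m)%N -> exists cst X, [/\ deforming G 1 cst, straight G q cst X,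
    forall b a u, (a < b)%N -> wpos u -> fil (u + (ew b + ew a)) m (Eop q cst X b a << u >>) &
    forall b a w, cmem G w -> cht G w = 1%N -> (a < b)%N -> w a = -1 -> w b = -1 -> cst b a w = 'X].
  elim: m => // m IH; rewrite leq_eqVlt => /predU1P[<-|m2]; first exact: Eop_first.
  have [cst [X [cst1 sX Em F]]] := IH m2.
  have [cst' [X' [cst1' sX' Em' F']]] := Eop_step m2 cst1 sX Em.
  exists cst', X'; split=> // b a w mw w1 ab wa wb.
  by rewrite F' ?w1 // F.
pose B := (\max_i clen G i)%N.
(* An overlap [x_c x_b x_a] has length at most [3 * B], and each unit of height costs length
   [cstep >= 1]; a defect of greater height would sit on a monomial of negative length. *)
have [cst [X [cst1 sX Em F]]] := H (3 * B).+2 isT.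
exists cst, X; split=> //; apply: Eop_eq0 => // c b a ab bc.
apply/eqP/freeg_eqP => v; rewrite coeff0.
have [h1 h2] := Em c b (ew a) bc (wpos_ew a) v.
apply/eqP/negPn/negP => nz; have [mw hw] := homog_mem h1 nz.
have := wlen_ge0 G (h2 nz); have := cht_wlen mw; rewrite wlenB !wlenD !wlen_ew.
have := cstep_gt0 G; have := leq_bigmax (F := clen G) a; have := leq_bigmax (F := clen G) b.
have := leq_bigmax (F := clen G) c; rewrite -/B.
move: (cstep G) (cht G _) hw (clen G a) (clen G b) (clen G c) (wlen G v) => s h hw x y z t.
move=> zB yB xB s0 e t0; have : (h <= s * h)%N by rewrite leq_pmull.
lia.
Qed.

End Deform.

(** * Ideals and normal forms *)

Section Ideals.
Variables (n : nat) (R : comNzRingType).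
Notation word := (seq 'I_n).
Notation A := {freeg (seq 'I_n) / R}.
Implicit Types (r : 'I_n -> 'I_n -> A) (D : A) (f : fa n R).

Lemma coeff_fa f (w : word) : coeff w [freeg f] = coef f w.
Proof. exact: coeff_Freeg. Qed.

Definition wsand (u v : word) : {linear A -> A} := fglift (fun w => << u ++ w ++ v >> : A).

Lemma freeg_mapE (T : choiceType) (S : Type) (c : S -> R) (k : S -> T) (s : seq S) :
  [freeg [seq (c x, k x) | x <- s]] = \sum_(x <- s) c x *: << k x >> :> {freeg T / R}.
Proof.
elim: s => [|x s IH]; first by rewrite big_nil freeg_nil.
by rewrite big_cons -IH freeg_scaleE -freeg_cat.
Qed.

Lemma freeg_faE f : [freeg f] = \sum_(t <- f) t.1 *: << t.2 >> :> A.
Proof. by rewrite -freeg_mapE -[in LHS](map_id f); congr Freeg; apply: eq_map => -[]. Qed.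

Lemma freeg_sandwich c u v f : [freeg (sandwich c u v f)] = c *: wsand u v [freeg f].
Proof.
rewrite freeg_mapE freeg_faE linear_sum scaler_sumr; apply: eq_bigr => t _.
by rewrite linearZ scalerA /wsand /= fgliftT.
Qed.

Lemma freeg_flatten (S : Type) (g : S -> fa n R) (s : seq S) :
  [freeg (flatten [seq g x | x <- s])] = \sum_(x <- s) [freeg (g x)] :> A.
Proof.
elim: s => [|x s IH]; first by rewrite big_nil freeg_nil.
by rewrite big_cons /= freeg_cat IH.
Qed.

Lemma freeg_lincomb (T : Type) (B : T -> fa n R) (s : seq (R * T)) :
  [freeg (lincomb B s)] = \sum_(t <- s) t.1 *: [freeg (B t.2)] :> A.
Proof.
rewrite freeg_flatten; apply: eq_bigr => t _.
by rewrite freeg_mapE freeg_faE scaler_sumr; apply: eq_bigr => u _; rewrite scalerA.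
Qed.

Lemma freeg_opp (f : fa n R) : [freeg (fa_opp f)] = - [freeg f] :> A.
Proof. by rewrite freeg_mapE freeg_faE -sumrN; apply: eq_bigr => t _; rewrite scaleNr. Qed.

Definition ideal r D : Prop :=
  exists s : seq ((R * word) * (('I_n * 'I_n) * word)),
    all (fun t => (val t.2.1.1 < val t.2.1.2)%N) s /\
    D = \sum_(t <- s) t.1.1 *: wsand t.1.2 t.2.2 (r t.2.1.1 t.2.1.2).

Lemma in_idealE (r : 'I_n -> 'I_n -> fa n R) f :
  in_ideal r f <-> ideal (fun a b => [freeg (r a b)]) [freeg f].
Proof.
split=> -[s [hs e]]; exists s; split=> //.
  rewrite -(eq_bigr _ (fun t _ => freeg_sandwich t.1.1 t.1.2 t.2.2 _)) -freeg_flatten.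
  by apply/eqP/freeg_eqP => w; rewrite !coeff_fa e.
move=> w; rewrite -!coeff_fa e freeg_flatten; congr (coeff _ _).
by apply: eq_bigr => t _; rewrite freeg_sandwich.
Qed.

Lemma eq_ideal r r' D : (forall a b : 'I_n, (a < b)%N -> r a b = r' a b) -> ideal r D -> ideal r' D.
Proof.
move=> rr' [s [hs ->]]; exists s; split=> //; rewrite big_seq [RHS]big_seq.
by apply: eq_bigr => t ts; rewrite rr' //; apply: (allP hs).
Qed.

Lemma ideal0 r : ideal r 0.
Proof. by exists [::]; rewrite big_nil. Qed.

Lemma idealD r D D' : ideal r D -> ideal r D' -> ideal r (D + D').
Proof.
move=> [s [hs ->]] [s' [hs' ->]]; exists (s ++ s').
by rewrite all_cat hs hs' big_cat.
Qed.

Lemma idealZ r c D : ideal r D -> ideal r (c *: D).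
Proof.
move=> [s [hs ->]]; exists [seq ((c * t.1.1, t.1.2), t.2) | t <- s]; split; first by rewrite all_map.
by rewrite scaler_sumr big_map; apply: eq_bigr => t _; rewrite scalerA.
Qed.

Lemma idealB r D D' : ideal r D -> ideal r D' -> ideal r (D - D').
Proof. by move=> h /(idealZ (-1)); rewrite scaleN1r; apply: idealD. Qed.

Lemma wsand_comp u v u' v' D : wsand u v (wsand u' v' D) = wsand (u ++ u') (v' ++ v) D.
Proof.
pose g : {linear A -> A} := wsand u v \o wsand u' v'.
rewrite -[LHS]/(g D); apply: eq_linear_freeg => w _.
by rewrite /g /wsand /= !fgliftT -!catA.
Qed.

Lemma wsandT u v w : wsand u v << w >> = << u ++ w ++ v >>.
Proof. by rewrite /wsand /= fgliftT. Qed.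

Lemma ideal_sand r u v D : ideal r D -> ideal r (wsand u v D).
Proof.
move=> [s [hs ->]]; exists [seq ((t.1.1, u ++ t.1.2), (t.2.1, t.2.2 ++ v)) | t <- s].
split; first by rewrite all_map.
rewrite linear_sum big_map; apply: eq_bigr => t _ /=.
by rewrite linearZ /= wsand_comp.
Qed.

Lemma ideal_rel r (a b : 'I_n) : (a < b)%N -> ideal r (r a b).
Proof.
move=> ab; exists [:: ((1, [::]), ((a, b), [::]))]; rewrite /= ab big_seq1 scale1r; split=> //=.
apply: (@eq_linear_freeg _ _ _ idfun (wsand [::] [::])) => w _.
by rewrite wsandT cats0.
Qed.

Lemma ideal_kill r (N : lmodType R) (g : {linear A -> N}) (P : N -> Prop) D :
  P 0 -> (forall x y, P x -> P y -> P (x + y)) -> (forall c x, P x -> P (c *: x)) ->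
  (forall u v (a b : 'I_n), (a < b)%N -> P (g (wsand u v (r a b)))) -> ideal r D -> P (g D).
Proof.
move=> P0 PD PZ H [s [hs ->]]; rewrite linear_sum; elim: s hs => [|t s IH] /=; first by rewrite big_nil.
by move=> /andP[ht hs]; rewrite big_cons linearZ; apply: PD; [apply/PZ/H|apply: IH].
Qed.

Definition quad_rel (c : R) (cf : 'I_n -> 'I_n -> R) (a b : 'I_n) : A :=
  - << [:: b; a] >> + c *: << [:: a; b] >> +
  \sum_(kl : 'I_n * 'I_n | (kl.1 <= kl.2)%N) cf kl.1 kl.2 *: << [:: kl.1; kl.2] >>.

End Ideals.

Arguments wsand {n R} u v.

(** * Normal ordering in the free algebra, and flatness *)

Section NormalForm.
Variables (n : nat) (G : cone n) (K : fieldType) (q : 'I_n -> 'I_n -> K).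
Hypothesis qV : forall i j, q i j * q j i = 1.
Hypothesis q1 : forall i, q i i = 1.
Implicit Types (u v w : weight n) (i j k l a b c : 'I_n).
Notation R := {poly K}.
Notation M := {freeg (weight n) / {poly K}}.
Notation A := {freeg (seq 'I_n) / {poly K}}.
Notation fil := (fil G).
Notation bch := (bch q).

Variable cst : 'I_n -> 'I_n -> weight n -> {poly K}.
Hypothesis cst1 : deforming G 1 cst.

Definition relD a b : A := quad_rel (q b a)%:P (fun k l => cst b a (wt a b k l)) a b.

Definition psi : {linear M -> A} := fglift (fun v => << mword v >> : A).
Definition nf (Y : 'I_n -> {linear M -> M}) : {linear A -> M} :=
  fglift (fun t : seq 'I_n => foldr (fun i => Y i) << 0 >> t).

Lemma psiT v : psi << v >> = << mword v >>. Proof. by rewrite /psi /= fgliftT. Qed.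
Lemma nfT Y t : nf Y << t >> = foldr (fun i => Y i) << 0 >> t.
Proof. by rewrite /nf /= fgliftT. Qed.

Lemma nf_sand Y t t' D : nf Y (wsand t t' D) =
  foldr (fun i => Y i) (nf Y (wsand [::] t' D)) t.
Proof.
elim: t => //= i t <-.
pose g1 : {linear A -> M} := nf Y \o wsand (i :: t) t'.
pose g2 : {linear A -> M} := Y i \o (nf Y \o wsand t t').
apply: (@eq_linear_freeg _ _ _ g1 g2) => w _.
rewrite -[LHS]/(nf Y (wsand (i :: t) t' << w >>)) -[RHS]/(Y i (nf Y (wsand t t' << w >>))).
by rewrite !wsandT !nfT.
Qed.

Lemma nf_rel Y t' a b : nf Y (wsand [::] t' (relD a b)) =
  - Eop q cst Y b a (foldr (fun i => Y i) << 0 >> t').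
Proof.
pose g : {linear A -> M} := nf Y \o wsand [::] t'.
have gT x : g << x >> = foldr (fun i => Y i) << 0 >> (x ++ t').
  by rewrite -[LHS]/(nf Y (wsand [::] t' << x >>)) wsandT nfT.
have -> : nf Y (wsand [::] t' (relD a b)) = - g << [:: b; a] >> + (q b a)%:P *: g << [:: a; b] >> +
    \sum_(kl : 'I_n * 'I_n | (kl.1 <= kl.2)%N) cst b a (wt a b kl.1 kl.2) *: g << [:: kl.1; kl.2] >>.
  rewrite -[LHS]/(g (relD a b)) /relD /quad_rel !linearD linearN linearZ linear_sum; congr (_ + _).
  by apply: eq_bigr => kl _; rewrite linearZ.
rewrite !gT /Eop /Qop.
have opp (x y z : M) : - x + y + z = - (x - y - z) by rewrite !opprD !opprK.
by rewrite opp; congr (- (_ - _)); apply: eq_bigr => kl _; rewrite gT.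
Qed.

(** The quantum torus action; it provides the normal ordering at parameter 0. *)
Definition Yop i : {linear M -> M} := fglift (fun v => (bch (ew i) v)%:P *: << v + ew i >> : M).

Lemma Yop_swap i j p : Yop i (Yop j p) = (q i j)%:P *: Yop j (Yop i p).
Proof.
have YT k v : Yop k << v >> = (bch (ew k) v)%:P *: << v + ew k >> by rewrite /Yop /= fgliftT.
have YZ k (r : {poly K}) x : Yop k (r *: x) = r *: Yop k x by rewrite linearZ.
pose g1 : {linear M -> M} := Yop i \o Yop j.
pose g2 : {linear M -> M} := (q i j)%:P \*: (Yop j \o Yop i).
apply: (@eq_linear_freeg _ _ _ g1 g2) => v _.
rewrite -[LHS]/(Yop i (Yop j << v >>)) -[RHS]/((q i j)%:P *: Yop j (Yop i << v >>)).
rewrite !YT !YZ !YT !scalerA -!polyCM !(bchDr qV) (bch_swap qV q1 i j).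
have -> : v + ew j + ew i = v + ew i + ew j by weq.
by congr (_%:P *: _); ring.
Qed.

Lemma nf_mword (Y : 'I_n -> {linear M -> M}) v :
  (forall i v, wpos v -> low i v -> Y i << v >> = << v + ew i >>) ->
  wpos v -> nf Y << mword v >> = << v >>.
Proof.
move=> Y1; move: v; apply: (wpos_ind G) => [|i v v0 li IH]; first by rewrite mword0 nfT.
by rewrite mword_low // nfT /= -nfT IH Y1.
Qed.

Lemma nf_psi (Y : 'I_n -> {linear M -> M}) p :
  (forall i v, wpos v -> low i v -> Y i << v >> = << v + ew i >>) ->
  (forall v, coeff v p != 0 -> wpos v) -> nf Y (psi p) = p.
Proof.
move=> Y1 hp; pose g : {linear M -> M} := nf Y \o psi.
apply: (@eq_linear_freeg _ _ _ g idfun) => v /hp v0.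
by rewrite -[LHS]/(nf Y (psi << v >>)) psiT nf_mword.
Qed.

Section Straight.
Variable X : 'I_n -> {linear M -> M}.
Hypothesis sX : straight G q cst X.

Lemma nf_fil t : fil (\sum_(i <- t) ew i) 0 (nf X << t >>).
Proof.
have := raising_word t (straight_raising sX) (fil_T G K (@wpos0 n)).
by rewrite add0r nfT.
Qed.

Lemma nf_pos D v : coeff v (nf X D) != 0 -> wpos v.
Proof.
move: v; apply: (linear_freeg_ind (P := fun p : M => forall u, coeff u p != 0 -> wpos u)).
- by move=> u; rewrite coeff0 eqxx.
- move=> x y hx hy u; rewrite coeffD; have [->|/hx //] := eqVneq (coeff u x) 0.
  by rewrite add0r => /hy.
move=> t _ u; rewrite coeffZ mulf_eq0 negb_or => /andP[_].
by case: (nf_fil t u).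
Qed.

(** [intertwine] with the free algebra as target, [x_i] acting by left multiplication and the ideal
    as space of errors; the relations hold there modulo the ideal by definition. *)
Lemma nf_congr D : ideal relD (D - psi (nf X D)).
Proof.
pose g : {linear A -> A} := idfun \- (psi \o nf X).
rewrite -[D - _]/(g D); apply: linear_freeg_ind; [exact: ideal0|exact: idealD|].
move=> t _; apply: idealZ; rewrite -[g _]/(<< t >> - psi (nf X << t >>)).
elim: t => [|i t IH]; first by rewrite nfT psiT mword0 subrr; apply: ideal0.
pose L i : {linear A -> A} := wsand [:: i] [::].
have LT k s : L k << s >> = << k :: s >> by rewrite /L wsandT cats0.
have -> : << i :: t >> - psi (nf X << i :: t >>) =
    L i (<< t >> - psi (nf X << t >>)) + (L i (psi (nf X << t >>)) - psi (X i (nf X << t >>))).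
  by rewrite linearB addrA subrK LT !nfT.
apply: idealD; first exact: ideal_sand.
apply: (@intertwineP n G K q cst cst1 X A L psi (fun _ => ideal relD) sX _ _ _ _ _ _ _ _ _ (nf_fil t)) => //.
- by move=> _; apply: ideal0.
- by move=> _; apply: idealD.
- by move=> _ _ r x _; apply: idealZ.
- by move=> _ k x; apply: ideal_sand.
- by move=> k v v0 lk; rewrite !psiT LT mword_low // subrr; apply: ideal0.
move=> k j v v0 jk lj.
have -> : Eop q cst L k j (psi << v >>) = - (wsand [::] (mword v) (relD j k)).
  have -> : wsand [::] (mword v) (relD j k) = - << [:: k, j & mword v] >> + (q k j)%:P *: << [:: j, k & mword v] >> +
      \sum_(kl : 'I_n * 'I_n | (kl.1 <= kl.2)%N) cst k j (wt j k kl.1 kl.2) *: << [:: kl.1, kl.2 & mword v] >>.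
    rewrite /relD /quad_rel !linearD linearN linearZ linear_sum !wsandT; congr (_ + _).
    by apply: eq_bigr => kl _; rewrite linearZ wsandT.
  rewrite psiT /Eop /Qop !LT; have opp (x y z : A) : x - y - z = - (- x + y + z) by rewrite !opprD !opprK.
  by rewrite opp; congr (- (_ + _)); apply: eq_bigr => kl _; rewrite !LT.
by rewrite -scaleN1r; apply/idealZ/ideal_sand/ideal_rel.
Qed.

Lemma nf_ideal D : (forall b a u, (a < b)%N -> wpos u -> Eop q cst X b a << u >> = 0) ->
  ideal relD D -> nf X D = 0.
Proof.
move=> E0; apply: (ideal_kill (P := fun x => x = 0)) => //.
- by move=> x y -> ->; rewrite addr0.
- by move=> c x ->; rewrite scaler0.
move=> t t' a b ab; rewrite nf_sand nf_rel -nfT.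
have -> : Eop q cst X b a (nf X << t' >>) = 0.
  apply: (linear_freeg_ind (P := fun x : M => x = 0)) => // [x y -> ->|v /nf_pos v0].
    by rewrite addr0.
  by rewrite /= E0 // scaler0.
by rewrite oppr0; elim: t => //= i t ->; rewrite linear0.
Qed.

Variable r : 'I_n -> 'I_n -> fa n {poly K}.
Hypothesis rE : forall a b, (a < b)%N -> [freeg (r a b)] = relD a b.

Lemma in_ideal_relD f : in_ideal r f <-> ideal relD [freeg f].
Proof.
by rewrite in_idealE; split; apply: eq_ideal => a b ab; rewrite rE.
Qed.

(** The ordered monomials form a basis: [nf_congr] gives spanning, and [nf], which kills the ideal,
    gives independence. *)
Lemma free_quotient_nf : (forall b a u, (a < b)%N -> wpos u -> Eop q cst X b a << u >> = 0) ->
  free_quotient r.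
Proof.
move=> E0; pose T := {v : weight n | wpos v}.
have BE (v : T) : [freeg [:: (1, mword (val v))]] = psi << val v >> :> A by rewrite psiT.
exists T, (fun v : T => [:: (1, mword (val v))]); split.
  move=> f; pose p := nf X [freeg f].
  exists [seq (coeff (val (z : T)) p, z : T) | z <- pmap insub (dom p)].
  rewrite in_ideal_relD freeg_cat freeg_opp freeg_lincomb big_map /=.
  suff -> : \sum_(z <- pmap insub (dom p)) coeff (val (z : T)) p *: [freeg [:: (1, mword (val (z : T)))]] = psi p.
    exact: nf_congr.
  rewrite linear_freegE; have : all (@wpos n) (dom p).
    by apply/allP => v; rewrite mem_dom => /nf_pos.
  elim: (dom p) => [|v s IH] /=; first by rewrite !big_nil.
  by move=> /andP[v0 /IH e]; rewrite insubT /= !big_cons e BE.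
move=> s; rewrite in_ideal_relD freeg_lincomb => /(nf_ideal E0) h x.
have X1 : forall i v, wpos v -> low i v -> X i << v >> = << v + ew i >> by case: sX.
have := congr1 (coeff (val x)) h; rewrite coeff0 linear_sum coeff_sum => e.
rewrite -[RHS]e big_mkcond; apply: eq_bigr => t _.
rewrite BE linearZ coeffZ psiT (nf_mword X1 (valP t.2)) coeffT val_eqE.
by case: eqP => _; rewrite ?mulr1 ?mulr0.
Qed.

Lemma sum_keys (T : eqType) (N : lmodType {poly K}) (s : seq ({poly K} * T)) (g : T -> N) :
  (forall x : T, \sum_(t <- s | t.2 == x) t.1 = 0) -> \sum_(t <- s) t.1 *: g t.2 = 0.
Proof.
move=> h; transitivity (\sum_(x <- undup [seq t.2 | t <- s]) \sum_(t <- s | t.2 == x) t.1 *: g t.2).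
  rewrite (exchange_big_dep xpredT) //= big_seq [RHS]big_seq; apply: eq_bigr => t ts.
  rewrite big_mkcond (bigD1_seq t.2) ?undup_uniq ?mem_undup ?map_f //= eqxx big1 ?addr0 // => x xt.
  by rewrite eq_sym (negPf xt).
apply: big1 => x _; under eq_bigr => t /eqP -> do [].
by rewrite -scaler_suml h scale0r.
Qed.

(** Modulo the ideal [D] is a combination of basis elements, and ['X] times it lies in the ideal;
    independence kills ['X] times each coefficient, hence the coefficient. *)
Lemma ideal_torsion_free D : free_quotient r -> ideal relD ('X *: D) -> ideal relD D.
Proof.
move=> [T [B [span indep]]] hX.
have [f fE] : exists f, [freeg f] = D :> A.
  by exists [seq (coeff x D, x) | x <- dom D]; rewrite Freeg_dom.
have [s hs] := span f; rewrite in_ideal_relD freeg_cat freeg_opp freeg_lincomb fE in hs.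
set L := \sum_(t <- s) _ in hs.
have L0 : L = 0.
  have hX' : ideal relD ('X *: L).
    have -> : 'X *: L = 'X *: D - 'X *: (D - L) by rewrite scalerBr opprB addrC subrK.
    exact: idealB hX (idealZ _ hs).
  have : in_ideal r (lincomb B [seq ('X * t.1, t.2) | t <- s]).
    rewrite in_ideal_relD freeg_lincomb big_map; move: hX'.
    by rewrite /L scaler_sumr; congr (ideal _ _); apply: eq_bigr => t _; rewrite scalerA.
  move=> /indep h; have h' x : \sum_(t <- s | t.2 == x) t.1 = 0.
    apply: (mulfI (negbT (polyX_eq0 K))); rewrite mulr0 -[RHS](h x) big_map mulr_sumr.
    by apply: eq_big => t.
  exact: (sum_keys (fun x : T => [freeg (B x)] : A) h').
by rewrite L0 subr0 in hs.
Qed.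

Let Y1 i v : wpos v -> low i v -> Yop i << v >> = << v + ew i >>.
Proof. by move=> _ li; rewrite /Yop /= fgliftT bch_low // scale1r. Qed.

(** At parameter 0 the corrections disappear, having positive height, and the quantum torus
    operators satisfy the remaining relations exactly. *)
Lemma nf_ideal_mod D : ideal relD D -> forall v, (coeff v (nf Yop D))`_0 = 0.
Proof.
pose P (x : M) := forall v, (coeff v x)`_0 = 0.
apply: (ideal_kill (P := P)).
- by move=> v; rewrite coeff0 coef0.
- by move=> x y hx hy v; rewrite coeffD coefD hx hy addr0.
- by move=> c x hx v; rewrite coeffZ coef0M hx mulr0.
move=> t t' a b ab; rewrite nf_sand nf_rel.
set y := foldr _ _ t'; have : P (- Eop q cst Yop b a y).
  have -> : - Eop q cst Yop b a y = Qop cst Yop b a y by rewrite /Eop Yop_swap subrr sub0r opprK.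
  move=> v; rewrite coeff_sum coef_sum; apply: big1 => kl _.
  rewrite coeffZ coef0M; case: (cst1 b a (wt a b kl.1 kl.2)) => [->|[_ h [c ->]]]; first by rewrite coef0 mul0r.
  by rewrite coefZ coefXn; case: (cht G _) h => //= m _; rewrite mulr0 mul0r.
move: (- _); elim: t => //= i t IH x /IH h v.
rewrite linear_freegE coeff_sum coef_sum; apply: big1 => u _.
by rewrite coeffZ coef0M h mul0r.
Qed.

Lemma psi_ideal_eq0 p : free_quotient r -> (forall v, coeff v p != 0 -> wpos v) ->
  ideal relD (psi p) -> p = 0.
Proof.
move=> fq p0 hp.
suff H m : forall p, (forall v, coeff v p != 0 -> wpos v) -> ideal relD (psi p) ->
    forall v (d : nat), (d < m)%N -> (coeff v p)`_d = 0.
  apply/eqP/freeg_eqP => v; rewrite coeff0; apply/polyP => j; rewrite coef0.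
  exact: (H j.+1 p p0 hp).
elim: m => // m IH {p0 hp} p0 h0 hp0 v j jm.
have c0 u : (coeff u p0)`_0 = 0.
  by have := nf_ideal_mod hp0 u; rewrite nf_psi.
pose p1 : M := \sum_(u <- dom p0) drop_poly 1 (coeff u p0) *: << u >>.
have p1E u : coeff u p1 = drop_poly 1 (coeff u p0).
  rewrite coeff_sum; have [up|up] := boolP (u \in dom p0).
    rewrite (bigD1_seq u) ?uniq_dom //= coeffZ coeffT eqxx mulr1 big1 ?addr0 // => x /negPf xu.
    by rewrite coeffZ coeffT xu mulr0.
  rewrite (coeff_outdom up) drop_poly0r big_seq big1 // => x xp; rewrite coeffZ coeffT.
  by case: eqVneq => [xu|]; rewrite ?mulr0 //; move: up; rewrite -xu xp.
have pE : p0 = 'X *: p1.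
  apply/eqP/freeg_eqP => u; rewrite coeffZ p1E; apply/polyP => k; rewrite coefXM coef_drop_poly.
  by case: k => [|k] /=; rewrite ?addn1.
case: j jm => [_|j jm]; first exact: c0.
have := IH p1 _ _ v j jm; rewrite p1E coef_drop_poly addn1; apply.
  by move=> u nz; apply: h0; apply: contra_neq nz => z; rewrite p1E z drop_poly0r.
by apply: (ideal_torsion_free fq); rewrite -linearZ -pE.
Qed.

(** The overlap lies in the ideal. Freeness lets one cancel powers of the
    parameter in ideal membership, and modulo the parameter ordered monomials are
    independent; so an ideal element in normal form is zero. *)
Lemma free_quotient_overlap : free_quotient r ->
  forall c b a, (a < b)%N -> (b < c)%N -> Eop q cst X c b << ew a >> = 0.
Proof.
move=> fq c b a ab bc.
have [X1 _ X3] := sX.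
have h1 : ideal relD (wsand [::] [:: a] (relD b c)) by apply/ideal_sand/ideal_rel.
have h2 : nf X (wsand [::] [:: a] (relD b c)) = - Eop q cst X c b << ew a >>.
  by rewrite nf_rel /= X1 ?low0 // add0r.
apply: oppr_inj; rewrite oppr0 -h2; apply: (psi_ideal_eq0 fq); first by move=> v; apply: nf_pos.
have -> : psi (nf X (wsand [::] [:: a] (relD b c))) = wsand [::] [:: a] (relD b c) -
   (wsand [::] [:: a] (relD b c) - psi (nf X (wsand [::] [:: a] (relD b c)))).
  by rewrite opprB addrC subrK.
exact: idealB h1 (nf_congr _).
Qed.

End Straight.

End NormalForm.

(** * Torus rescalings *)

Section Scaling.
Variables (n : nat) (R : comNzRingType).
Notation word := (seq 'I_n).
Notation A := {freeg (seq 'I_n) / R}.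
Implicit Types (tau : 'I_n -> R) (u v w : word) (D : A) (f : fa n R).

Definition wscale tau w : R := \prod_(k <- w) tau k.
Definition scale_fa tau f : fa n R := [seq (t.1 * wscale tau t.2, t.2) | t <- f].
Definition scaling tau : {linear A -> A} := fglift (fun w => wscale tau w *: << w >> : A).

Lemma scalingT tau w : scaling tau << w >> = wscale tau w *: << w >>.
Proof. by rewrite /scaling /= fgliftT. Qed.

Lemma freeg_scale tau f : [freeg (scale_fa tau f)] = scaling tau [freeg f] :> A.
Proof.
rewrite freeg_mapE freeg_faE linear_sum; apply: eq_bigr => t _.
by rewrite linearZ /= scalingT scalerA.
Qed.

Lemma scalingK tau tau' : (forall k, tau k * tau' k = 1) -> cancel (scaling tau) (scaling tau').
Proof.
move=> tt' D; pose g : {linear A -> A} := scaling tau' \o scaling tau.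
rewrite -[LHS]/(g D) -[RHS]/((@idfun A) D); apply: eq_linear_freeg => w _.
rewrite /g /= scalingT linearZ /= scalingT scalerA /wscale -big_split /=.
by rewrite big1 ?scale1r // => k _.
Qed.

Lemma scaling_wsand tau u v D :
  scaling tau (wsand u v D) = (wscale tau u * wscale tau v) *: wsand u v (scaling tau D).
Proof.
pose g1 : {linear A -> A} := scaling tau \o wsand u v.
pose g2 : {linear A -> A} := (wscale tau u * wscale tau v) \*: (wsand u v \o scaling tau).
rewrite -[LHS]/(g1 D) -[RHS]/(g2 D); apply: eq_linear_freeg => w _.
rewrite /g1 /g2 /= wsandT !scalingT linearZ /= wsandT scalerA /wscale !big_cat /=.
by congr (_ *: _); ring.
Qed.

Lemma ideal_scaling tau (r r' : 'I_n -> 'I_n -> A) (c : 'I_n -> 'I_n -> R) D :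
  (forall a b : 'I_n, (a < b)%N -> scaling tau (r a b) = c a b *: r' a b) ->
  ideal r D -> ideal r' (scaling tau D).
Proof.
move=> rr'; apply: (ideal_kill (P := ideal r')).
- exact: ideal0.
- exact: idealD.
- by move=> x y; apply: idealZ.
move=> u v a b ab; rewrite scaling_wsand rr' //; apply/idealZ/ideal_sand/idealZ.
exact: ideal_rel.
Qed.

Lemma scaling_quad_rel tau (c : R) (cf cf' : 'I_n -> 'I_n -> R) (a b : 'I_n) :
  (forall k l : 'I_n, (k <= l)%N -> cf k l * (tau k * tau l) = tau a * tau b * cf' k l) ->
  scaling tau (quad_rel c cf a b) = (tau a * tau b) *: quad_rel c cf' a b.
Proof.
have w2 x y : wscale tau [:: x; y] = tau x * tau y by rewrite /wscale big_cons big_seq1.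
move=> h; rewrite /quad_rel !scalerDr !linearD linearN linearZ linear_sum /= !scalingT !w2.
congr (_ + _ + _).
- by rewrite scalerN mulrC.
- by rewrite !scalerA mulrC.
rewrite scaler_sumr; apply: eq_bigr => kl klP.
by rewrite linearZ /= scalingT w2 !scalerA h.
Qed.

Section Transport.
Variables (tau tau' : 'I_n -> R) (c c' : 'I_n -> 'I_n -> R) (r r' : 'I_n -> 'I_n -> fa n R).
Hypothesis tauV : forall k, tau k * tau' k = 1.
Hypothesis cV : forall a b, c a b * c' a b = 1.
Hypothesis rr' : forall a b : 'I_n, (a < b)%N ->
  scaling tau [freeg (r a b)] = c a b *: [freeg (r' a b)].

Let tauV' k : tau' k * tau k = 1. Proof. by rewrite mulrC tauV. Qed.

Lemma in_ideal_scaling f f' : [freeg f'] = scaling tau [freeg f] ->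
  in_ideal r f <-> in_ideal r' f'.
Proof.
move=> ff'; rewrite !in_idealE ff'; split; first exact: ideal_scaling rr'.
rewrite -[X in _ -> ideal _ X](scalingK tauV); apply: (ideal_scaling (c := c')) => a b ab.
have := congr1 (fun D => c' a b *: scaling tau' D) (rr' ab); rewrite (scalingK tauV).
by rewrite linearZ /= scalerA mulrC cV scale1r.
Qed.

Lemma free_quotient_scaling : free_quotient r -> free_quotient r'.
Proof.
move=> [T [B [span indep]]]; exists T, (fun x => scale_fa tau (B x)).
have key (s : seq (R * T)) : [freeg (lincomb (fun x => scale_fa tau (B x)) s)] =
    scaling tau [freeg (lincomb B s)].
  rewrite !freeg_lincomb linear_sum; apply: eq_bigr => t _.
  by rewrite linearZ /= freeg_scale.
split=> [f|s].
  have [s hs] := span (scale_fa tau' f); exists s.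
  apply/(in_ideal_scaling (f := scale_fa tau' f ++ fa_opp (lincomb B s))) => //.
  by rewrite !freeg_cat !freeg_opp key linearB /= freeg_scale (scalingK tauV').
by move/(in_ideal_scaling (key s)); apply: indep.
Qed.

End Transport.

End Scaling.

Lemma prod_diag (n : nat) (tau : 'rV[CC]_n) (w u : seq 'I_n) : size u = size w ->
  \prod_(p <- zip w u) diag_mx tau p.1 p.2 = if u == w then wscale (tau 0) w else 0.
Proof.
rewrite /wscale; elim: w u => [|x w IH] [|y u] //=; first by rewrite !big_nil.
move=> [e]; rewrite !big_cons /= IH // eqseq_cons mxE [y == x]eq_sym.
by case: (x =P y) => [->|_]; rewrite ?mulr1n ?mul0r //; case: ifP; rewrite ?mulr0.
Qed.

Lemma freeg_subst_diag (n : nat) (tau : 'rV[CC]_n) (f : fa n CC) :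
  [freeg (subst (diag_mx tau) f)] = scaling (tau 0) [freeg f] :> {freeg (seq 'I_n) / CC}.
Proof.
rewrite freeg_flatten freeg_faE linear_sum; apply: eq_bigr => t _.
rewrite freeg_mapE linearZ /= scalingT /subst_word big_map big_map big_enum /=.
rewrite (bigD1 (in_tuple t.2)) //= prod_diag // eqxx big1 ?addr0 ?scalerA // => u nu.
by rewrite prod_diag ?size_tuple // (negPf (_ : val u != t.2)) ?mulr0 ?scale0r.
Qed.

(** * Smoothable weights *)

Section Exponential.

Lemma cexpD (x y : CC) : cexp (x + y) = cexp x * cexp y.
Proof.
case: x y => [a b] [c d]; rewrite /cexp [complex.Re _]/= [complex.Im _]/=.
rewrite -!RplusE Exp_prop.exp_plus Cos_plus.cos_plus Rtrigo1.sin_plus !(RplusE, RminusE, RmultE).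
move: (Rtrigo_def.exp a) (Rtrigo_def.exp c) (Rtrigo_def.cos b) (Rtrigo_def.cos d)
 (Rtrigo_def.sin b) (Rtrigo_def.sin d) => ea ec cb cd sb sd.
apply/eqP; rewrite /CC eq_complex /=; apply/andP; split; apply/eqP; ring.
Qed.

Lemma cexp0 : cexp 0 = 1.
Proof.
rewrite /cexp /= Rtrigo_def.exp_0 Rtrigo_def.cos_0 Rtrigo_def.sin_0.
by apply/eqP; rewrite /CC eq_complex /= !(mulr0, mul0r, mulr1, mul1r, addr0, add0r, subr0) !eqxx.
Qed.

Lemma cexp_neq0 z : cexp z != 0.
Proof.
apply/eqP => z0; have := cexpD z (- z); rewrite subrr cexp0 z0 mul0r => /eqP.
by rewrite oner_eq0.
Qed.

Lemma cexpN z : cexp (- z) = (cexp z)^-1.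
Proof. by apply: (mulfI (cexp_neq0 z)); rewrite -cexpD subrr cexp0 mulfV ?cexp_neq0. Qed.

Lemma cexpMn z m : cexp (z *+ m) = cexp z ^+ m.
Proof. by elim: m => [|m IH]; rewrite ?cexp0 // mulrS cexpD IH exprS. Qed.

Lemma cexpMz z (m : int) : cexp (z * m%:~R) = cexp z ^ m.
Proof.
case: m => m; first by rewrite -pmulrn mulr_natr cexpMn.
by rewrite NegzE mulrNz mulrN cexpN -pmulrn mulr_natr cexpMn.
Qed.

Lemma cexp_sum (J : finType) (F : J -> CC) : cexp (\sum_j F j) = \prod_j cexp (F j).
Proof. exact: (big_morph cexp cexpD cexp0). Qed.

End Exponential.

(** * Sums of smoothable weights along the chain of edges *)

Section Weights.
Variables (n : nat) (lam b : 'M[CC]_n) (I : {set 'I_n}) (theta : 'I_n -> weight n).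
Hypothesis b_inv : is_biresidue lam b.
Hypothesis smooth : forall i, i \in I ->
  exists j : 'I_n, [/\ val j = (val i).+1, smoothable b i j & smoothable_weight b i j (theta i)].
Implicit Types (w : weight n) (i j k : 'I_n) (t : seq 'I_n).

Lemma CC_char0 (m : int) : (m%:~R == 0 :> CC) = (m == 0).
Proof. exact: (@intr_eq0 (complex.complex Rdefinitions.R)). Qed.

Lemma CC_intr_inj : injective (intr : int -> CC).
Proof. by move=> x y /eqP; rewrite -subr_eq0 -rmorphB /= CC_char0 subr_eq0 => /eqP. Qed.

Definition wsum t : weight n := \sum_(i <- t) theta i.

Lemma b_alt i j : b j i = - b i j. Proof. by case: b_inv. Qed.

Lemma b_diag i : b i i = 0.
Proof.
have /eqP := b_alt i i; rewrite -addr_eq0 -mulr2n -mulr_natl mulf_eq0.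
by rewrite -[2%:R]/(2%:~R) CC_char0 => /eqP.
Qed.

(** [bcol k p] is [b k p], extended by 0 to every [p : nat], so that sums along
    the chain of edges telescope. *)
Definition bcol k (p : nat) : CC := if insub p is Some i then b k i else 0.

Lemma bcolE k i : bcol k i = b k i.
Proof. by rewrite /bcol valK. Qed.

Definition beta i : CC := bcol i i.+1.

Lemma theta_spec i : i \in I -> [/\ (i.+1 < n)%N, beta i != 0,
  forall k, (theta i k)%:~R * beta i = bcol k i - bcol k i.+1 &
  forall k, val k != val i -> val k != i.+1 -> 0 <= theta i k].
Proof.
move=> /smooth[j [ji [bij sm] [ti tj tk]]].
have betaE : beta i = b i j by rewrite /beta -ji bcolE.
have ltj : (i.+1 < n)%N by rewrite -ji ltn_ord.
split=> //; first by rewrite betaE.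
  move=> k; rewrite betaE -ji !bcolE; have [->|ki] := eqVneq k i.
    by rewrite ti b_diag mulN1r sub0r.
  have [->|kj] := eqVneq k j; first by rewrite tj b_diag mulN1r subr0 (b_alt i j).
  by rewrite tk // mulfVK // addrC [b j k]b_alt.
move=> k ki kj; have ki' : k != i by rewrite -val_eqE.
have kj' : k != j by rewrite -val_eqE /= ji.
have [m hm] := sm k ki' kj'; have := tk k ki' kj'; rewrite hm.
by rewrite -[m%:R]/((m%:Z)%:~R) => /CC_intr_inj ->.
Qed.

Lemma theta_m1 i k : i \in I -> (val k == val i) || (val k == i.+1) -> theta i k = -1.
Proof.
move=> /smooth[j [ji _ [ti tj _]]] /orP[/eqP/val_inj -> //|/eqP kj].
by have -> : k = j by apply: val_inj; rewrite /= kj.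
Qed.

Lemma theta_col i : i \in I -> exists2 j : 'I_n, val j = i.+1 &
  forall k, (theta i k)%:~R = (b k i - b k j) / beta i.
Proof.
move=> iI; have [_ b0 h _] := theta_spec iI; have [j [ji _ _]] := smooth iI.
by exists j => // k; rewrite -(mulfK b0 (theta i k)%:~R) h -ji !bcolE.
Qed.

Lemma sum_theta i : i \in I -> \sum_k theta i k = 0.
Proof.
move=> /theta_col[j _ h]; apply: CC_intr_inj; rewrite rmorph_sum /=.
under eq_bigr do rewrite h.
have col x : \sum_k b k x = 0.
  have [_ nb _] := b_inv; rewrite -[RHS]oppr0 -[in RHS](nb x) -sumrN.
  by apply: eq_bigr => k _; rewrite b_alt.
by rewrite -mulr_suml sumrB !col subrr mul0r.
Qed.

(** [theta i] is [b] applied to [e_i - e_(i+1)], divided by [beta i], and [lam] inverts [b] on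
    vectors of total 0. *)
Lemma lam_theta i k : i \in I ->
  \sum_l lam k l * (theta i l)%:~R = ((k == i)%:R - (val k == i.+1)%:R) / beta i.
Proof.
move=> /theta_col[j ji h].
pose z : 'cV[CC]_n := \col_l ((l == i)%:R - (l == j)%:R).
have delta1 x : \sum_(l < n) (l == x)%:R = 1 :> CC.
  by rewrite (bigD1 x) //= eqxx big1 ?addr0 // => l /negPf ->.
have zD : inDelta z.
  rewrite /inDelta; under eq_bigr do rewrite mxE.
  by rewrite sumrB !delta1 subrr.
have bz l : (b *m z) l 0 = b l i - b l j.
  rewrite mxE; under eq_bigr do rewrite mxE mulrBr.
  have pick x : \sum_m b l m * (m == x)%:R = b l x.
    by rewrite (bigD1 x) //= eqxx mulr1 big1 ?addr0 // => m /negPf ->; rewrite mulr0.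
  by rewrite sumrB !pick.
have [_ _ inv] := b_inv; have [_ /(congr1 (fun m : 'cV[CC]_n => m k 0))] := inv z zD.
rewrite !mxE => e.
have <- : (k == j) = (val k == i.+1) by rewrite -ji -val_eqE.
rewrite -e mulr_suml; apply: eq_bigr => l _.
by rewrite h bz mulrA.
Qed.

(** The coefficient of [e_p - e_(p+1)] in [lam] applied to [wsum t]. *)
Definition slope t (p : nat) : CC := \sum_(i <- t | val i == p) (beta i)^-1.

Lemma lam_wsum t k : all (mem I) t ->
  \sum_l lam k l * (wsum t l)%:~R = slope t k - (if val k is p.+1 then slope t p else 0).
Proof.
rewrite /wsum /slope; elim: t => [|i t IH] /=.
  rewrite !big_nil big1 => [|l _]; last by rewrite ffunE mulr0.
  by case: (nat_of_ord k) => [|p]; rewrite ?big_nil subrr.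
move=> /andP[iI tI]; rewrite !big_cons.
under eq_bigr do rewrite ffunE rmorphD mulrDr.
rewrite big_split /= lam_theta // IH // -val_eqE /= [(i == k :> nat)]eq_sym.
case: (nat_of_ord k) => [|p] /=; first by case: eqP => _; rewrite ?subr0 ?mul1r ?mul0r ?add0r.
rewrite big_cons eqSS [(i == p :> nat)]eq_sym.
case: (p.+1 =P i) => [e|_]; case: (p =P i) => [e'|_]; rewrite ?subr0 ?mul1r ?mul0r ?add0r ?sub0r //.
- by rewrite -e' in e; have := n_Sn p; rewrite e.
- by rewrite addrA.
- by rewrite mulNr mul1r opprD addrCA.
Qed.

Definition wrange t (x y : nat) : weight n := wsum [seq i : 'I_n <- t | (x <= i < y)%N].

(** Each [theta i] is a multiple of a difference of consecutive columns of [b]; constant slope makes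
    the sum telescope. *)
Lemma wrange_const t (x y k : 'I_n) (c : CC) : all (mem I) t -> (x <= y)%N ->
  (forall p : nat, (x <= p < y)%N -> slope t p = c) ->
  (wrange t x y k)%:~R = c * (b k x - b k y).
Proof.
move=> tI xy hc; rewrite -!bcolE.
have -> : bcol k x - bcol k y = \sum_(x <= p < y) (bcol k p - bcol k p.+1).
  have := telescope_sumr (fun p => - bcol k p) xy; rewrite opprK addrC => <-.
  by apply: eq_bigr => p _; rewrite opprK addrC.
rewrite mulr_sumr /wrange /wsum big_filter.
transitivity (\sum_(x <= p < y) slope t p * (bcol k p - bcol k p.+1)); last first.
  by apply: eq_big_nat => p /hc ->.
rewrite sum_ffunE rmorph_sum /=.
transitivity (\sum_(i <- t | (x <= i < y)%N) (beta i)^-1 * (bcol k i - bcol k i.+1)).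
  rewrite big_seq_cond [RHS]big_seq_cond; apply: eq_bigr => i /andP[it _].
  have [_ b0 h _] := theta_spec (allP tI i it).
  by rewrite -h mulrC mulfK.
under [RHS]eq_bigr do rewrite /slope mulr_suml.
rewrite (exchange_big_dep xpredT) //= big_mkcond /=; apply: eq_bigr => i _.
under [RHS]eq_bigl do rewrite eq_sym.
by rewrite big_nat1_eq.
Qed.

(** Both values are [- c * b x y], as [b] is alternating. *)
Lemma wrange_ends t (x y : 'I_n) (c : CC) : all (mem I) t -> (x <= y)%N ->
  (forall p : nat, (x <= p < y)%N -> slope t p = c) -> wrange t x y x = wrange t x y y.
Proof.
move=> tI xy hc; apply: CC_intr_inj; rewrite !(wrange_const _ tI xy hc) !b_diag.
by rewrite [b y x]b_alt subr0 sub0r.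
Qed.

Lemma wrange_ge0 t (x y : nat) k : all (mem I) t -> (k < x)%N || (y < k)%N -> 0 <= wrange t x y k.
Proof.
move=> tI h; rewrite /wrange /wsum sum_ffunE big_filter big_seq_cond; apply: sumr_ge0 => i.
case/andP=> it hi; have [_ _ _ pos] := theta_spec (allP tI i it).
by apply: pos; apply/eqP => /= e; lia.
Qed.

Lemma wrange_cat t (x y z : nat) : (x <= y <= z)%N -> wrange t x y + wrange t y z = wrange t x z.
Proof.
move=> h; rewrite /wrange /wsum !big_filter [RHS]big_mkcond [X in X + _ = _]big_mkcond
  [X in _ + X = _]big_mkcond -big_split /=.
apply: eq_bigr => i _; have [iy|iy] := ltnP i y; rewrite /= ?andbF ?andbT.
  have -> : (i < z)%N by lia.
  by rewrite andbT addr0.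
have -> : (x <= i)%N by lia.
by rewrite add0r.
Qed.

Lemma slope_neq0 t p : all (mem I) t -> p \in t -> slope t p != 0.
Proof.
move=> tI pt; rewrite /slope (eq_bigl (fun i => i == p)) //.
rewrite (eq_bigr (fun=> (beta p)^-1)) => [|i /eqP -> //].
rewrite big_const_seq iter_addr_0.
have [_ b0 _ _] := theta_spec (allP tI p pt).
rewrite -mulr_natr mulf_neq0 ?invr_neq0 //.
rewrite -[_%:R]/((Posz _)%:~R) CC_char0 -lt0n -has_count; apply/hasP; exists p => //.
Qed.

Lemma slope_eq0 t p : (forall i, i \in t -> val i != p) -> slope t p = 0.
Proof. by move=> h; rewrite /slope big_seq_cond big1 // => i /andP[/h/negPf ->]. Qed.

(** If [lam w] vanishes where [w >= 0], the slope can jump only where [w = -1].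
    The ends of the support use two of the three allowed places; cutting the
    support at the remaining one makes [w] drop to [-2] there. *)
Lemma size_wsum_le1 t : all (mem I) t -> (forall k, -1 <= wsum t k) ->
  (#|[pred k | wsum t k == -1%R]| <= 3)%N ->
  (forall k, 0 <= wsum t k -> \sum_l lam k l * (wsum t l)%:~R = 0) -> (size t <= 1)%N.
Proof.
case: t => // i0 t0; set t := i0 :: t0 => tI wm1 w3 w0.
have t0' : i0 \in t by rewrite inE eqxx.
have [p pt pmin] : exists2 p, p \in t & forall i, i \in t -> (p <= i)%N.
  by case: (arg_minnP (fun i : 'I_n => val i) t0') => p; exists p.
have [r rt rmax] : exists2 r, r \in t & forall i, i \in t -> (i <= r)%N.
  by case: (arg_maxnP (fun i : 'I_n => val i) t0') => r; exists r.
have [rn _ _ _] := theta_spec (allP tI r rt).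
pose r1 := Ordinal rn.
have jump k : \sum_l lam k l * (wsum t l)%:~R != 0 -> wsum t k = -1.
  by move=> h; have := wm1 k; case: (ltP (wsum t k) 0) => [|/w0 e]; [lia|rewrite e eqxx in h].
have wp : wsum t p = -1.
  apply: jump; rewrite lam_wsum //; have := slope_neq0 tI pt.
  rewrite /=; case E: (nat_of_ord p) => [|p']; first by rewrite subr0.
  rewrite (slope_eq0 (p := p')) ?subr0 //.
  by move=> i /pmin; rewrite E => h; rewrite gtn_eqF.
have wr : wsum t r1 = -1.
  apply: jump; rewrite lam_wsum //= [slope t r.+1]slope_eq0; last first.
    by move=> i /rmax h; rewrite ltn_eqF.
  by rewrite sub0r oppr_eq0 slope_neq0.
(* If a single index occurs, [wsum t p] is minus its multiplicity, and [wp] makes that 1. *)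
have [rp|pr] := leqP r p.
  have tp i : i \in t -> i = p.
    by move=> it; apply: val_inj; apply/eqP; rewrite eqn_leq pmin // (leq_trans (rmax i it)).
  move: wp; rewrite /wsum sum_ffunE (eq_big_seq (fun=> -1)) => [|i /tp ->]; last first.
    by apply: theta_m1; [exact: (allP tI)|rewrite eqxx].
  by rewrite big_const_seq count_predT iter_addr_0 mulNrn => /oppr_inj; rewrite natz => -[e]; rewrite /= e.
have whole : wrange t p r1 = wsum t.
  rewrite /wrange; congr wsum; apply/all_filterP/allP => i it.
  by rewrite pmin //= ltnS rmax.
pose J k := [&& (p < k)%N, (k <= r)%N & slope t k != slope t k.-1].
have JW k : J k -> wsum t k = -1.
  case/and3P => pk kr sk; apply: jump; rewrite lam_wsum // -subr_eq0 in sk *.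
  by move: pk sk; rewrite /=; case: (nat_of_ord k).
have [k [pk kr Jk]] : exists k : 'I_n, [/\ (p < k)%N, (k <= r)%N &
    forall j, J j -> j = k].
  have [k Jk|noJ] := pickP J; last first.
    (* Without an interior jump any cut point serves. *)
    have pn : (p.+1 < n)%N by apply: leq_trans (ltn_ord r1); rewrite /= ltnW.
    by exists (Ordinal pn); split=> // j; rewrite noJ.
  have /and3P[pk kr _] := Jk; exists k; split=> // j Jj; apply/eqP/negPn/negP => jk.
  have /and3P[pj jr _] := Jj.
  have u : uniq [:: p; k; j; r1].
    by rewrite /= !inE -!val_eqE /= in jk *; lia.
  move: w3; rewrite leqNgt => /negP; apply.
  rewrite -[4%N]/(size [:: p; k; j; r1]) -(card_uniqP u); apply: subset_leq_card.
  by apply/subsetP => x; rewrite !inE => /or4P[] /eqP ->; rewrite ?wp ?wr ?JW.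
have flat (x y : nat) : (p <= x)%N -> (y <= r.+1)%N -> (forall j : nat, (x < j < y)%N -> j != k) ->
    forall j : nat, (x <= j < y)%N -> slope t j = slope t x.
  move=> px yr nk; elim=> [|j IH] hj; first by congr slope; lia.
  have [->//|xj] := eqVneq x j.+1.
  have jn : (j.+1 < n)%N by lia.
  have := Jk (Ordinal jn); rewrite /J /= => h.
  have [->|nj] := eqVneq (slope t j.+1) (slope t j); first by rewrite IH //; lia.
  have hk : j.+1 = k by rewrite -(h _) ?nj ?andbT //; lia.
  have : j.+1 != k by apply: nk; lia.
  by rewrite hk eqxx.
(* Each piece has constant slope, hence equal values at its two ends. At its outer end it is at most
   [-1], because the other piece is nonnegative there; so at the cut [k] the two add up to at most
   [-2]. *)
have flatX := flat p k (leqnn _) (leqW kr) _.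
have flatY := flat k r1 (ltnW pk) (leqnn _) _.
have eX := @wrange_ends t p k (slope t p) tI (ltnW pk) (flatX _).
have eY := @wrange_ends t k r1 (slope t k) tI (leqW kr) (flatY _).
have sum j : wrange t p k j + wrange t k r1 j = wsum t j.
  by rewrite -whole -(@wrange_cat t p k r1) ?ffunE //= (ltnW pk) ltnW.
have := wrange_ge0 (x := k) (y := r1) (k := p) tI; rewrite pk => /(_ isT).
have := wrange_ge0 (x := p) (y := k) (k := r1) tI; rewrite ltnS kr orbT => /(_ isT).
have {}eX : wrange t p k p = wrange t p k k by apply: eX => j; lia.
have {}eY : wrange t k r1 k = wrange t k r1 r1 by apply: eY => j; lia.
have := wm1 k; have := sum p; have := sum k; have := sum r1; rewrite wp wr.
lia.
Qed.

(** [lam] maps the [theta i] to nonzero multiples of the vectors [e_i - e_(i+1)], which are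
    triangular. *)
Lemma theta_free (x : 'I_n -> CC) : (forall k, \sum_(i in I) x i * (theta i k)%:~R = 0) ->
  forall i, i \in I -> x i = 0.
Proof.
move=> h; pose y i := if i \in I then x i / beta i else 0.
have H k : \sum_i y i * ((k == i)%:R - (val k == i.+1)%:R) = 0.
  transitivity (\sum_l lam k l * \sum_(i in I) x i * (theta i l)%:~R); last first.
    by rewrite big1 // => l _; rewrite h mulr0.
  under [RHS]eq_bigr do rewrite mulr_sumr.
  rewrite exchange_big /= [RHS]big_mkcond /=; apply: eq_bigr => i _; rewrite /y.
  case: ifP => iI; last by rewrite mul0r.
  rewrite -mulrA [_^-1 * _]mulrC -lam_theta // mulr_sumr.
  by apply: eq_bigr => l _; rewrite mulrCA.
have Y : forall i, y i = 0.
  move=> [p]; elim: p => [|p IH] pn.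
    have := H (Ordinal pn); rewrite (bigD1 (Ordinal pn)) //= ?eqxx subr0 mulr1 big1 ?addr0 //.
    by move=> i /negPf ni; rewrite eq_sym ni subrr mulr0.
  have p1n := ltnW pn; have := H (Ordinal pn).
  have np : Ordinal p1n != Ordinal pn by rewrite -val_eqE /= ltn_eqF.
  rewrite (bigD1 (Ordinal pn)) //= (bigD1 (Ordinal p1n)) //= IH mul0r add0r ?eqxx.
  rewrite (ltn_eqF (ltnSn p.+1)) subr0 mulr1 big1 ?addr0 // => i /andP[ni nj].
  rewrite eq_sym (negPf ni) eqSS eq_sym; move: nj; rewrite -val_eqE /= => /negPf ->.
  by rewrite subrr mulr0.
move=> i iI; have [_ b0 _ _] := theta_spec iI.
by have /eqP := Y i; rewrite /y iI mulf_eq0 invr_eq0 (negPf b0) orbF => /eqP.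
Qed.

(** A rational right inverse of the matrix of the [theta i], cleared of denominators. The integer
    dual vectors define the lengths of the letters and, with [d]-th roots, solve for torus
    elements. *)
Lemma theta_dual : exists (d : nat) (A : 'I_n -> 'I_n -> int), (0 < d)%N /\
  forall i i', i \in I -> i' \in I -> \sum_j theta i j * A j i' = (d * (i == i'))%N.
Proof.
pose M : 'M[rat]_(#|I|, n) := \matrix_(x, j) (theta (enum_val x) j)%:~R.
have Mfree : row_free M.
  apply: inj_row_free => v vM; apply/rowP => x; rewrite mxE.
  pose y i : CC := if [pick z : 'I_#|I| | enum_val z == i] is Some z then
    ratr (v 0 z) : complex.complex Rdefinitions.R else 0.
  have yE z : y (enum_val z) = (ratr (v 0 z) : complex.complex Rdefinitions.R).
    rewrite /y; case: pickP => [z' /eqP/enum_val_inj -> //|/(_ z)].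
    by rewrite eqxx.
  have := @theta_free y _ (enum_val x) (enum_valP x); rewrite yE => h.
  apply/eqP; rewrite -(fmorph_eq0 (@ratr (complex.complex Rdefinitions.R))); apply/eqP/h => k.
  have := congr1 (fun m : 'rV[rat]_n => ratr (m 0 k) : complex.complex Rdefinitions.R) vM.
  rewrite !mxE rmorph0 rmorph_sum /= => e; rewrite -[RHS]e big_enum_val /=.
  by apply: eq_bigr => z _; rewrite yE !mxE rmorphM /= ratr_int.
pose B := pinvmx M; pose d := (\prod_j \prod_x `|denq (B j x)|)%N.
pose N j x : int := numq (B j x) * ((\prod_(p : 'I_n * 'I_#|I| | p != (j, x)) `|denq (B p.1 p.2)|)%N : int).
have NE j x : (N j x)%:~R = (d%:R : rat) * B j x.
  rewrite /N /d pair_big /= [in RHS](bigD1 (j, x)) //= natrM rmorphM /= mulrAC; congr (_ * _).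
  rewrite -[LHS](divfK (x := (denq (B j x))%:~R)) ?intr_eq0 ?denq_neq0 // divq_num_den mulrC.
  by congr (_ * _); rewrite -absz_denq.
exists d, (fun j i => if [pick z : 'I_#|I| | enum_val z == i] is Some z then N j z else 0); split.
  by apply: prodn_gt0 => j; apply: prodn_gt0 => x; rewrite absz_gt0 denq_neq0.
move=> i i' iI iI'.
case: pickP => [z /eqP zi|/(_ (enum_rank_in iI' i'))]; last by rewrite enum_rankK_in ?eqxx.
apply: (@intr_inj rat); rewrite rmorph_sum /=.
have /(congr1 (fun m : 'M[rat]_#|I| => d%:R * m (enum_rank_in iI i) z)) := mulmxVp Mfree.
rewrite mxE [X in _ = _ * X -> _]mxE mulr_sumr => e.
transitivity (d%:R * (enum_rank_in iI i == z)%:R : rat); last first.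
  rewrite -(inj_eq enum_val_inj) enum_rankK_in // zi -natrM.
  by rewrite -[RHS]/((d * _)%N%:R).
rewrite -e; apply: eq_bigr => j _.
by rewrite [M _ _]mxE enum_rankK_in // rmorphM /= NE mulrCA.
Qed.

End Weights.

(** * The semigroup generated by the smoothable weights *)

Section Semigroup.
Variables (n : nat) (lam b : 'M[CC]_n) (I : {set 'I_n}) (theta : 'I_n -> weight n).
Hypothesis lam_alt : add_alternating lam.
Hypothesis lam_gen : generic lam.
Hypothesis b_inv : is_biresidue lam b.
Hypothesis smooth : forall i, i \in I ->
  exists j : 'I_n, [/\ val j = (val i).+1, smoothable b i j & smoothable_weight b i j (theta i)].
Implicit Types (w : weight n) (i j k : 'I_n) (t : seq 'I_n).
Notation wsum := (wsum theta).
Notation inTheta := (inTheta I theta).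

Lemma inThetaP m w :
  reflect (exists t, [/\ size t = m, all (mem I) t & w = wsum t]) (inTheta m w).
Proof.
apply: (iffP existsP) => [[t /andP[tI /eqP ->]]|[t [tm tI ->]]].
  by exists t; rewrite size_tuple.
by move/eqP: tm => tm; exists (Tuple tm); rewrite /= eqxx andbT.
Qed.

Lemma inTheta1 i : i \in I -> inTheta 1 (theta i).
Proof. by move=> iI; apply/inThetaP; exists [:: i]; rewrite /= iI /wsum big_seq1. Qed.

Lemma inTheta0 w : inTheta 0 w = (w == 0).
Proof.
apply/inThetaP/eqP => [[t [/size0nil -> _ ->]]|->]; first by rewrite /wsum big_nil.
by exists [::]; rewrite /wsum big_nil.
Qed.

Lemma inThetaD m m' w w' : inTheta m w -> inTheta m' w' -> inTheta (m + m') (w + w').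
Proof.
case/inThetaP => t [tm tI ->] /inThetaP[t' [tm' tI' ->]]; apply/inThetaP.
by exists (t ++ t'); rewrite size_cat tm tm' all_cat tI tI' /wsum big_cat.
Qed.

Lemma inTheta_sum m w : inTheta m w -> \sum_k w k = 0.
Proof.
case/inThetaP => t [_ tI ->]; under eq_bigr do rewrite /wsum sum_ffunE.
rewrite exchange_big /= big_seq big1 // => i it.
by rewrite (sum_theta b_inv smooth (allP tI i it)).
Qed.

(** With [rho i] a [d]-th root of [g i], monomials in [rho] whose exponents come from the dual
    vectors take the value [rho i ^+ d] on [theta i]. *)
Lemma theta_torus (g : 'I_n -> CC) : (forall i, i \in I -> g i != 0) ->
  exists s : 'I_n -> CC, (forall j, s j != 0) /\
    forall i, i \in I -> \prod_j s j ^ theta i j = g i.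
Proof.
move=> g0; have [d [A [d0 dA]]] := theta_dual b_inv smooth.
have [rho rhoE] : exists rho : 'I_n -> CC, forall i, rho i ^+ d = g i.
  pose r i : CC := d.-root (g i : complex.complex Rdefinitions.R).
  by exists r => i; apply: (rootCK d0 (g i : complex.complex Rdefinitions.R)).
have rho0 i : i \in I -> rho i != 0.
  by move=> /g0; rewrite -rhoE; apply: contra_neq => ->; rewrite expr0n gtn_eqF.
exists (fun j => \prod_(i in I) rho i ^ A j i); split.
  by move=> j; apply/prodf_neq0 => i /rho0; apply: expfz_neq0.
move=> i iI.
transitivity (\prod_(i' in I) rho i' ^ (\sum_j theta i j * A j i')).
  rewrite (eq_bigr (fun j => \prod_(i' in I) rho i' ^ (theta i j * A j i'))); last first.
    move=> j _; rewrite (big_morph (fun x : CC => x ^ theta i j) (fun x y => expfzMl x y _) (exp1rz _ _)).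
    apply: eq_bigr => i' _.
    by rewrite exprz_exp mulrC.
  rewrite exchange_big /=; apply: eq_bigr => i' /rho0 r0.
  by apply/esym/(big_morph (fun m => rho i' ^ m)) => // x y; rewrite expfzDr.
rewrite (bigD1 i) //= dA // eqxx muln1 -[rho i ^ _]/(rho i ^+ d) rhoE big1 ?mulr1 // => i' /andP[i'I ni].
by rewrite dA // eq_sym (negPf ni) muln0.
Qed.

(** The length of [x_j] is chosen so that every [theta i] shortens words by the
    same amount [d]; this is possible since the [theta i] are linearly independent. *)
Lemma theta_cone : exists G : cone n,
  (forall w, cmem G w -> inTheta (cht G w) w) /\
  (forall m w, inTheta m w -> cmem G w /\ cht G w = m).
Proof.
have [d [A [d0 dA]]] := theta_dual b_inv smooth.
(* Adding [c.+1] makes all lengths positive and does not affect the length of [theta i], whose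
   entries sum to 0. *)
pose g j : int := - \sum_(i in I) A j i; pose c := (\sum_j `|g j|)%N.
pose h j := absz (g j + (c.+1)%:Z).
have cE j : (`|g j| <= c)%N by rewrite /c (bigD1 j) //= leq_addr.
have hE j : (h j)%:Z = g j + (c.+1)%:Z.
  by rewrite /h abszE ger0_norm //; have := cE j; lia.
have thetaL i : i \in I -> \sum_j (h j)%:Z * theta i j = - d%:Z.
  move=> iI; under eq_bigr do rewrite hE mulrDl.
  rewrite big_split /= -mulr_sumr (sum_theta b_inv smooth iI) mulr0 addr0.
  under eq_bigr do rewrite /g mulNr mulr_suml.
  rewrite sumrN exchange_big /= (bigD1 i iI) /= [X in _ + X]big1 ?addr0 => [|i' /andP[i'I ni]].
    by under eq_bigr do rewrite mulrC; rewrite dA // eqxx muln1.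
  by under eq_bigr do rewrite mulrC; rewrite dA // eq_sym (negPf ni) muln0.
pose len w := \sum_j (h j)%:Z * w j.
have lenT m w : inTheta m w -> len w = - (d * m)%:Z.
  case/inThetaP => t [<- tI ->]; rewrite /len.
  under eq_bigr do rewrite /wsum sum_ffunE mulr_sumr.
  rewrite exchange_big /= big_seq (eq_bigr (fun=> - d%:Z)) => [|i it]; last first.
    by apply/thetaL/(allP tI).
  by rewrite -big_seq big_const_seq count_predT iter_addr_0 mulNrn PoszM -mulr_natr natz.
pose ht w := (`|len w| %/ d)%N.
have htT m w : inTheta m w -> ht w = m.
  by move=> /lenT e; rewrite /ht e abszN absz_nat mulKn.
have memP m w : inTheta m w -> inTheta (ht w) w by move=> mw; rewrite (htT m).
(* Membership in some Theta_m is tested at the only candidate height [ht w], which keeps it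
   boolean. *)
unshelve eexists (@Cone n (fun w => inTheta (ht w) w) ht h d _ _ _ _ _ _) => //=.
- by apply: (memP 0%N); rewrite inTheta0.
- by move=> v w hv hw; apply: (memP (ht v + ht w)%N); apply: inThetaD.
- by move=> i; rewrite absz_gt0; have := cE i; lia.
- by move=> w /lenT.
- by move=> w /[swap] ->; rewrite inTheta0 => /eqP.
by split=> // m w mw; rewrite (htT m).
Qed.

Let q i j := EExp lam i j.

Lemma qE i j : q i j = cexp (lam i j).
Proof. by rewrite /q mxE. Qed.

Lemma EExpV i j : q i j * q j i = 1.
Proof. by rewrite !qE -cexpD (lam_alt i j) subrr cexp0. Qed.

Lemma EExp1 i : q i i = 1.
Proof.
rewrite qE; have /eqP := lam_alt i i; rewrite -addr_eq0 -mulr2n -mulr_natl mulf_eq0.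
by rewrite -[2%:R]/(2%:~R) CC_char0 => /eqP ->; rewrite cexp0.
Qed.

Lemma chi_EExp i w : chi q i w = cexp (\sum_j lam i j * (w j)%:~R).
Proof. by rewrite cexp_sum; apply: eq_bigr => j _; rewrite cexpMz qE. Qed.

Lemma inTheta_rigid m w : inTheta m w -> (2 <= m)%N -> (forall i, -1 <= w i) ->
  (#|[pred i | w i == -1%R]| <= 3)%N -> exists i, 0 <= w i /\ chi q i w != 1.
Proof.
move=> mw m2 w1 w3; apply/'exists_andP => //; apply: contraT => /existsPn none.
have hoch : hochschild_contributing (EExp lam) w.
  by split=> // i wi; have := none i; rewrite wi /= negbK => /eqP.
have [_ pois] := lam_gen.2 w (conj w1 (inTheta_sum mw)) hoch.
case/inThetaP: mw => t [tm tI e]; rewrite leqNgt in m2; case/negP: m2.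
rewrite -tm ltnS; apply: (size_wsum_le1 b_inv smooth) => //; rewrite -e //.
Qed.

Lemma theta_edge i : i \in I -> exists j : 'I_n,
  [/\ val j = i.+1, theta i i = -1, theta i j = -1 &
    forall k, k != i -> k != j -> 0 <= theta i k /\ chi q k (theta i) = 1].
Proof.
move=> iI; have [j [ji _ _]] := smooth iI; have [_ _ _ pos] := theta_spec b_inv smooth iI.
exists j; split=> //.
- by apply: (theta_m1 smooth) => //; rewrite eqxx.
- by apply: (theta_m1 smooth) => //; rewrite ji eqxx orbT.
move=> k ki kj; have kj' : val k != i.+1 by rewrite -ji val_eqE.
split; first exact: pos.
rewrite chi_EExp (lam_theta b_inv smooth) // (negPf ki) (negPf kj') subrr mul0r.
exact: cexp0.
Qed.

End Semigroup.

(** * Uniqueness *)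

Lemma wt_lt0 (n : nat) (a b k l x : 'I_n) : wt a b k l x < 0 -> (x == a) || (x == b).
Proof. by rewrite /wt !ffunE; case: (x == a); case: (x == b) => //=; lia. Qed.

Section Uniqueness.
Variables (n : nat) (G : cone n) (K : fieldType) (q : 'I_n -> 'I_n -> K).
Hypothesis qV : forall i j, q i j * q j i = 1.
Hypothesis q1 : forall i, q i i = 1.
Implicit Types (u v w : weight n) (i j k l a b c : 'I_n).
Notation M := {freeg (weight n) / {poly K}}.
Notation fil := (fil G).
Notation chi := (chi q).
Hypothesis cmem_rigid : forall w, cmem G w -> (2 <= cht G w)%N -> (forall i, -1 <= w i) ->
  (#|[pred i | w i == -1%R]| <= 3)%N -> exists i, 0 <= w i /\ chi i w != 1.
Variables (cst cst' : 'I_n -> 'I_n -> weight n -> {poly K}) (X X' : 'I_n -> {linear M -> M}).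
Hypotheses (cst1 : deforming G 1 cst) (sX : straight G q cst X).
Hypotheses (cst1' : deforming G 1 cst') (sX' : straight G q cst' X').
Hypothesis E0 : forall b a u, (a < b)%N -> wpos u -> Eop q cst X b a << u >> = 0.
Hypothesis E0' : forall b a u, (a < b)%N -> wpos u -> Eop q cst' X' b a << u >> = 0.
Hypothesis supp : forall b a w, cst' b a w - cst b a w != 0 ->
  (a < b)%N /\ exists k l, (k <= l)%N /\ wt a b k l = w.

Lemma cst_unique s w a b : (2 <= s)%N ->
  deforming G s (fun b a w => cst' b a w - cst b a w) ->
  cmem G w -> cht G w = s -> (a < b)%N -> w a = -1 -> w b = -1 ->
  cst' b a w = cst b a w.
Proof.
move=> s2 dcst mw ws ab wa wb; apply/eqP; rewrite -subr_eq0; apply: contraT => nz.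
have [_ [k [l [kl e]]]] := supp nz.
have nneg x : x != a -> x != b -> 0 <= w x.
  move=> xa xb; rewrite leNgt; apply/negP; rewrite -e => /wt_lt0.
  by rewrite (negPf xa) (negPf xb).
have [|||i [wi ci]] := cmem_rigid mw; rewrite ?ws //.
- by move=> x; have [->|xa] := eqVneq x a; [|have [->|xb] := eqVneq x b]; rewrite ?wa ?wb //; have := nneg x xa xb; lia.
- apply: leq_trans (_ : (#|[:: a; b]| <= _)%N); last by rewrite (leq_trans (card_size _)).
  apply: subset_leq_card; apply/subsetP => x; rewrite !inE => /eqP wx.
  by apply: contraT; rewrite negb_or => /andP[xa xb]; have := nneg x xa xb; rewrite wx.
have ia : i != a by apply: contraTneq wi => ->; rewrite wa.
have ib : i != b by apply: contraTneq wi => ->; rewrite wb.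
have Efil b' a' u : (a' < b')%N -> wpos u -> fil (u + (ew b' + ew a')) s (Eop q cst X b' a' << u >>).
  by move=> ab' u0; rewrite E0 //; apply: fil0.
have dS b' a' : cst' b' a' w - cst b' a' w != 0 -> exists k l, (k <= l)%N /\ wt a' b' k l = w.
  by case/supp.
have cmp c' b' a' ab' bc' := ecoef_compare qV q1 cst1 sX cst1' sX' dcst ws dS Efil (a := a') (b := b') (c := c') ab' bc'.
(* A pair with a nonzero difference at [w] consists of [a] and [b], where [w] is negative; so it
   cannot contain [i]. *)
have d0 b' a' : (i == a') || (i == b') -> dcoef q cst cst' w b' a' = 0.
  move=> hi; rewrite /dcoef; have [->|/supp[ab' [k' [l' [_ e']]]]] := eqVneq (cst' b' a' w - cst b' a' w) 0.
    by rewrite mulr0.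
  have := @wt_lt0 n a' b' k' l' a; have := @wt_lt0 n a' b' k' l' b; rewrite e' wa wb.
  move=> /(_ isT) hb /(_ isT) ha; have : a != b by rewrite -val_eqE ltn_eqF.
  case/orP: hi => /eqP hi; rewrite -hi ?[_ == i]eq_sym ?(negPf ia) ?(negPf ib) ?orbF /= in ha hb.
    by rewrite (eqP ha) (eqP hb) eqxx.
  by rewrite (eqP ha) (eqP hb) eqxx.
have dab : dcoef q cst cst' w b a != 0.
  by rewrite mulf_neq0 ?polyC_eq0 ?invr_eq0 ?mulf_neq0 ?bch_neq0.
have ne0 : (chi i w - 1)%:P * dcoef q cst cst' w b a != 0.
  by rewrite mulf_neq0 // polyC_eq0 subr_eq0.
have ecoef0 c' b' a' : (b' < c')%N -> ecoef q cst' X' w c' b' (ew a') - ecoef q cst X w c' b' (ew a') = 0.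
  by move=> bc; rewrite /ecoef E0 ?E0' ?wpos_ew // !coeff0 !mulr0 subr0.
(* In the overlap of [a], [b] and [i] only the term of the pair [{a, b}] survives, wherever [i]
   stands. *)
case: (ltngtP i a) => [lia|lai|/val_inj e']; last by rewrite e' eqxx in ia.
  have := cmp b a i lia ab; rewrite ecoef0 // !(d0 _ i) ?eqxx // !mulr0 subr0 add0r => /esym/eqP.
  by rewrite (negPf ne0).
case: (ltngtP i b) => [lib|lbi|/val_inj e']; last by rewrite e' eqxx in ib.
  have := cmp b i a lai lib; rewrite ecoef0 // (d0 i a) ?eqxx ?orbT // (d0 b i) ?eqxx // !mulr0 sub0r addr0.
  by move=> /esym/eqP; rewrite oppr_eq0 (negPf ne0).
have := cmp i b a ab lbi; rewrite ecoef0 // !(d0 i) ?eqxx ?orbT // !mulr0 subr0 addr0 => /esym/eqP.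
by rewrite (negPf ne0).
Qed.

End Uniqueness.

(** * The relations of the theorem *)

Section Relations.
Variables (n : nat) (q : 'M[CC]_n) (I : {set 'I_n}) (theta : 'I_n -> weight n) (G : cone n).
Hypothesis GT : forall w, cmem G w -> inTheta I theta (cht G w) w.
Hypothesis TG : forall m w, inTheta I theta m w -> cmem G w /\ cht G w = m.
Variables (N : nat) (Cc : 'I_n -> 'I_n -> 'I_n -> 'I_n -> CC).
Implicit Types (w : weight n) (a b k l : 'I_n).
Notation rel_coef := (rel_coef I theta N Cc).
Notation rel_ab := (rel_ab q I theta N Cc).

Lemma rel_coefE a b k l : rel_coef a b k l =
  if cmem G (wt a b k l) && (0 < cht G (wt a b k l) <= N)%N
  then Cc k l b a *: 'X^(cht G (wt a b k l)) else 0.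
Proof.
rewrite /Defs.rel_coef; set w := wt a b k l.
case: ifP => [/andP[mw hw]|hw].
  rewrite big_mkcond (bigD1_seq (cht G w)) ?iota_uniq ?mem_index_iota //= GT // big1 ?addr0 ?mul_polyC //.
  by move=> m nm; case: ifP => // /TG[_ e]; rewrite e eqxx in nm.
rewrite big_nat_cond big1 // => m /andP[mN /TG[mw e]].
by move: hw; rewrite mw e mN.
Qed.

Lemma freeg_rel_ab a b : [freeg (rel_ab a b)] = quad_rel (q b a)%:P (rel_coef a b) a b.
Proof.
rewrite freeg_cat freeg_faE big_cons big_seq1 /= scaleN1r freeg_mapE big_enum_cond.
by congr (_ + _); apply: eq_bigl => kl; rewrite andbT.
Qed.

Lemma freeg_spec_rel e a b :
  [freeg (spec_eps rel_ab e a b)] = quad_rel (q b a) (fun k l => (rel_coef a b k l).[e]) a b.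
Proof.
have em1 : (-1 : {poly CC}).[e] = -1 by rewrite -polyC1 -polyCN hornerC.
rewrite freeg_mapE big_cat /= big_cons big_seq1 /= em1 scaleN1r hornerC big_map.
by rewrite big_enum_cond; congr (_ + _); apply: eq_bigl => kl; rewrite andbT.
Qed.

(** The relations with coefficients indexed by weight; for given [w] at most one pair contributes,
    by [ew_pair_inj]. *)
Definition rel_cst b a w : {poly CC} :=
  if (a < b)%N then
    \sum_(kl : 'I_n * 'I_n | (kl.1 <= kl.2)%N && (wt a b kl.1 kl.2 == w)) rel_coef a b kl.1 kl.2
  else 0.

Lemma rel_cst_wt a b k l : (a < b)%N -> (k <= l)%N -> rel_cst b a (wt a b k l) = rel_coef a b k l.
Proof.
move=> ab kl; rewrite /rel_cst ab (big_pred1 (k, l)) // => -[k' l'] /=.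
apply/andP/eqP => [[kl' /eqP]|[-> ->]] //.
by rewrite /wt => /addIr/addIr/(ew_pair_inj kl' kl).
Qed.

Lemma rel_cst_supp b a w : rel_cst b a w != 0 -> (a < b)%N /\ exists k l, (k <= l)%N /\ wt a b k l = w.
Proof.
rewrite /rel_cst; case: ifP => [ab|]; last by rewrite eqxx.
move=> nz; split=> //.
case: (pickP [pred kl : 'I_n * 'I_n | (kl.1 <= kl.2)%N && (wt a b kl.1 kl.2 == w)]) => [kl /andP[h /eqP e]|h].
  by exists kl.1, kl.2.
by rewrite big_pred0 ?eqxx in nz.
Qed.

Lemma rel_cst_deforming : deforming G 1 rel_cst.
Proof.
move=> b a w; have [->|] := eqVneq (rel_cst b a w) 0; first by left.
move=> /rel_cst_supp[ab [k [l [kl <-]]]]; rewrite rel_cst_wt // rel_coefE.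
by case: ifP => [/and3P[mw h _]|_]; [right; split=> //; exists (Cc k l b a)|left].
Qed.

Lemma freeg_rel_cst a b : (a < b)%N ->
  [freeg (rel_ab a b)] = relD (fun i j => q i j) rel_cst a b.
Proof.
move=> ab; rewrite freeg_rel_ab; congr (_ + _); apply: eq_bigr => kl h.
by rewrite rel_cst_wt.
Qed.

End Relations.

(** * Torus characters and rescaled coefficients *)

Section Torus.
Variable n : nat.
Implicit Types (s t : 'I_n -> CC) (v w : weight n).

Definition twt s w : CC := \prod_j s j ^ w j.

Lemma twt0 s : twt s 0 = 1.
Proof. by rewrite /twt big1 // => j _; rewrite ffunE. Qed.

Lemma twtD s v w : (forall j, s j != 0) -> twt s (v + w) = twt s v * twt s w.
Proof. by move=> s0; rewrite -big_split; apply: eq_bigr => j _; rewrite ffunE expfzDr. Qed.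

Lemma twt_ew s k : twt s (ew k) = s k.
Proof.
rewrite /twt (bigD1 k) //= big1 ?mulr1 => [|j /negPf nj]; first by rewrite ffunE eqxx expr1z.
by rewrite ffunE nj.
Qed.

Lemma twt_wt s a b k l : (forall j, s j != 0) -> s a * s b * twt s (wt a b k l) = s k * s l.
Proof.
move=> s0; rewrite -!(twt_ew s) -!twtD //; congr (twt s _).
by rewrite /wt; weq.
Qed.

Lemma twt_theta (I : {set 'I_n}) (theta : 'I_n -> weight n) s t t' (e e' : CC) m w :
  (forall j, s j != 0) -> (forall j, t j != 0) -> (forall j, t' j != 0) ->
  (forall i, i \in I -> twt s (theta i) * (twt t (theta i) * e) = twt t' (theta i) * e') ->
  inTheta I theta m w -> twt s w * (twt t w * e ^+ m) = twt t' w * e' ^+ m.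
Proof.
move=> s0 t0 t0' h /inThetaP[u [<- uI ->]] {m w}.
rewrite /wsum; elim: u uI => [|i u IH] /=; first by rewrite big_nil !twt0 !mul1r.
move=> /andP[iI uI]; rewrite big_cons !twtD // !exprS.
transitivity ((twt s (theta i) * (twt t (theta i) * e)) *
  (twt s (\sum_(j <- u) theta j) * (twt t (\sum_(j <- u) theta j) * e ^+ size u))); first by ring.
by rewrite h // IH //; ring.
Qed.

End Torus.

Section Twist.
Variables (n : nat) (q : 'M[CC]_n) (I : {set 'I_n}) (theta : 'I_n -> weight n) (N : nat).
Variable C1 : 'I_n -> 'I_n -> 'I_n -> 'I_n -> CC.
Implicit Types (s t : 'I_n -> CC).

(** The coefficients after the rescaling [x_k |-> t_k x_k], once each relation is made monic
    again. *)
Definition twist t k l b a : CC := C1 k l b a * twt t (wt a b k l).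

Lemma rel_coef_twist t a b k l :
  rel_coef I theta N (twist t) a b k l = (twt t (wt a b k l))%:P * rel_coef I theta N C1 a b k l.
Proof.
by rewrite mulr_sumr; apply: eq_bigr => m _; rewrite /twist polyCM [X in X * _]mulrC -mulrA.
Qed.

Lemma horner_rel_coef t e a b k l : (rel_coef I theta N (twist t) a b k l).[e] =
  \sum_(1 <= m < N.+1 | inTheta I theta m (wt a b k l))
    C1 k l b a * (twt t (wt a b k l) * e ^+ m).
Proof.
rewrite /rel_coef horner_sum; apply: eq_bigr => m _.
by rewrite hornerM hornerC hornerXn /twist -mulrA.
Qed.

Lemma free_quotient_twist t : (forall j, t j != 0) ->
  free_quotient (rel_ab q I theta N C1) -> free_quotient (rel_ab q I theta N (twist t)).
Proof.
move=> t0; pose tau k := (t k)%:P; pose tau' k := (t k)^-1%:P.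
have tauV k : tau k * tau' k = 1 by rewrite -polyCM mulfV.
apply: (@free_quotient_scaling _ _ tau tau' (fun a b => tau a * tau b) (fun a b => tau' a * tau' b)) => //.
  by move=> a b; rewrite mulrACA !tauV mulr1.
move=> a b ab; rewrite !freeg_rel_ab; apply: scaling_quad_rel => k l kl.
by rewrite rel_coef_twist [RHS]mulrA /tau -!polyCM twt_wt // mulrC.
Qed.

(** Diagonal matrices preserve the filtration; the condition on the [theta i] propagates
    multiplicatively to Theta_m, with the powers [e ^+ m] and [e' ^+ m]. *)
Lemma filtered_iso_twist t t' e e' s :
  (forall j, s j != 0) -> (forall j, t j != 0) -> (forall j, t' j != 0) ->
  (forall i, i \in I -> twt s (theta i) * (twt t (theta i) * e) = twt t' (theta i) * e') ->
  filtered_iso I theta (spec_eps (rel_ab q I theta N (twist t)) e)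
    (spec_eps (rel_ab q I theta N (twist t')) e').
Proof.
move=> s0 t0 t0' h; pose r := \row_j s j.
have rE k : r 0 k = s k by rewrite mxE.
exists (diag_mx r); split.
- by rewrite unitmxE det_diag unitfE; apply/prodf_neq0 => j _; rewrite mxE.
- by move=> a k l; rewrite mxE; have [->|] := eqVneq k l; rewrite ?mulr0n ?eqxx.
move=> f; apply: (@in_ideal_scaling _ _ (r 0) (fun k => (s k)^-1) (fun a b => s a * s b)
    (fun a b => (s a)^-1 * (s b)^-1)).
- by move=> k; rewrite rE mulfV.
- by move=> a b; rewrite mulrACA !mulfV // mulr1.
- move=> a b ab; rewrite !freeg_spec_rel.
  rewrite -!rE; apply: scaling_quad_rel => k l kl; rewrite !rE.
  rewrite -(twt_wt a b k l s0) mulrCA; congr (_ * _).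
  rewrite !horner_rel_coef mulr_suml; apply: eq_bigr => m mw.
  rewrite -mulrA -(twt_theta s0 t0 t0' h mw); congr (_ * _).
  by rewrite mulrC.
exact: freeg_subst_diag.
Qed.

End Twist.

(** * Existence and uniqueness for the given data *)

Section Main.
Variables (n : nat) (lam b : 'M[CC]_n) (I : {set 'I_n}) (theta : 'I_n -> weight n).
Hypothesis lam_alt : add_alternating lam.
Hypothesis lam_gen : generic lam.
Hypothesis b_inv : is_biresidue lam b.
Hypothesis smooth : forall i, i \in I ->
  exists j : 'I_n, [/\ val j = (val i).+1, smoothable b i j & smoothable_weight b i j (theta i)].
Implicit Types (w : weight n) (a c i j k l : 'I_n).
Let q : 'I_n -> 'I_n -> CC := fun i j => EExp lam i j.
Let qV := EExpV lam_alt.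
Let q1 := EExp1 lam_alt.

Lemma wt_theta a c k l i : (a < c)%N -> i \in I -> wt a c k l = theta i ->
  theta i a = -1 /\ theta i c = -1.
Proof.
move=> ac iI e; have [j [ji ti tj _]] := theta_edge b_inv smooth iI.
have neg x : theta i x = -1 -> x = a \/ x = c.
  by move=> h; have := @wt_lt0 n a c k l x; rewrite e h => /(_ isT)/orP[]/eqP; [left|right].
have ij : (i < j)%N by rewrite -[nat_of_ord j]/(val j) ji.
have ni := neg _ ti; have nj := neg _ tj.
by move: ni nj ij ti tj ac => [->|->] [->|->]; rewrite ?ltnn // => /ltnW; rewrite leqNgt => /negPf ->.
Qed.

Section WithCone.
Variable G : cone n.
Hypothesis GT : forall w, cmem G w -> inTheta I theta (cht G w) w.
Hypothesis TG : forall m w, inTheta I theta m w -> cmem G w /\ cht G w = m.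

Lemma cone_rigid w : cmem G w -> (2 <= cht G w)%N -> (forall i, -1 <= w i) ->
  (#|[pred i | w i == -1%R]| <= 3)%N -> exists i, 0 <= w i /\ chi q i w != 1.
Proof. by move=> /GT mw; apply: inTheta_rigid lam_gen b_inv smooth _ _ mw. Qed.

Lemma cone_theta w : cmem G w -> cht G w = 1%N -> exists2 i, i \in I & w = theta i.
Proof.
move=> /GT mw e; move: mw; rewrite e => /inThetaP[[|i [|? ?]] [] // _ /andP[iI _] ->].
by exists i; rewrite // /wsum big_seq1.
Qed.

Lemma cone_first w : cmem G w -> cht G w = 1%N ->
  exists i j : 'I_n, [/\ (i < j)%N, w i = -1, w j = -1 &
    forall k, k != i -> k != j -> 0 <= w k /\ chi q k w = 1].
Proof.
move=> mw e; have [i iI ->] := cone_theta mw e.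
have [j [ji ti tj h]] := theta_edge b_inv smooth iI.
by exists i, j; split=> //; rewrite -[nat_of_ord j]/(val j) ji.
Qed.

Lemma deformation_exists : exists N C1, [/\ (1 <= N)%N,
  forall (a c k l i : 'I_n), (a < c)%N -> (k <= l)%N -> i \in I -> wt a c k l = theta i -> C1 k l c a = 1 &
  free_quotient (rel_ab (EExp lam) I theta N C1)].
Proof.
have cmem_sum w : cmem G w -> \sum_i w i = 0 by move=> /GT; apply: inTheta_sum b_inv smooth _ _.
have [cst [X [cst1 sX E0 F]]] := Eop_exists qV q1 cmem_sum cone_rigid cone_first.
(* The sum bounds the height of every quadratic weight, so truncation at [N] loses nothing. *)
pose N := (\sum_(x : 'I_n * 'I_n * ('I_n * 'I_n)) cht G (wt x.1.1 x.1.2 x.2.1 x.2.2)).+1.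
pose C1 k l c a : CC := (cst c a (wt a c k l))`_(cht G (wt a c k l)).
exists N, C1; split=> //.
  move=> a c k l i ac kl iI e; have [mw hw] := TG (inTheta1 theta iI).
  have [ta tc] := wt_theta ac iI e.
  by rewrite /C1 e F // hw coefX eqxx.
apply: (free_quotient_nf cst1 sX _ E0) => a c ac.
rewrite freeg_rel_ab; congr (_ + _); apply: eq_bigr => -[k l] /= kl; congr (_ *: _).
rewrite (rel_coefE GT TG); have := cst1 c a (wt a c k l).
have cN : (cht G (wt a c k l) <= N)%N.
  by rewrite /N leqW // (bigD1 (a, c, (k, l))) //= leq_addr.
rewrite cN andbT; case=> [e|[mw hw [x e]]]; first by rewrite /C1 e coef0 scale0r if_same.
by rewrite mw hw /C1 e coefZ coefXn eqxx mulr1.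
Qed.

Section Unique.
Hypothesis no_root : forall (m : nat) (a c : 'I_n), (1 <= m)%N -> a != c ->
  ~~ inTheta I theta m (ew a - ew c).
Variables (gamma : 'I_n -> CC) (N N' : nat) (Cc Cc' : 'I_n -> 'I_n -> 'I_n -> 'I_n -> CC).
Hypothesis D : deformation_data (EExp lam) I theta gamma N Cc.
Hypothesis D' : deformation_data (EExp lam) I theta gamma N' Cc'.
Notation cst := (rel_cst I theta N Cc).
Notation cst' := (rel_cst I theta N' Cc').

(** If [k] or [l] were [a] or [c], cancellation would turn the weight into some [e_x - e_y]:
    excluded by [no_root], or zero and hence of height 0. *)
Lemma wt_neg a c k l : (a < c)%N -> cmem G (wt a c k l) -> (0 < cht G (wt a c k l))%N ->
  wt a c k l a = -1 /\ wt a c k l c = -1.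
Proof.
move=> ac mw hw; have nr x y : wt a c k l = ew x - ew y -> False.
  move=> e; have := GT mw; have [xy|xy] := eqVneq x y; last by rewrite e; apply/negP/no_root; rewrite -?e.
  move: e; rewrite xy subrr => e _; have := TG (_ : inTheta I theta 0 0).
  by rewrite inTheta0 eqxx -e => /(_ isT)[_ h]; rewrite h in hw.
have ca : c != a by rewrite -val_eqE gtn_eqF.
have ka : a != k by apply/eqP => e; apply: (nr l c); rewrite /wt -e; weq.
have la : a != l by apply/eqP => e; apply: (nr k c); rewrite /wt -e; weq.
have kc : c != k by apply/eqP => e; apply: (nr l a); rewrite /wt -e; weq.
have lc : c != l by apply/eqP => e; apply: (nr k a); rewrite /wt -e; weq.
rewrite /wt !ffunE !eqxx (negPf ca) [a == c]eq_sym (negPf ca).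
by rewrite (negPf ka) (negPf la) (negPf kc) (negPf lc).
Qed.

Lemma rel_straight (M : nat) (Cd : 'I_n -> 'I_n -> 'I_n -> 'I_n -> CC) :
  deformation_data (EExp lam) I theta gamma M Cd ->
  exists X, straight G q (rel_cst I theta M Cd) X /\
  forall c a u, (a < c)%N -> wpos u -> Eop q (rel_cst I theta M Cd) X c a << u >> = 0.
Proof.
move=> [_ _ fq]; have d1 := rel_cst_deforming GT TG M Cd.
have [X sX] := straight_exists q d1; exists X; split=> //.
have rE a c := @freeg_rel_cst n (EExp lam) I theta M Cd a c.
apply: (Eop_eq0 qV q1 d1 sX).
exact: (free_quotient_overlap qV q1 d1 sX rE fq).
Qed.

(** Height one is fixed by [gamma]; above it [cst_unique] raises the order of agreement by one.
    Beyond [minn N N'] one of the systems is truncated, hence the bound on [s]. *)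
Lemma rel_cst_agree s : (1 <= s)%N -> (s <= (minn N N').+1)%N ->
  deforming G s (fun c a w => cst' c a w - cst c a w).
Proof.
have h1 : deforming G 1 (fun c a w => cst' c a w - cst c a w).
  by move=> c a w; apply/homogD/homogN; apply: rel_cst_deforming.
elim: s => // -[_ _ _ //|s IH] _ sN.
have {}IH := IH isT (ltnW sN) => c a w.
have [e|nz] := eqVneq (cst' c a w - cst c a w) 0; first by left; rewrite e.
have [mw hw] := homog_mem (IH c a w) nz.
move: (hw); rewrite leq_eqVlt => /predU1P[/esym e|lt]; last first.
  by case: (IH c a w) => [-> |[_ _ h]]; [left|right].
have supp c' a' w' : cst' c' a' w' - cst c' a' w' != 0 ->
    (a' < c')%N /\ exists k l, (k <= l)%N /\ wt a' c' k l = w'.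
  have [z|/rel_cst_supp //] := eqVneq (cst' c' a' w') 0.
  by rewrite z sub0r oppr_eq0 => /rel_cst_supp.
have [ac [k [l [kl wE]]]] := supp _ _ _ nz.
case/eqP: nz; apply/eqP; rewrite subr_eq0; apply/eqP.
have [wa wc] : w a = -1 /\ w c = -1 by rewrite -wE; apply: wt_neg; rewrite ?wE ?e.
case: s IH sN e hw => [|s] IH sN e hw.
  have [i iI wi] := cone_theta mw e; rewrite -wE !rel_cst_wt // !(rel_coefE GT TG) wE mw e.
  have [n1 g1 _] := D; have [n1' g1' _] := D'.
  by rewrite n1 n1' (g1 _ _ _ _ i) ?(g1' _ _ _ _ i) // wE.
have [X [sX E0]] := rel_straight D; have [X' [sX' E0']] := rel_straight D'.
apply: (cst_unique qV q1 cone_rigid _ sX _ sX' E0 E0' supp _ IH) => //.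
- exact: rel_cst_deforming.
- exact: rel_cst_deforming.
Qed.

Lemma deformation_unique a c k l m : (a < c)%N -> (k <= l)%N -> (1 <= m)%N -> (m <= N)%N ->
  (m <= N')%N -> inTheta I theta m (wt a c k l) -> Cc k l c a = Cc' k l c a.
Proof.
move=> ac kl m1 mN mN' /TG[mw e].
have h := @rel_cst_agree m.+1 isT _ c a (wt a c k l); have {}h := h _.
have /eqP : cst' c a (wt a c k l) - cst c a (wt a c k l) = 0.
  by apply: homog_gt (h _); rewrite ?e // ltnS leq_min mN mN'.
rewrite subr_eq0 !rel_cst_wt // !(rel_coefE GT TG) mw e m1 mN mN' /= => /eqP.
by move/(congr1 (fun p : {poly CC} => p`_m)); rewrite !coefZ coefXn eqxx !mulr1.
Qed.

End Unique.
End WithCone.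
End Main.

Theorem theorem5p4 (n : nat) (lam b : 'M[CC]_n) (I : {set 'I_n})
    (theta : 'I_n -> weight n) :
  add_alternating lam -> normalized lam -> generic lam ->
  is_biresidue lam b ->
  (forall i, i \in I ->
     exists j : 'I_n, [/\ val j = (val i).+1, smoothable b i j &
                          smoothable_weight b i j (theta i)]) ->
  (exists D : ('I_n -> CC) -> nat * ('I_n -> 'I_n -> 'I_n -> 'I_n -> CC),
     (forall gamma : 'I_n -> CC, (forall i, i \in I -> gamma i != 0) ->
        deformation_data (EExp lam) I theta gamma (D gamma).1 (D gamma).2) /\
     (forall (gamma gamma' : 'I_n -> CC) (e e' : CC),
        (forall i, i \in I -> gamma i != 0) -> (forall i, i \in I -> gamma' i != 0) ->
        e != 0 -> e' != 0 ->
        filtered_iso I theta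
          (spec_eps (rel_ab (EExp lam) I theta (D gamma).1 (D gamma).2) e)
          (spec_eps (rel_ab (EExp lam) I theta (D gamma').1 (D gamma').2) e')))
  /\
  ((forall (m : nat) (a c : 'I_n), (1 <= m)%N -> a != c ->
      ~~ inTheta I theta m (ew a - ew c)) ->
   forall (gamma : 'I_n -> CC) (N N' : nat) (Cc Cc' : 'I_n -> 'I_n -> 'I_n -> 'I_n -> CC),
     (forall i, i \in I -> gamma i != 0) ->
     deformation_data (EExp lam) I theta gamma N Cc ->
     deformation_data (EExp lam) I theta gamma N' Cc' ->
     forall (a c k l : 'I_n) (m : nat),
       (val a < val c)%N -> (val k <= val l)%N ->
       (1 <= m)%N -> (m <= N)%N -> (m <= N')%N ->
       inTheta I theta m (wt a c k l) ->
       Cc k l c a = Cc' k l c a).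
Proof.
move=> lam_alt _ lam_gen b_inv smooth.
have [G [GT TG]] := theta_cone b_inv smooth.
split; last first.
  move=> no_root gamma N N' Cc Cc' _ D D' a c k l m.
  exact: (deformation_unique lam_alt lam_gen b_inv smooth GT TG no_root D D').
have [N [C1 [N1 first fq]]] := deformation_exists lam_alt lam_gen b_inv smooth GT TG.
pose P (gamma t : 'I_n -> CC) := (forall j, t j != 0) /\
  forall i, i \in I -> twt t (theta i) = gamma i.
(* The deformation has to be a function of [gamma], so a torus element realising [gamma] is selected
   by [epsilon]. *)
pose t gamma := ClassicalEpsilon.epsilon (inhabits (fun=> 1)) (P gamma).
have tP gamma : (forall i, i \in I -> gamma i != 0) -> P gamma (t gamma).
  by move=> g0; apply: ClassicalEpsilon.epsilon_spec; apply: (theta_torus b_inv smooth g0).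
exists (fun gamma => (N, twist C1 (t gamma))); split=> /=.
  move=> gamma /tP[t0 tg]; split; [exact: N1| |exact: free_quotient_twist].
  by move=> a c k l i ac kl iI e; rewrite /twist (first _ _ _ _ i) // e tg // mul1r.
move=> gamma gamma' e e' g0 g0' e0 e0'.
have [t0 tg] := tP _ g0; have [t0' tg'] := tP _ g0'.
(* The ratio that [s] must realise on [theta i] in order to turn [gamma i * e] into
   [gamma' i * e']. *)
have gg i : i \in I -> gamma' i * e' / (gamma i * e) != 0.
  by move=> iI; rewrite !mulf_neq0 ?invr_eq0 ?mulf_neq0 ?g0 ?g0'.
have [s [s0 sg]] := theta_torus b_inv smooth gg.
apply: (@filtered_iso_twist _ _ _ _ _ _ _ _ _ _ s) => // i iI.
by rewrite [twt s _](sg _ iI) tg // tg' // mulfVK // mulf_neq0 ?g0.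
Qed.
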